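(* Let $H$ be as in the context. Assume that $x_0$ and $y_0$ are not conjugate along the bicharacteristic $\gamma_0$ issued from $(x_0,\xi^0)$, relative to $H(x,\xi)$. Let $T(x,y)$ be the (locally defined) travel time between $x$ and $y$ in a neighborhood of $(x_0,y_0)$. Then the following holds near $(x_0,y_0)$. (a) $(y,\mathrm d_yT)=\Phi^{T(x,y)}(x,-\mathrm d_xT)$. (b) Further, suppose $x_0\in U$, $y_0\in V$, and let $S$ be the scattering relation relative to the incoming covector $(x_0,\xi^0)$, for which $\langle\mathrm d\rho,H_\xi\rangle\ne0$. Then $$C=\{(x,-\mathrm d_x'T,\,y,\,\mathrm d_y'T)\}$$ (with $x\in U$, $y\in V$ near $x_0,y_0$) is the graph of $S$ in a neighborhood of $(x_0,\xi^0{}',y_0,\eta^0{}')$.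
   Context: $M$ is a smooth manifold with boundary, $\dim M=n\ge2$. $H\in C^\infty(T^*M\setminus0)$ is positive, homogeneous of degree two ($H(x,\lambda\xi)=\lambda^2H(x,\xi)$ for $\lambda>0$), with $\mathrm dH\ne0$ on $\{H=1/2\}$. $\Phi^t$ is the Hamiltonian flow of $X_H=H_\xi\partial_x-H_x\partial_\xi$; its integral curves are bicharacteristics, unit if they lie in $S^*M=\{H=1/2\}$; $|\xi|_x=(2H(x,\xi))^{1/2}$. $(x_0,\xi^0)\in S^*M$, and the unit bicharacteristic $\gamma_0$ issued from it reaches $(y_0,\eta^0)$ at a positive time. Exponential map: $\exp_x\xi=\pi\circ\Phi^1(x,\xi)$, $\pi:T^*M\to M$. A point $y=\exp_x\xi$ is not conjugate to $x$ along the bicharacteristic issued from $(x,\xi)$ if $\exp_x$ is a local diffeomorphism near $\xi$; then $T(x,y)=|\xi|_x$ is the travel time. (For the unit $\xi^0$, non-conjugacy of $x_0,y_0$ refers to the multiple $T_0\xi^0$ with $\exp_{x_0}(T_0\xi^0)=y_0$, $T_0>0$ being the time $\gamma_0$ takes from $x_0$ to $y_0$.) For $(x,y)$ near $(x_0,y_0)$, $T(x,y)$ is the travel time along the unique unit bicharacteristic from $x$ to $y$ issued with codirection near $\xi^0$ and with travel time near $T_0$. For (b): $U,V\subset\partial M$ are disjoint open sets; $\rho$ is a boundary defining function; $\iota^*:T^*M|_{\partial M}\to T^*\partial M$ is restriction of covectors to $T\partial M$, denoted by a prime, so $\mathrm d_x'T$, $\mathrm d_y'T$ are the restrictions of $\mathrm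 d_xT$, $\mathrm d_yT$ to $TU$, $TV$. $(x_0,\xi^0)$ is incoming (i.e. $\langle\mathrm d\rho,H_\xi(x_0,\xi^0)\rangle>0$) and $\gamma_0$ hits $T^*M|_V$ transversally for the first time at $(y_0,\eta^0)$. For $(x,\xi')\in T^*U$ near $(x_0,\xi^0{}')$, let $(x,\xi)$ be the locally unique covector near $(x_0,\xi^0)$ with restriction $\xi'$ and $H(x,\xi)=1/2$; the unit bicharacteristic issued from it hits $T^*M|_V$ transversally at some $(y,\eta)$, and $S(x,\xi')=(y,\eta')$. *)

(* Defs.v *)
From HB Require Import structures.
From mathcomp Require Import all_boot all_order all_algebra.
From mathcomp Require Import all_classical all_reals all_analysis.
Import Order.TTheory GRing.Theory Num.Theory numFieldNormedType.Exports.

Set Implicit Arguments.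
Unset Strict Implicit.
Unset Printing Implicit Defensive.

Local Open Scope classical_set_scope.
Local Open Scope ring_scope.

Section calculus.
Context {R : realType}.

(* C^k regularity, meant for an open A and finite-dimensional V and W. *)
Fixpoint Ck (V W : normedModType R) (k : nat) (A : set V) (f : V -> W) : Prop :=
  if k is k'.+1 then
    (forall a, A a -> differentiable f a) /\
    (forall v, Ck k' A (fun a => 'D_v f a))
  else forall a, A a -> {for a, continuous f}.

(* Smoothness on an arbitrary set: local existence of smooth extensions. *)
Definition smooth_on (V W : normedModType R) (A : set V) (f : V -> W) : Prop :=
  forall a, A a -> exists (O : set V) (g : V -> W),
    [/\ open O, O a, (forall k, Ck k O g) & {in A `&` O, f =1 g}].

Definition has_diff_within (V W : normedModType R) (A : set V) (f : V -> W)
    (a : V) (L : V -> W) : Prop :=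
  (forall k u v, L (k *: u + v) = k *: L u + L v) /\
  (forall e : R, 0 < e ->
    \forall z \near nbhs a, A z -> `|f z - f a - L (z - a)| <= e * `|z - a|).

(* The differential is unique as soon as A contains, near a, a relatively open
   piece of a half-space (or of a nondegenerate interval), which is the case in
   all uses below. *)
Definition diff_within (V W : normedModType R) (A : set V) (f : V -> W)
    (a : V) : V -> W :=
  xget (fun=> 0) [set L | has_diff_within A f a L].

Definition pairing (n : nat) (z v : 'rV[R]_n) : R := \sum_i z 0 i * v 0 i.

(* The coordinate of index 0; for n > 0 the sum has exactly one term. *)
Definition coord0 (n : nat) (z : 'rV[R]_n) : R :=
  \sum_(i < n | i == 0%N :> nat) z 0 i.

Definition half_space (n : nat) : set 'rV[R]_n := [set z | 0 <= coord0 z].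

End calculus.
Arguments half_space {R} n.

Record smooth_manifold (R : realType) (n : nat) (M : topologicalType) := {
  chart : Type ;
  cdom : chart -> set M ;
  cmap : chart -> M -> 'rV[R]_n ;
  cinv : chart -> 'rV[R]_n -> M ;
  manifold_hausdorff : hausdorff_space M ;
  manifold_second_countable : @second_countable M ;
  cdom_open : forall c, open (cdom c) ;
  cdom_cover : forall x, exists c, cdom c x ;
  cimg_open : forall c, exists2 O, open O &
    cmap c @` cdom c = O `&` half_space n ;
  cmapK : forall c x, cdom c x -> cinv c (cmap c x) = x ;
  cmap_continuous : forall c, {within cdom c, continuous (cmap c)} ;
  cinv_continuous : forall c,
    {within cmap c @` cdom c, continuous (cinv c)} ;
  transition_smooth : forall c1 c2,
    smooth_on (cmap c1 @` (cdom c1 `&` cdom c2)) (cmap c2 \o cinv c1)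
}.

Section cotangent.
Context {R : realType} {n : nat} {M : topologicalType}
        (A : smooth_manifold R n M).

Definition chart_image (c : chart A) : set 'rV[R]_n := cmap c @` cdom c.

(* Differential at x of the change of charts from c1 to c2. *)
Definition transition_diff (c1 c2 : chart A) (x : M) : 'rV[R]_n -> 'rV[R]_n :=
  diff_within (cmap c1 @` (cdom c1 `&` cdom c2)) (cmap c2 \o cinv c1)
              (cmap c1 x).

(* A point of T^*M: a base point x and, for every chart around x, the components
   of the covector in that chart, which transform by the transposed differential
   of the change of charts. Components in the other charts are set to 0, so that
   equality of records is equality of covectors. *)
Record cotangent := Cotangent {
  base : M ;
  comp : chart A -> 'rV[R]_n ;
  comp_out : forall c, ~ cdom c base -> comp c = 0 ;
  comp_law : forall c1 c2, cdom c1 base -> cdom c2 base -> forall v,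
    pairing (comp c1) v = pairing (comp c2) (transition_diff c1 c2 base v)
}.

HB.instance Definition _ := gen_eqMixin cotangent.
HB.instance Definition _ := gen_choiceMixin cotangent.

Definition nonzero (p : cotangent) : Prop := exists c, comp p c != 0.

Program Definition covector_scale (k : R) (p : cotangent) : cotangent :=
  @Cotangent (base p) (fun c => k *: comp p c) _ _.
Next Obligation. by move=> k p c /comp_out ->; rewrite scaler0. Qed.
Next Obligation.
have E (z v : 'rV[R]_n) k : pairing (k *: z) v = k * pairing z v.
  by rewrite mulr_sumr; apply: eq_bigr => i _; rewrite mxE mulrA.
by move=> k p c1 c2 h1 h2 v; rewrite !E (comp_law h1 h2).
Qed.

Program Definition zero_covector (x : M) : cotangent :=
  @Cotangent x (fun=> 0) _ _.
Next Obligation. by []. Qed.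
Next Obligation.
have E (v : 'rV[R]_n) : pairing 0 v = 0.
  by apply: big1 => i _; rewrite mxE mul0r.
by move=> x c1 c2 _ _ v; rewrite !E.
Qed.

(* The point of T^*M with coordinates (z, zeta) in the chart induced by c. *)
Definition cotangent_at (c : chart A) (z zeta : 'rV[R]_n) : cotangent :=
  xget (zero_covector (cinv c z))
       [set p | base p = cinv c z /\ comp p c = zeta].

Definition nbhs_cotangent (p : cotangent) (W : set cotangent) : Prop :=
  exists2 c, cdom c (base p) & exists2 e : R, 0 < e &
    forall q, cdom c (base q) -> `|cmap c (base q) - cmap c (base p)| < e ->
      `|comp q c - comp p c| < e -> W q.

(* p is the differential of f at the point base p. *)
Definition is_differential (f : M -> R) (p : cotangent) : Prop :=
  forall c, cdom c (base p) ->
    @has_diff_within R 'rV[R]_n R^o (chart_image c) (f \o cinv c)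
      (cmap c (base p)) (pairing (comp p c)).

Definition boundary : set M :=
  [set x | exists2 c : chart A, cdom c x & coord0 (cmap c x) = 0].

Definition open_in_boundary (U : set M) : Prop :=
  exists2 O, open O & U = O `&` boundary.

(* A point of the cotangent bundle of the boundary. In a chart c, the tangent
   space of the boundary is coord0 v = 0, and a linear form on it is given by a
   row whose entry of index 0 is irrelevant and set to 0. *)
Record bcotangent := BCotangent {
  bbase : M ;
  bbase_boundary : boundary bbase ;
  bcomp : chart A -> 'rV[R]_n ;
  bcomp_out : forall c, ~ cdom c bbase -> bcomp c = 0 ;
  bcomp_coord0 : forall c, coord0 (bcomp c) = 0 ;
  bcomp_law : forall c1 c2, cdom c1 bbase -> cdom c2 bbase ->
    forall v, coord0 v = 0 ->
    pairing (bcomp c1) v = pairing (bcomp c2) (transition_diff c1 c2 bbase v)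
}.

Definition restricts (p : cotangent) (b : bcotangent) : Prop :=
  base p = bbase b /\
  forall c, cdom c (base p) -> forall v, coord0 v = 0 ->
    pairing (bcomp b c) v = pairing (comp p c) v.

Definition nbhs_bcotangent (b : bcotangent) (N : set bcotangent) : Prop :=
  exists2 c, cdom c (bbase b) & exists2 e : R, 0 < e &
    forall b', cdom c (bbase b') -> `|cmap c (bbase b') - cmap c (bbase b)| < e ->
      `|bcomp b' c - bcomp b c| < e -> N b'.

Definition smooth_function (f : M -> R) : Prop :=
  forall c, @smooth_on R 'rV[R]_n R^o (chart_image c) (f \o cinv c).

Definition boundary_defining (rho : M -> R) : Prop :=
  [/\ smooth_function rho,
      forall x, boundary x -> rho x = 0,
      forall x, ~ boundary x -> 0 < rho x &
      forall p, boundary (base p) -> is_differential rho p -> nonzero p].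

End cotangent.

Section hamiltonian.
Context {R : realType} {n : nat} {M : topologicalType}
        {A : smooth_manifold R n M} (H : cotangent A -> R).

Local Notation V := 'rV[R]_n.

(* H in the coordinates (z, zeta) induced by the chart c; only its values on
   phase_image c, i.e. off the zero section, matter. *)
Definition Hchart (c : chart A) (w : V * V) : R :=
  H (cotangent_at c w.1 w.2).

Definition phase_image (c : chart A) : set (V * V)%type :=
  [set w | chart_image c w.1 /\ w.2 != 0].

Definition dHchart (c : chart A) (p : cotangent A) : V * V -> R :=
  @diff_within R (V * V)%type R^o (phase_image c) (Hchart c)
    (cmap c (base p), comp p c).

Definition H_x (c : chart A) (p : cotangent A) : V :=
  \row_i dHchart c p (delta_mx 0 i, 0).

Definition H_xi (c : chart A) (p : cotangent A) : V :=
  \row_i dHchart c p (0, delta_mx 0 i).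

Definition unit_covector (p : cotangent A) : Prop := nonzero p /\ H p = 1 / 2.

Record hamiltonian_conditions : Prop := {
  H_smooth : forall c,
    @smooth_on R (V * V)%type R^o (phase_image c) (Hchart c) ;
  H_positive : forall p, nonzero p -> 0 < H p ;
  H_homogeneous : forall p (k : R), nonzero p -> 0 < k ->
    H (covector_scale k p) = k ^+ 2 * H p ;
  H_regular : forall p c, unit_covector p -> cdom c (base p) ->
    exists w, dHchart c p w != 0
}.

(* Bicharacteristics: integral curves in T^*M \ 0 of
   H_xi d/dx - H_x d/dxi, over the interval [a, b] *)
Definition bicharacteristic (a b : R) (g : R -> cotangent A) : Prop :=
  {within `[a, b], continuous (@base R n M A \o g)} /\
  forall t, `[a, b]%classic t ->
    nonzero (g t) /\
    forall c, cdom c (base (g t)) ->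
      @has_diff_within R R^o (V * V)%type `[a, b]
        (fun s => (cmap c (base (g s)), comp (g s) c)) t
        (fun s => s *: (H_xi c (g t), - H_x c (g t))).

(* The flow, as the graph of a partial map: Phi^t p is defined and equals q *)
Definition flow (t : R) (p q : cotangent A) : Prop :=
  exists g, [/\ bicharacteristic (Num.min 0 t) (Num.max 0 t) g,
                g 0 = p & g t = q].

(* exp_x xi = y for p = (x, xi) *)
Definition expmap (p : cotangent A) (y : M) : Prop :=
  exists2 q, flow 1 p q & base q = y.

(* y = exp_x xi is not conjugate to x along the bicharacteristic issued from
   p = (x, xi): exp_x is a local diffeomorphism near xi. In a chart c around x
   and a chart d around y, exp_x restricted to the part D of its domain lying in
   a neighborhood W of xi is a smooth bijection f, with smooth inverse g, onto a
   neighborhood O of y in M. When y is a boundary point D is not a neighborhood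
   of xi, since the bicharacteristics leaving M are not in the domain. *)
Definition not_conjugate (p : cotangent A) (y : M) : Prop :=
  expmap p y /\
  exists (c d : chart A) (W : set V) (O : set M) (f g : V -> V),
    let x := base p in
    let ex (zeta : V) (y' : M) := expmap (cotangent_at c (cmap c x) zeta) y' in
    let D := [set zeta | W zeta /\ exists y', ex zeta y'] in
    [/\ [/\ cdom c x, open W & W (comp p c)],
        [/\ open O, O y & O `<=` cdom d],
        smooth_on D f /\ smooth_on (cmap d @` O) g,
        forall zeta y', D zeta -> ex zeta y' ->
          [/\ O y', f zeta = cmap d y' & g (f zeta) = zeta] &
        forall z, (cmap d @` O) z -> D (g z) /\ f (g z) = z].

(* t is the travel time from x to y along the unit bicharacteristic issued from
   p, where p is in W and t is within e of T0. *)
Definition travels (W : set (cotangent A)) (T0 e : R) (x y : M)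
    (p : cotangent A) (t : R) : Prop :=
  [/\ W p, unit_covector p, base p = x, `|t - T0| < e &
      exists2 q, flow t p q & base q = y].

(* For all sufficiently small W and e, and for (x, y) near (x0, y0), there is
   exactly one unit bicharacteristic from x to y issued from a covector in W and
   with travel time within e of T0, and T(x, y) is this travel time. *)
Definition local_travel_time (p0 : cotangent A) (y0 : M) (T0 : R)
    (T : M -> M -> R) : Prop :=
  exists W1 : set (cotangent A), nbhs_cotangent p0 W1 /\
  exists2 e1 : R, 0 < e1 &
    forall W e, nbhs_cotangent p0 W -> W `<=` W1 -> 0 < e <= e1 ->
      \forall z \near nbhs (base p0, y0),
        exists2 p, travels W T0 e z.1 z.2 p (T z.1 z.2) &
        forall p' t', travels W T0 e z.1 z.2 p' t' ->
          p' = p /\ t' = T z.1 z.2.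

(* <d rho, H_xi> at p, computed in the chart c *)
Definition drho_Hxi (rho : M -> R) (c : chart A) (p : cotangent A) : R :=
  @diff_within R V R^o (chart_image c) (rho \o cinv c) (cmap c (base p))
    (H_xi c p).

Definition incoming (rho : M -> R) (p : cotangent A) : Prop :=
  forall c, cdom c (base p) -> 0 < drho_Hxi rho c p.

Definition hits_transversally (rho : M -> R) (p : cotangent A) : Prop :=
  forall c, cdom c (base p) -> drho_Hxi rho c p != 0.

(* The bicharacteristic from p0 to q0 meets the boundary at most at its
   endpoints, and transversally. *)
Definition meets_boundary_regularly (rho : M -> R) (p0 q0 : cotangent A)
    (T0 : R) : Prop :=
  [/\ forall t q, 0 < t < T0 -> flow t p0 q -> ~ boundary A (base q),
      boundary A (base p0) -> hits_transversally rho p0 &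
      boundary A (base q0) -> hits_transversally rho q0].

(* Graph of the scattering relation S(x, xi') = (y, eta'); the lift (x, xi) of
   (x, xi') to S^*M is looked for in the set W. A transversal hit at a positive
   time ends the bicharacteristic, since it is contained in M. *)
Definition scattering (rho : M -> R) (U V' : set M) (W : set (cotangent A))
    (b1 b2 : bcotangent A) : Prop :=
  U (bbase b1) /\
  exists p q (t : R),
    [/\ [/\ W p, unit_covector p & restricts p b1],
        0 < t, flow t p q &
        [/\ V' (base q), hits_transversally rho q & restricts q b2]].

Definition canonical_graph (T : M -> M -> R) (U V' : set M)
    (b1 b2 : bcotangent A) : Prop :=
  [/\ U (bbase b1), V' (bbase b2) &
    exists p q,
      [/\ base p = bbase b1 /\ base q = bbase b2,
          is_differential (fun x => T x (base q)) p,
          is_differential (fun y => T (base p) y) q,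
          restricts (covector_scale (-1) p) b1 & restricts q b2]].

End hamiltonian.

(* Main.v *)
From mathcomp Require Import all_boot all_order all_algebra.
From mathcomp Require Import all_classical all_reals all_analysis.
From mathcomp Require Import lra ring.
Require Import Defs.
Import Order.TTheory GRing.Theory Num.Theory numFieldNormedType.Exports.
Set Implicit Arguments.
Unset Strict Implicit.
Unset Printing Implicit Defensive.
Local Open Scope classical_set_scope.
Local Open Scope ring_scope.

(** Scale the unit bicharacteristic to time one: its initial covector becomes
    P0 = T0 p0, and the bicharacteristics joining points near the end points have
    energies T^2 / 2.  Everything rests on the first variation of the action: for
    two bicharacteristics over the time tau, from p to q and from p' to q',

      <q, dy> - <p, dx> - tau (H p' - H p)

    is of second order in the difference of the initial covectors.  By the identity
    of Euler this holds over short times, and it is additive in time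
    (first_variation_short, flow_tame).  When the end points are not conjugate, the
    difference of the initial covectors is bounded by that of the end points
    (endpoint_estimates), and the formula for tau = 1 says that T has differential
    - p in x and q in y, where p and q are the unit covectors at the ends: this is
    (a) (travel_differential).

    The smoothness of the flow is replaced by a weaker property, which is easy to
    propagate and makes sense for relations with an arbitrary domain: second
    differences of the values are bounded by second differences of the arguments
    and products of first differences (tame_rel).  It suffices to carry the
    differentiability of the inverse of the exponential map over to neighbouring
    base points (tame_inversion), also when the end point lies on the boundary and
    the exponential map is defined on one side only.

    Existence of bicharacteristics between given points (exponential_onto) is
    proved by a Newton iteration for the flow, prolonged beyond the boundary at the
    last point (extended_flow).  Transversality ensures that a prolonged
    bicharacteristic whose end point is in M has not left M before.  That integral
    curves computed in one chart are bicharacteristics in all others is the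
    symplectic invariance of the Hamiltonian field (bichar_chart_change).
    Uniqueness is again the estimate of covectors by end points, whence the local
    travel time (travel_time_exists).

    For (b), a covector of the boundary has a unique lift to the unit cosphere
    bundle near p0 because H is strictly monotone in the normal direction
    (boundary_lift).  By (a) the points of C are the restrictions to the boundary of
    pairs p, q such that the bicharacteristic from p reaches q at the time T(x, y),
    hence points of the graph of S.  Conversely, a bicharacteristic from a covector near p0 that hits
    the boundary near y0 does so at a time close to T0 (hitting_time): before, it
    stays away from y0 as the original one does, and after, it has left M.  By
    uniqueness it is then the one that defines the travel time
    (scattering_graph). *)


(** * Linear identities in modules *)

Section module_identities.
Context {R : realType} {V : lmodType R}.

(** Formal linear combinations of the vectors of a list: two of them have the same
    value as soon as they have the same coefficients, which is a matter of ring
    identities. *)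
Inductive mexp :=
  | MVar of nat | MZero | MAdd of mexp & mexp | MOpp of mexp | MScale of R & mexp.

Fixpoint meval (env : seq V) (e : mexp) : V :=
  match e with
  | MVar i => env`_i
  | MZero => 0
  | MAdd a b => meval env a + meval env b
  | MOpp a => - meval env a
  | MScale k a => k *: meval env a
  end.

Fixpoint mcoef (e : mexp) (i : nat) : R :=
  match e with
  | MVar j => if Nat.eqb j i then 1 else 0
  | MZero => 0
  | MAdd a b => mcoef a i + mcoef b i
  | MOpp a => - mcoef a i
  | MScale k a => k * mcoef a i
  end.

Lemma mevalE env e : meval env e = \sum_(i < size env) mcoef e i *: env`_i.
Proof.
elim: e => [j||a IHa b IHb|a IHa|k a IHa] /=; rewrite ?IHa ?IHb.
- have [jn|nj] := ltnP j (size env).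
    rewrite (bigD1 (Ordinal jn)) //= PeanoNat.Nat.eqb_refl scale1r big1 ?addr0// => i.
    by move=> /eqP ij; case: PeanoNat.Nat.eqb_spec => [e|]; rewrite ?scale0r//; case: ij; apply/val_inj.
  rewrite nth_default// big1// => i _.
  case: PeanoNat.Nat.eqb_spec => [e|_]; last by rewrite scale0r.
  by move: nj; rewrite e leqNgt ltn_ord.
- by rewrite big1// => i _; rewrite scale0r.
- by rewrite -big_split; apply: eq_bigr => i _; rewrite scalerDl.
- by rewrite -sumrN; apply: eq_bigr => i _; rewrite scaleNr.
- by rewrite scaler_sumr; apply: eq_bigr => i _; rewrite scalerA.
Qed.

Fixpoint mall (n : nat) (P : nat -> Prop) : Prop :=
  if n is m.+1 then P m /\ mall m P else True.

Lemma meval_eq env e f :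
  mall (size env) (fun i => mcoef e i = mcoef f i) -> meval env e = meval env f.
Proof.
move=> h; rewrite !mevalE; apply: eq_bigr => i _; congr (_ *: _).
elim: (size env) h i => [|m IH] /= h i; first by case: i.
case: h => hm /IH h; have := ltn_ord i; rewrite ltnS leq_eqVlt => /predU1P[->//|im].
exact: (h (Ordinal im)).
Qed.

End module_identities.

Ltac mod_mem x l :=
  lazymatch l with
  | nil => constr:(false)
  | cons x _ => constr:(true)
  | cons _ ?l' => mod_mem x l'
  end.
Ltac mod_atoms l t :=
  lazymatch t with
  | (?a + ?b)%R => let l1 := mod_atoms l a in mod_atoms l1 b
  | (- ?a)%R => mod_atoms l a
  | (?k *: ?a)%R => mod_atoms l a
  | (0)%R => l
  | _ => let b := mod_mem t l in
         lazymatch b with true => l | false => constr:(cons t l) end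
  end.
Ltac mod_index x l :=
  lazymatch l with
  | cons x _ => constr:(0%N)
  | cons _ ?l' => let i := mod_index x l' in constr:(S i)
  end.
Ltac mod_reify R V l t :=
  lazymatch t with
  | (?a + ?b)%R => let x := mod_reify R V l a in let y := mod_reify R V l b in
      constr:(@MAdd R x y)
  | (- ?a)%R => let x := mod_reify R V l a in constr:(@MOpp R x)
  | (?k *: ?a)%R => let x := mod_reify R V l a in constr:(@MScale R k x)
  | (0)%R => constr:(@MZero R)
  | _ => let i := mod_index t l in constr:(@MVar R i)
  end.
Ltac module_eq_over R V :=
  lazymatch goal with
  | |- ?a = ?b =>
    let l0 := mod_atoms (@nil V) a in
    let l := mod_atoms l0 b in
    let x := mod_reify R V l a in
    let y := mod_reify R V l b in
    refine (@meval_eq R V l x y _); cbn [mall size mcoef Nat.eqb];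
    repeat (split; [ring|]); exact I
  end.
Ltac module_eq :=
  match goal with
  | R : realType |- @eq ?T _ _ => 
     let V := constr:([the lmodType R of T : Type]) in
     module_eq_over R V
  end.

(** * Linear maps and differentials within a set *)

Section linear_maps.
Context {R : realType}.
Implicit Types V W X : normedModType R.

Definition islinear V W (L : V -> W) : Prop :=
  forall k u v, L (k *: u + v) = k *: L u + L v.

Section theory.
Variables (V W : normedModType R) (L : V -> W).
Hypothesis linL : islinear L.

Lemma islinear0 : L 0 = 0.
Proof. by have := linL (-1) 0 0; rewrite !scaler0 addr0 scaleN1r addNr. Qed.

Lemma islinearZ k u : L (k *: u) = k *: L u.
Proof. by have := linL k u 0; rewrite addr0 islinear0 addr0. Qed.

Lemma islinearD u v : L (u + v) = L u + L v.
Proof. by have := linL 1 u v; rewrite !scale1r. Qed.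

Lemma islinearN u : L (- u) = - L u.
Proof. by rewrite -scaleN1r islinearZ scaleN1r. Qed.

Lemma islinearB u v : L (u - v) = L u - L v.
Proof. by rewrite islinearD islinearN. Qed.

Lemma islinear_sum (I : Type) (r : seq I) (P : pred I) (F : I -> V) :
  L (\sum_(i <- r | P i) F i) = \sum_(i <- r | P i) L (F i).
Proof.
elim/big_rec2: _ => [|i y x _ <-]; first exact: islinear0.
by rewrite islinearD.
Qed.

End theory.

(** A frame with bounded coordinates: all that the estimates need to know about
    the finite dimension of a normed space. *)
Class finite_frame V : Prop := finite_frameP :
  exists (I : finType) (e : I -> V) (k : I -> V -> R),
    forall v, v = \sum_i k i v *: e i /\ forall i, `|k i v| <= `|v|.

#[global] Instance finite_frame_R : finite_frame (R^o : normedModType R).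
Proof.
exists unit, (fun=> 1), (fun _ v => v) => v; split => //.
by rewrite (big_pred1 tt) /= ?[_ *: _]mulr1//; case.
Qed.

#[global] Instance finite_frame_prod V W :
  finite_frame V -> finite_frame W ->
  finite_frame ((V * W)%type : normedModType R).
Proof.
move=> [I [e [k ek]]] [J [f [l fl]]].
exists (I + J)%type, (fun s => match s with inl i => (e i, 0) | inr j => (0, f j) end),
  (fun s v => match s with inl i => k i v.1 | inr j => l j v.2 end) => -[v w]; split.
- rewrite big_sumType /=.
  have -> : \sum_i k i v *: (e i, 0 : W) = (v, 0).
    rewrite [in RHS](ek v).1; apply: (big_ind2 (fun (x : V * W) y => x = (y, 0))) => //.
      by move=> _ x _ y -> ->; rewrite -[LHS]/(x + y, 0 + 0) addr0.
    by move=> i _; rewrite -[LHS]/(k i v *: e i, k i v *: 0) scaler0.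
  have -> : \sum_i l i w *: (0 : V, f i) = (0, w).
    rewrite [in RHS](fl w).1; apply: (big_ind2 (fun (x : V * W) y => x = (0, y))) => //.
      by move=> _ x _ y -> ->; rewrite -[LHS]/(0 + 0, x + y) addr0.
    by move=> i _; rewrite -[LHS]/(l i w *: 0, l i w *: f i) scaler0.
  by rewrite -[RHS]/(v + 0, 0 + w) addr0 add0r.
- case=> [i|j] /=; rewrite /Num.norm /= le_max.
    by rewrite (ek v).2.
  by rewrite (fl w).2 orbT.
Qed.

Lemma row_entry_le n (v : 'rV[R]_n) i : `|v 0 i| <= `|v|.
Proof.
rewrite /Num.norm /= mx_normrE.
by rewrite (le_bigmax_cond _ (fun ij : 'I_1 * 'I_n => `|v ij.1 ij.2|) (j := (0, i))).
Qed.

Lemma row_norm_le n (v : 'rV[R]_n) e :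
  0 <= e -> (forall i, `|v 0 i| <= e) -> `|v| <= e.
Proof.
move=> e0 h; rewrite /Num.norm /= mx_normrE; apply: bigmax_le => // -[i j] _ /=.
by rewrite ord1.
Qed.

#[global] Instance finite_frame_row n : finite_frame ('rV[R]_n : normedModType R).
Proof.
exists 'I_n, (fun i => delta_mx 0 i), (fun i (v : 'rV[R]_n) => v 0 i) => v; split.
  exact: row_sum_delta.
by move=> i; exact: row_entry_le.
Qed.

Lemma islinear_bounded V W (L : V -> W) : finite_frame V -> islinear L ->
  exists2 C, 0 < C & forall v, `|L v| <= C * `|v|.
Proof.
move=> [I [e [k ek]]] linL; exists (\sum_i `|L (e i)| + 1).
  by rewrite ltr_wpDl// sumr_ge0.
move=> v; rewrite [in `|L v|](ek v).1 islinear_sum//.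
rewrite (le_trans (ler_norm_sum _ _ _))// mulrDl mul1r ler_wpDr// mulr_suml.
apply: ler_sum => i _; rewrite islinearZ// normrZ mulrC ler_wpM2l//.
exact: (ek v).2.
Qed.

Lemma pair_norm V W (v : V) (w : W) : `|(v, w)| = Num.max `|v| `|w|.
Proof. by []. Qed.

Lemma pair_fst_le V W (x : V * W) : `|x.1| <= `|x|.
Proof. by rewrite [`|x|]/Num.norm /= le_max lexx. Qed.

Lemma pair_snd_le V W (x : V * W) : `|x.2| <= `|x|.
Proof. by rewrite [`|x|]/Num.norm /= le_max lexx orbT. Qed.

Lemma pair_norm_le V W (x : V * W) e : `|x.1| <= e -> `|x.2| <= e -> `|x| <= e.
Proof. by move=> h1 h2; rewrite /Num.norm /= ge_max h1 h2. Qed.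

Lemma pair_norm_lt V W (x : V * W) e : `|x.1| < e -> `|x.2| < e -> `|x| < e.
Proof. by move=> h1 h2; rewrite [`|x|]/Num.norm /= gt_max h1 h2. Qed.

Lemma near_normP V (a : V) (P : set V) :
  nbhs a P <-> exists2 d : R, 0 < d & forall z, `|z - a| < d -> P z.
Proof.
split=> [/nbhs_ballP[d /= d0 h]|[d d0 h]].
  by exists d => // z hz; apply: h; rewrite -ball_normE /= distrC.
by apply/nbhs_ballP; exists d => //= z; rewrite -ball_normE /= distrC; exact: h.
Qed.

Lemma small_norm_eq0 V (x : V) (c : R) : 0 <= c ->
  (forall e, 0 < e -> `|x| <= e * c) -> x = 0.
Proof.
move=> c0 h; apply/eqP; rewrite -normr_le0; apply/ler_addgt0Pl => e e0.
rewrite addr0; have := h (e / (c + 1)); have c1 : 0 < c + 1 by rewrite ltr_wpDl.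
move=> /(_ (divr_gt0 e0 c1))/le_trans; apply.
by rewrite mulrAC ler_pdivrMr// ler_wpM2l ?(ltW e0)// lerDl.
Qed.

End linear_maps.

Section differential_within.
Context {R : realType}.
Implicit Types V W X : normedModType R.

Lemma has_diff_withinP V W (A : set V) (f : V -> W) a L :
  has_diff_within A f a L <-> islinear L /\
  forall e, 0 < e -> exists2 d, 0 < d &
    forall z, `|z - a| < d -> A z -> `|f z - f a - L (z - a)| <= e * `|z - a|.
Proof. by split=> -[h1 h2]; split=> // e /h2 /near_normP. Qed.

Lemma hdw_local V W (A B : set V) (f g : V -> W) a L d : 0 < d ->
  (forall z, `|z - a| < d -> B z -> A z /\ f z = g z) -> f a = g a ->
  has_diff_within A f a L -> has_diff_within B g a L.
Proof.
move=> d0 h fg /has_diff_withinP[linL hL]; apply/has_diff_withinP; split=> // e e0.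
have [d' d'0 h'] := hL e e0; exists (Num.min d d'); first by rewrite lt_min d0.
by move=> z; rewrite lt_min => /andP[z1 z2] /(h _ z1)[Az <-]; rewrite -fg; exact: h'.
Qed.

Lemma hdw_sub V W (A B : set V) (f : V -> W) a L :
  B `<=` A -> has_diff_within A f a L -> has_diff_within B f a L.
Proof. by move=> BA; apply: hdw_local (@ltr01 R) _ _ => // z _ /BA. Qed.

Lemma hdw_bound V W (A : set V) (f : V -> W) a L : finite_frame V ->
  has_diff_within A f a L -> exists C d, [/\ 0 < C, 0 < d &
    forall z, `|z - a| < d -> A z -> `|f z - f a| <= C * `|z - a|].
Proof.
move=> fV /has_diff_withinP[linL hL].
have [C C0 hC] := islinear_bounded fV linL.
have [d d0 hd] := hL 1 ltr01; exists (1 + C), d; split=> //; first by rewrite addr_gt0.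
move=> z zd Az; rewrite -[f z - f a](subrK (L (z - a))).
by rewrite (le_trans (ler_normD _ _))// mulrDl lerD// hd.
Qed.

Lemma hdw_comp V W X (A : set V) (B : set W) (f : V -> W) (g : W -> X) a L K :
  finite_frame V -> finite_frame W ->
  has_diff_within A f a L -> has_diff_within B g (f a) K ->
  (exists2 d, 0 < d & forall z, `|z - a| < d -> A z -> B (f z)) ->
  has_diff_within A (g \o f) a (K \o L).
Proof.
move=> fV fW hf hg [d0 d00 AB].
have [C [d1 [C0 d10 hC]]] := hdw_bound fV hf.
move: hf hg => /has_diff_withinP[linL hL] /has_diff_withinP[linK hK].
have [D D0 hD] := islinear_bounded fW linK.
apply/has_diff_withinP; split=> [k u v /=|e e0]; first by rewrite linL linK.
have [d2 d20 h2] := hL (e / 2 / D) ltac:(by rewrite !divr_gt0).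
have [d3 d30 h3] := hK (e / 2 / C) ltac:(by rewrite !divr_gt0).
exists (Num.min (Num.min d0 d1) (Num.min d2 (d3 / C))).
  by rewrite !lt_min d00 d10 d20 divr_gt0.
move=> z; rewrite !lt_min => /andP[/andP[z0 z1] /andP[z2 z3]] Az /=.
have fz := hC _ z1 Az.
have -> : g (f z) - g (f a) - K (L (z - a)) =
  (g (f z) - g (f a) - K (f z - f a)) + K (f z - f a - L (z - a)).
  by rewrite (islinearB linK (f z - f a)) addrA subrK.
rewrite (le_trans (ler_normD _ _))// (splitr e) mulrDl lerD//.
  have : `|f z - f a| < d3.
    by rewrite (le_lt_trans fz)// mulrC -ltr_pdivlMr.
  move=> /h3/(_ (AB _ z0 Az))/le_trans; apply.
  rewrite mulrAC ler_pdivrMr// -[leRHS]mulrA ler_wpM2l ?divr_ge0 ?(ltW e0)//.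
  by rewrite mulrC.
rewrite (le_trans (hD _))// mulrC -ler_pdivlMr// mulrAC.
exact: h2.
Qed.

Lemma hdw_cst V W (A : set V) (c : W) a : has_diff_within A (fun=> c) a (fun=> 0).
Proof.
apply/has_diff_withinP; split=> [k u v|e e0]; first by rewrite scaler0 addr0.
by exists 1 => // z _ _; rewrite subrr subr0 normr0 mulr_ge0// ltW.
Qed.

Lemma hdw_linear V W (A : set V) (L : V -> W) a :
  islinear L -> has_diff_within A L a L.
Proof.
move=> linL; apply/has_diff_withinP; split=> // e e0.
by exists 1 => // z _ _; rewrite islinearB// subrr normr0 mulr_ge0// ltW.
Qed.

Lemma hdwD V W (A : set V) (f g : V -> W) a L K :
  has_diff_within A f a L -> has_diff_within A g a K ->
  has_diff_within A (fun z => f z + g z) a (fun v => L v + K v).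
Proof.
move=> /has_diff_withinP[linL hL] /has_diff_withinP[linK hK].
apply/has_diff_withinP; split=> [k u v|e e0].
  by rewrite linL linK scalerDr addrACA.
have [d1 d10 h1] := hL (e / 2) ltac:(by rewrite divr_gt0).
have [d2 d20 h2] := hK (e / 2) ltac:(by rewrite divr_gt0).
exists (Num.min d1 d2); first by rewrite lt_min d10.
move=> z; rewrite lt_min => /andP[z1 z2] Az.
have -> : f z + g z - (f a + g a) - (L (z - a) + K (z - a)) =
   (f z - f a - L (z - a)) + (g z - g a - K (z - a)) by module_eq.
by rewrite (le_trans (ler_normD _ _))// (splitr e) mulrDl lerD// ?h1// h2.
Qed.

Lemma hdwZ V W (A : set V) (f : V -> W) a L c :
  has_diff_within A f a L ->
  has_diff_within A (fun z => c *: f z) a (fun v => c *: L v).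
Proof.
move=> /has_diff_withinP[linL hL]; apply/has_diff_withinP; split=> [k u v|e e0].
  by rewrite linL scalerDr !scalerA mulrC.
have c1 : 0 < `|c| + 1 by rewrite ltr_wpDl.
have [d d0 h] := hL (e / (`|c| + 1)) ltac:(by rewrite divr_gt0).
exists d => // z zd Az; rewrite -!scalerBr normrZ.
rewrite (le_trans (ler_wpM2l _ (h _ zd Az)))// mulrA ler_wpM2r//.
by rewrite mulrCA ler_piMr// ?ltW// ltr_pdivrMr// mul1r ltrDl.
Qed.

Lemma hdw_pair V W X (A : set V) (f : V -> W) (g : V -> X) a L K :
  has_diff_within A f a L -> has_diff_within A g a K ->
  has_diff_within A (fun z => (f z, g z)) a (fun v => (L v, K v)).
Proof.
move=> /has_diff_withinP[linL hL] /has_diff_withinP[linK hK].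
apply/has_diff_withinP; split=> [k u v|e e0]; first by rewrite linL linK.
have [d1 d10 h1] := hL e e0; have [d2 d20 h2] := hK e e0.
exists (Num.min d1 d2); first by rewrite lt_min d10.
move=> z; rewrite lt_min => /andP[z1 z2] Az.
by apply: pair_norm_le; [exact: h1|exact: h2].
Qed.

Lemma hdw_fst V W X (A : set V) (f : V -> W * X) a L :
  has_diff_within A f a L ->
  has_diff_within A (fun z => (f z).1) a (fun v => (L v).1).
Proof.
move=> /has_diff_withinP[linL hL]; apply/has_diff_withinP; split=> [k u v|e e0].
  by rewrite linL.
have [d d0 h] := hL e e0; exists d => // z zd Az.
exact: le_trans (pair_fst_le (f z - f a - L (z - a))) (h _ zd Az).
Qed.

Lemma differentiable_hdw V W (A : set V) (f : V -> W) a :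
  differentiable f a -> has_diff_within A f a (fun v => 'D_v f a).
Proof.
move=> df.
have -> : (fun v => 'D_v f a) = 'd f a by apply/funext => v; rewrite deriveE.
apply/has_diff_withinP; split=> [k u v|e e0]; first by rewrite linearP.
have [_ /eqaddoP h] := (diff_locallyP a f).1 df.
have /near_normP[d d0 hd] := h e e0.
exists d => // z zd _.
have := hd (z - a); rewrite subr0 => /(_ zd) /=.
have -> : (f \o shift a - (cst (f a) + 'd f a)) (z - a) = f z - f a - 'd f a (z - a).
  by rewrite !fctE /= subrK opprD addrA.
by [].
Qed.

(** What makes a differential within A at a unique: points of A accumulate at a on
    every line through a. *)
Definition accessible V (A : set V) (a : V) : Prop :=
  forall v d, 0 < d -> exists s : R, [/\ s != 0, `|s| < d & A (a + s *: v)].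

Lemma hdw_unique V W (A : set V) (f : V -> W) a L K : accessible A a ->
  has_diff_within A f a L -> has_diff_within A f a K -> L = K.
Proof.
move=> acc /has_diff_withinP[linL hL] /has_diff_withinP[linK hK].
apply/funext => v; apply/eqP; rewrite -subr_eq0; apply/eqP.
apply: (@small_norm_eq0 _ _ _ (`|v|)) => // e e0.
have [d1 d10 h1] := hL (e / 2) ltac:(by rewrite divr_gt0).
have [d2 d20 h2] := hK (e / 2) ltac:(by rewrite divr_gt0).
have v1 : 0 < `|v| + 1 by rewrite ltr_wpDl.
have [s [s0]] := acc v (Num.min d1 d2 / (`|v| + 1)) ltac:(by rewrite divr_gt0// lt_min d10).
rewrite ltr_pdivlMr// => sd As.
have sv : `|a + s *: v - a| < Num.min d1 d2.
  by rewrite addrC addKr normrZ (le_lt_trans _ sd)// ler_wpM2l// lerDl.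
move: sv; rewrite lt_min => /andP[/h1/(_ As) + /h2/(_ As)].
rewrite [a + _]addrC addrK normrZ (islinearZ linL) (islinearZ linK) => k1 k2.
rewrite -(ler_pM2l (x := `|s|)) ?normr_gt0// -normrZ scalerBr mulrCA.
set x := s *: L v in k1 *; set y := s *: K v in k2 *; set F := (X in `|X - x|) in k1.
have -> : x - y = (F - y) - (F - x) by module_eq.
by rewrite (le_trans (ler_normB _ _))// (splitr e) mulrDl lerD.
Qed.

Lemma diff_withinE V W (A : set V) (f : V -> W) a L : accessible A a ->
  has_diff_within A f a L -> diff_within A f a = L.
Proof.
move=> acc h; rewrite /diff_within; case: xgetP => [y _ /= hy|/(_ L)//].
exact: hdw_unique acc hy h.
Qed.

End differential_within.

(** * Real induction and curves *)

Section curves.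
Context {R : realType}.
Implicit Types V W X : normedModType R.

(** At the infimum of the points where P fails, P holds by the first clause, and
    then it holds slightly beyond by the second one. *)
Lemma real_induction (a b : R) (P : R -> Prop) :
  (forall t, a <= t <= b -> (forall s, a <= s < t -> P s) -> P t) ->
  (forall t, a <= t < b -> (forall s, a <= s <= t -> P s) ->
     exists2 e : R, 0 < e & forall s, t < s < t + e -> s <= b -> P s) ->
  forall t, a <= t <= b -> P t.
Proof.
move=> hl hr t tab; apply: contrapT => nPt.
pose S := [set s | a <= s <= b /\ ~ P s].
have S0 : S !=set0 by exists t.
have Slb : has_lbound S by exists a => s [/andP[]].
have am : a <= inf S by apply: lb_le_inf => // s [/andP[]].
have mt : inf S <= t by apply: ge_inf.
have below s : a <= s < inf S -> P s.
  move=> /andP[as_ sm]; apply: contrapT => nPs.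
  have : inf S <= s.
    apply: ge_inf => //; split=> //; rewrite as_ /=.
    by rewrite (le_trans (ltW sm))// (le_trans mt)//; case/andP: tab.
  by rewrite leNgt sm.
have Pm : P (inf S).
  by apply: hl below; rewrite am (le_trans mt)//; case/andP: tab.
have ltb : inf S < t.
  by rewrite lt_neqAle mt andbT; apply/eqP => mE; apply: nPt; rewrite -mE.
have [|s|e e0 he] := hr (inf S).
- by rewrite am (lt_le_trans ltb)//; case/andP: tab.
- by rewrite [s <= _]le_eqVlt => /andP[as_ /orP[/eqP->//|sm]]; apply: below; rewrite as_.
have : inf S + e <= inf S.
  apply: lb_le_inf => // s [/andP[as_ sb] nPs]; rewrite leNgt; apply/negP => se.
  apply: nPs; have [sm|sm|->//] := ltgtP s (inf S); first by apply: below; rewrite as_.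
  by apply: he => //; rewrite sm.
by rewrite gerDl leNgt e0.
Qed.

Definition deriv_on W (a b : R) (u v : R -> W) : Prop :=
  forall t, a <= t <= b -> forall e : R, 0 < e -> exists2 d : R, 0 < d &
    forall s, a <= s <= b -> `|s - t| < d ->
      `|u s - u t - (s - t) *: v t| <= e * `|s - t|.

Lemma deriv_onP W a b (u v : R -> W) :
  deriv_on a b u v <-> forall t, a <= t <= b ->
    @has_diff_within R R^o W `[a, b] u t (fun s => s *: v t).
Proof.
split=> [h t tab|h t tab e e0].
  apply/has_diff_withinP; split=> [k x y|e e0].
    by rewrite scalerDl scalerA.
  have [d d0 hd] := h t tab e e0; exists d => // s sd; rewrite /= in_itv /= => sab.
  exact: hd.
have /has_diff_withinP[_ /(_ e e0)[d d0 hd]] := h t tab; exists d => // s sab sd.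
by apply: hd => //=; rewrite in_itv.
Qed.

Lemma deriv_on_sub W a b c d (u v : R -> W) :
  a <= c -> d <= b -> deriv_on a b u v -> deriv_on c d u v.
Proof.
move=> ac db h t /andP[ct td] e e0.
have [|r r0 hr] := h t _ e e0; first by rewrite (le_trans ac ct) (le_trans td db).
exists r => // s /andP[cs sd]; apply: hr.
by rewrite (le_trans ac cs) (le_trans sd db).
Qed.

Lemma deriv_on_ext W a b (u v u' v' : R -> W) :
  (forall t, a <= t <= b -> u t = u' t /\ v t = v' t) ->
  deriv_on a b u v -> deriv_on a b u' v'.
Proof.
move=> E h t tab e e0; have [d d0 hd] := h t tab e e0; exists d => // s sab sd.
by rewrite -(E _ sab).1 -(E _ tab).1 -(E _ tab).2; exact: hd.
Qed.

Lemma deriv_onB W a b (u v u' v' : R -> W) :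
  deriv_on a b u v -> deriv_on a b u' v' ->
  deriv_on a b (fun t => u t - u' t) (fun t => v t - v' t).
Proof.
move=> h h' t tab e e0.
have [d d0 hd] := h t tab (e / 2) ltac:(by rewrite divr_gt0).
have [d' d'0 hd'] := h' t tab (e / 2) ltac:(by rewrite divr_gt0).
exists (Num.min d d'); first by rewrite lt_min d0.
move=> s sab; rewrite lt_min => /andP[/(hd _ sab) h1 /(hd' _ sab) h2].
have -> : u s - u' s - (u t - u' t) - (s - t) *: (v t - v' t) =
   (u s - u t - (s - t) *: v t) - (u' s - u' t - (s - t) *: v' t) by module_eq.
by rewrite (le_trans (ler_normB _ _))// (splitr e) mulrDl lerD.
Qed.

Lemma deriv_on_comp W X a b (u v : R -> W) (B : set W) (f : W -> X) (L : R -> W -> X) :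
  finite_frame W ->
  deriv_on a b u v ->
  (forall t, a <= t <= b -> B (u t) /\ has_diff_within B f (u t) (L t)) ->
  deriv_on a b (fun t => f (u t)) (fun t => L t (v t)).
Proof.
move=> fW /deriv_onP h hL; apply/deriv_onP => t tab.
have [But hLt] := hL t tab; have linL := hLt.1.
have -> : (fun s => s *: L t (v t)) = L t \o (fun s => s *: v t).
  by apply/funext => s /=; rewrite (islinearZ linL).
apply: hdw_comp hLt _ => //; first exact: h.
exists 1 => // z _ /=; rewrite in_itv /= => zab; exact: (hL z zab).1.
Qed.

Lemma deriv_on_continuous W a b (u v : R -> W) t (e : R) :
  deriv_on a b u v -> a <= t <= b -> 0 < e ->
  exists2 d : R, 0 < d & forall s, a <= s <= b -> `|s - t| < d -> `|u s - u t| < e.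
Proof.
move=> h tab e0; have [d d0 hd] := h t tab 1 ltr01.
have k0 : 0 < 1 + `|v t| by rewrite ltr_wpDr.
exists (Num.min d (e / (1 + `|v t|))); first by rewrite lt_min d0 divr_gt0.
move=> s sab; rewrite lt_min => /andP[/(hd _ sab) h1 h2].
rewrite -[u s - u t](subrK ((s - t) *: v t)) (le_lt_trans (ler_normD _ _))//.
rewrite (le_lt_trans (lerD h1 (lexx _)))// normrZ.
by rewrite mulrC -mulrDr -ltr_pdivlMr.
Qed.

Lemma deriv_on_within_continuous W a b (u v : R -> W) :
  deriv_on a b u v -> {within `[a, b], continuous u}.
Proof.
move=> h; apply/subspace_continuousP => t; rewrite /= in_itv /= => tab.
apply/cvgrPdist_lt => e e0.
have [d d0 hd] := deriv_on_continuous h tab e0.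
apply/nbhs_ballP; exists d => //= s; rewrite -ball_normE /= distrC => st.
by rewrite in_itv /= => sab; rewrite distrC; exact: hd.
Qed.

(** For every e > 0 the bound with K + e propagates along the interval by real
    induction. *)
Lemma mean_value W a b (u v : R -> W) (K : R) : a <= b ->
  deriv_on a b u v -> (forall t, a <= t <= b -> `|v t| <= K) ->
  `|u b - u a| <= K * (b - a).
Proof.
move=> ab h vK.
suff H e : 0 < e -> forall t, a <= t <= b -> `|u t - u a| <= (K + e) * (t - a).
  have [->|nab] := eqVneq a b; first by rewrite !subrr normr0 mulr0.
  have ba : 0 < b - a by rewrite subr_gt0 lt_neqAle nab.
  rewrite -ler_pdivrMr//; apply/ler_addgt0Pr => e e0; rewrite ler_pdivrMr//.
  by apply: H => //; rewrite ab lexx.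
move=> e0.
have step t s : a <= t <= b -> a <= s <= b ->
    `|u s - u t - (s - t) *: v t| <= e * `|s - t| -> `|u s - u t| <= (K + e) * `|s - t|.
  move=> tab sab st; rewrite -[u s - u t](subrK ((s - t) *: v t)).
  rewrite (le_trans (ler_normD _ _))// addrC mulrDl lerD// normrZ mulrC ler_wpM2r//.
  exact: vK.
apply: real_induction => t tab IH.
  have [->|nat] := eqVneq t a; first by rewrite !subrr normr0 mulr0.
  have {nat}at_ : a < t by rewrite lt_neqAle eq_sym nat; case/andP: tab.
  have [d d0 hd] := h t tab e e0.
  pose s := Num.max a (t - d / 2).
  have st : s < t by rewrite gt_max at_ ltrBlDr ltrDl divr_gt0.
  have as_ : a <= s by rewrite le_max lexx.
  have sab : a <= s <= b by rewrite as_ (le_trans (ltW st))//; case/andP: tab.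
  have std : `|s - t| < d.
    rewrite distrC gtr0_norm ?subr_gt0// ltrBlDr -ltrBlDl lt_max; apply/orP; right.
    by rewrite ltrD2l ltrN2 ltr_pdivrMr// ltr_pMr// ltr1n.
  have h1 := step _ _ tab sab (hd _ sab std).
  have h2 := IH s ltac:(by rewrite as_ st).
  have tri := ler_normB (u s - u a) (u s - u t).
  rewrite (_ : u s - u a - _ = u t - u a) in tri; last by module_eq.
  move: h1; rewrite distrC [`|s - t|]distrC [`|t - s|]gtr0_norm ?subr_gt0//.
  by rewrite distrC => h1; lra.
have tab' : a <= t <= b by case/andP: tab => -> /ltW.
have [d d0 hd] := h t tab' e e0; exists d => // s /andP[ts std] sb.
have sab : a <= s <= b by rewrite sb andbT (le_trans _ (ltW ts))//; case/andP: tab.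
have h1 : `|u s - u t| <= (K + e) * `|s - t|.
  by apply: step => //; apply: hd => //; rewrite gtr0_norm ?subr_gt0// ltrBlDl.
have h2 := IH t ltac:(by rewrite lexx andbT; case/andP: tab).
rewrite -[u s - u a](subrK (u t - u a)) (_ : _ - (u t - u a) = u s - u t); last by module_eq.
rewrite (le_trans (ler_normD _ _))//.
rewrite (_ : (K + e) * (s - a) = (K + e) * (s - t) + (K + e) * (t - a)); last by ring.
by rewrite lerD// -[s - t]gtr0_norm ?subr_gt0.
Qed.

(** The interval is so short that the growth is absorbed by one half of the
    maximum of the norm of u, which is attained. *)
Lemma gronwall W a b (u v : R -> W) (L k : R) : 0 <= L -> 0 <= k ->
  L * (b - a) <= 1 / 2 -> deriv_on a b u v ->
  (forall t, a <= t <= b -> `|v t| <= L * `|u t| + k) ->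
  forall t, a <= t <= b -> `|u t| <= 2 * `|u a| + 2 * k * (b - a).
Proof.
move=> L0 k0 Lab h hv t tab; have ab : a <= b by case/andP: tab => /le_trans; apply.
have /(EVT_max ab)[c] : {within `[a, b], continuous (fun t => `|u t|)}.
  move=> x; apply: continuous_comp; last exact: norm_continuous.
  exact: deriv_on_within_continuous h x.
rewrite in_itv /= => /andP[ac cb] hc.
have mv : `|u c - u a| <= (L * `|u c| + k) * (c - a).
  apply: (@mean_value _ _ _ _ v) => //; first exact: deriv_on_sub h.
  move=> s /andP[as_ sc]; have sab : a <= s <= b by rewrite as_ (le_trans sc).
  by rewrite (le_trans (hv s sab))// lerD2r ler_wpM2l// hc// in_itv.
have {}hc := hc t; rewrite in_itv /= in hc; have {}hc := hc tab.
have : `|u c| <= `|u a| + (L * `|u c| + k) * (b - a).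
  rewrite -[u c in leLHS](subrK (u a)) addrC (le_trans (ler_normD _ _))// lerD2l.
  rewrite (le_trans mv)// ler_wpM2l ?addr_ge0 ?mulr_ge0//.
  by rewrite lerD2r.
have : 0 <= `|u c| by [].
by move: (`|u c|) hc => U hc U0; nra.
Qed.

End curves.

(** * Tame maps and relations *)

Section tame.
Context {R : realType}.
Implicit Types V W X : normedModType R.

(** Second differences of a map of class C^2 are controlled by those of its
    arguments, up to a product of first differences.  This is the only form in
    which smoothness with respect to initial conditions is used below: unlike
    differentiability of the flow, it follows from an a priori estimate and is
    meaningful for relations with an arbitrary domain. *)
Definition tame_rel V W (P : V -> W -> Prop) (w0 : V) : Prop :=
  exists K : R, 0 < K /\ forall w1 w2 w3 w4 y1 y2 y3 y4,
    `|w1 - w0| < K^-1 -> `|w2 - w0| < K^-1 ->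
    `|w3 - w0| < K^-1 -> `|w4 - w0| < K^-1 ->
    P w1 y1 -> P w2 y2 -> P w3 y3 -> P w4 y4 ->
    `|y1 - y2 - (y3 - y4)| <=
       K * (`|w1 - w2 - (w3 - w4)| + `|w1 - w2| * (`|w1 - w3| + `|w2 - w4|)).

Definition tame V W (f : V -> W) (w0 : V) : Prop := tame_rel (fun w y => y = f w) w0.

(** The second difference of w1, w2, w2, w2 is a first difference. *)
Lemma tame_lip V W (P : V -> W -> Prop) w0 : tame_rel P w0 ->
  exists K : R, 0 < K /\ forall w1 w2 y1 y2,
    `|w1 - w0| < K^-1 -> `|w2 - w0| < K^-1 -> P w1 y1 -> P w2 y2 ->
    `|y1 - y2| <= K * `|w1 - w2|.
Proof.
move=> [K [K0 hK]]; exists (K + 2); split; first by rewrite addr_gt0.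
have K2 : (K + 2)^-1 <= K^-1 by rewrite lef_pV2 ?posrE ?addr_gt0// lerDl.
move=> w1 w2 y1 y2 h1 h2 p1 p2.
have h1' := lt_le_trans h1 K2; have h2' := lt_le_trans h2 K2.
have := hK _ _ _ _ _ _ _ _ h1' h2' h2' h2' p1 p2 p2 p2.
rewrite !subrr !subr0 normr0 addr0.
have : `|w1 - w2| <= 2 * K^-1.
  rewrite (_ : w1 - w2 = w1 - w0 - (w2 - w0)); last by module_eq.
  by rewrite (le_trans (ler_normB _ _))// mulr_natl mulr2n lerD// ltW.
move=> h12 /le_trans; apply; have := ler_wpM2l (ltW K0) h12.
rewrite mulrCA divff ?gt_eqF// mulr1; have := normr_ge0 (w1 - w2); nra.
Qed.

Lemma tame_near V W (P : V -> W -> Prop) w0 y0 (e : R) : tame_rel P w0 -> P w0 y0 ->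
  0 < e -> exists2 d : R, 0 < d & forall w y, `|w - w0| < d -> P w y -> `|y - y0| < e.
Proof.
move=> /tame_lip[K [K0 hK]] P0 e0; exists (Num.min K^-1 (e / K)).
  by rewrite lt_min invr_gt0 K0 divr_gt0.
move=> w y; rewrite lt_min => /andP[h1 h2] Pw.
have w00 : `|w0 - w0| < K^-1 by rewrite subrr normr0 invr_gt0.
by rewrite (le_lt_trans (hK _ _ _ _ h1 w00 Pw P0))// mulrC -ltr_pdivlMr.
Qed.

Lemma tame_rel_sub V W (P Q : V -> W -> Prop) w0 (d : R) : 0 < d ->
  (forall w y, `|w - w0| < d -> Q w y -> P w y) -> tame_rel P w0 -> tame_rel Q w0.
Proof.
move=> d0 QP [K [K0 hK]]; exists (K + d^-1); split; first by rewrite addr_gt0 ?invr_gt0.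
have k1 : (K + d^-1)^-1 <= K^-1.
  by rewrite lef_pV2 ?posrE ?addr_gt0 ?invr_gt0// lerDl invr_ge0 ltW.
have k2 : (K + d^-1)^-1 <= d.
  by rewrite invf_ple ?posrE ?addr_gt0 ?invr_gt0// lerDr ltW.
move=> w1 w2 w3 w4 y1 y2 y3 y4 h1 h2 h3 h4 p1 p2 p3 p4.
apply: le_trans (hK _ _ _ _ _ _ _ _ _ _ _ _ (QP _ _ _ p1) (QP _ _ _ p2)
  (QP _ _ _ p3) (QP _ _ _ p4)) _; rewrite ?(lt_le_trans h1)// ?(lt_le_trans h2)//
  ?(lt_le_trans h3)// ?(lt_le_trans h4)//.
by rewrite ler_wpM2r ?addr_ge0 ?mulr_ge0 ?addr_ge0// lerDl invr_ge0 ltW.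
Qed.

Lemma tame_rel_comp V W X (P : V -> W -> Prop) (Q : W -> X -> Prop) w0 y0 :
  tame_rel P w0 -> tame_rel Q y0 -> P w0 y0 ->
  tame_rel (fun w z => exists2 y, P w y & Q y z) w0.
Proof.
move=> tP [L [L0 hL]] P0.
have [d d0 hd] : exists2 d : R, 0 < d & forall w y, `|w - w0| < d -> P w y -> `|y - y0| < L^-1.
  by apply: tame_near tP P0 _; rewrite invr_gt0.
have [K' [K'0 hK']] := tame_lip tP; have [K [K0 hK]] := tP.
pose M := K + K' + d^-1 + L * (K + K' * (2 * K')).
have M1 : 0 <= L * (K + K' * (2 * K')) by rewrite mulr_ge0 ?addr_ge0 ?mulr_ge0// ltW.
have di : 0 < d^-1 by rewrite invr_gt0.
have M0 : 0 < M by rewrite /M; lra.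
have mk : M^-1 <= K^-1 by rewrite lef_pV2 ?posrE// /M; lra.
have mk' : M^-1 <= K'^-1 by rewrite lef_pV2 ?posrE// /M; lra.
have md : M^-1 <= d by rewrite invf_ple ?posrE// /M; lra.
exists M; split=> // w1 w2 w3 w4 z1 z2 z3 z4 h1 h2 h3 h4.
move=> [y1 p1 q1] [y2 p2 q2] [y3 p3 q3] [y4 p4 q4].
have b w y : `|w - w0| < M^-1 -> P w y -> `|y - y0| < L^-1.
  by move=> h; apply: hd; exact: lt_le_trans md.
apply: le_trans (hL _ _ _ _ _ _ _ _ (b _ _ h1 p1) (b _ _ h2 p2) (b _ _ h3 p3)
  (b _ _ h4 p4) q1 q2 q3 q4) _.
have e1 := hK _ _ _ _ _ _ _ _ (lt_le_trans h1 mk) (lt_le_trans h2 mk)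
  (lt_le_trans h3 mk) (lt_le_trans h4 mk) p1 p2 p3 p4.
have l12 := hK' _ _ _ _ (lt_le_trans h1 mk') (lt_le_trans h2 mk') p1 p2.
have l13 := hK' _ _ _ _ (lt_le_trans h1 mk') (lt_le_trans h3 mk') p1 p3.
have l24 := hK' _ _ _ _ (lt_le_trans h2 mk') (lt_le_trans h4 mk') p2 p4.
apply: (@le_trans _ _ (L * (K + K' * (2 * K')) *
  (`|w1 - w2 - (w3 - w4)| + `|w1 - w2| * (`|w1 - w3| + `|w2 - w4|)))); last first.
  by rewrite ler_wpM2r ?addr_ge0 ?mulr_ge0 ?addr_ge0// /M; lra.
rewrite -mulrA ler_wpM2l ?(ltW L0)//.
have : `|y1 - y2| * (`|y1 - y3| + `|y2 - y4|) <=
   K' * `|w1 - w2| * (K' * (`|w1 - w3| + `|w2 - w4|)).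
  by rewrite ler_pM ?addr_ge0// mulrDr lerD.
have := normr_ge0 (w1 - w2 - (w3 - w4)).
have : 0 <= `|w1 - w2| * (`|w1 - w3| + `|w2 - w4|) by rewrite mulr_ge0 ?addr_ge0.
move: e1; pose D : R := `|w1 - w2 - (w3 - w4)|.
pose Q1 : R := `|w1 - w2| * (`|w1 - w3| + `|w2 - w4|); rewrite -/D -/Q1.
rewrite (_ : K' * `|w1 - w2| * (K' * (`|w1 - w3| + `|w2 - w4|)) = K' * K' * Q1);
  last by rewrite /Q1; ring.
move=> e1 q0 d0' f1.
have kk : 0 < K' * K' by rewrite mulr_gt0.
have kd : 0 <= K' * K' * D by rewrite mulr_ge0 // ltW.
have kq : 0 <= K' * K' * Q1 by rewrite mulr_ge0 // ltW.
rewrite (_ : _ * (D + Q1) = K * (D + Q1) + 2 * (K' * K' * D) + 2 * (K' * K' * Q1)); last by ring.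
lra.
Qed.

Lemma tame_comp V W X (f : V -> W) (g : W -> X) w0 :
  tame f w0 -> tame g (f w0) -> tame (g \o f) w0.
Proof.
move=> tf tg; have := tame_rel_comp tf tg erefl.
apply: (tame_rel_sub (@ltr01 R)) => w y _ -> /=; by exists (f w).
Qed.

Lemma tame_linear V W (L : V -> W) w0 : finite_frame V -> islinear L -> tame L w0.
Proof.
move=> fV linL; have [C C0 hC] := islinear_bounded fV linL.
exists C; split=> // w1 w2 w3 w4 _ _ _ _ _ _ _ _ -> -> -> ->.
rewrite -!(islinearB linL) (le_trans (hC _))// ler_wpM2l ?(ltW C0)//.
by rewrite lerDl mulr_ge0 ?addr_ge0.
Qed.

Lemma tame_finite V W (I : finType) (f : I -> V -> W) w0 : (forall i, tame (f i) w0) ->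
  exists K : R, 0 < K /\ forall i w1 w2 w3 w4,
    `|w1 - w0| < K^-1 -> `|w2 - w0| < K^-1 ->
    `|w3 - w0| < K^-1 -> `|w4 - w0| < K^-1 ->
    `|f i w1 - f i w2 - (f i w3 - f i w4)| <=
       K * (`|w1 - w2 - (w3 - w4)| + `|w1 - w2| * (`|w1 - w3| + `|w2 - w4|)).
Proof.
move=> /choice[K hK]; have K0 i : 0 < K i by case: (hK i).
have S0 : 0 <= \sum_i K i by apply: sumr_ge0 => i _; exact: ltW.
have Ki i : K i <= \sum_i K i.
  by rewrite (bigD1 i)//= lerDl sumr_ge0// => j _; exact: ltW.
exists (\sum_i K i + 1); split=> [|i w1 w2 w3 w4 h1 h2 h3 h4]; first by lra.
have ki : (\sum_i K i + 1)^-1 <= (K i)^-1.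
  by rewrite lef_pV2 ?posrE//; have := Ki i; lra.
have [_ /(_ w1 w2 w3 w4)] := hK i.
move=> /(_ _ _ _ _ (lt_le_trans h1 ki) (lt_le_trans h2 ki) (lt_le_trans h3 ki)
  (lt_le_trans h4 ki) erefl erefl erefl erefl)/le_trans; apply.
by rewrite ler_wpM2r ?addr_ge0 ?mulr_ge0 ?addr_ge0//; have := Ki i; lra.
Qed.

Lemma tame_row V n (f : 'I_n -> V -> R^o) w0 :
  (forall i, tame (f i) w0) -> tame (fun w => \row_i f i w : 'rV[R]_n) w0.
Proof.
move=> /tame_finite[K [K0 hK]]; exists K; split=> // w1 w2 w3 w4 y1 y2 y3 y4 h1 h2 h3 h4.
move=> -> -> -> ->; apply: row_norm_le.
  by rewrite mulr_ge0 ?(ltW K0)// ?addr_ge0 ?mulr_ge0 ?addr_ge0.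
by move=> i; rewrite !mxE; exact: hK.
Qed.

Lemma tame_sum V W (I : finType) (f : I -> V -> W) w0 :
  (forall i, tame (f i) w0) -> tame (fun w => \sum_i f i w) w0.
Proof.
move=> /tame_finite[K [K0 hK]]; exists (K * (#|I|%:R + 1)).
have I1 : 0 < #|I|%:R + 1 :> R by rewrite ltr_wpDl.
split; first by rewrite mulr_gt0.
have kk : (K * (#|I|%:R + 1))^-1 <= K^-1.
  by rewrite lef_pV2 ?posrE ?mulr_gt0// ler_peMr ?(ltW K0)// lerDr.
move=> w1 w2 w3 w4 y1 y2 y3 y4 h1 h2 h3 h4 -> -> -> ->.
rewrite -!sumrB (le_trans (ler_norm_sum _ _ _))//.
apply: (@le_trans _ _ (\sum_(i : I) K * (`|w1 - w2 - (w3 - w4)| + `|w1 - w2| * (`|w1 - w3| + `|w2 - w4|)))).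
  by apply: ler_sum => i _; apply: hK; exact: lt_le_trans kk.
rewrite sumr_const -[leLHS]mulr_natl mulrA [_ * K]mulrC ler_wpM2r ?addr_ge0 ?mulr_ge0 ?addr_ge0//.
by rewrite ler_wpM2l ?(ltW K0)// lerDl.
Qed.

Lemma tame_pair V W X (f : V -> W) (g : V -> X) w0 :
  tame f w0 -> tame g w0 -> tame (fun w => (f w, g w)) w0.
Proof.
move=> [K [K0 hK]] [L [L0 hL]]; exists (K + L); split; first by rewrite addr_gt0.
have k1 : (K + L)^-1 <= K^-1 by rewrite lef_pV2 ?posrE; lra.
have k2 : (K + L)^-1 <= L^-1 by rewrite lef_pV2 ?posrE; lra.
move=> w1 w2 w3 w4 y1 y2 y3 y4 h1 h2 h3 h4 -> -> -> ->.
have N0 : 0 <= `|w1 - w2 - (w3 - w4)| + `|w1 - w2| * (`|w1 - w3| + `|w2 - w4|).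
  by rewrite addr_ge0 ?mulr_ge0 ?addr_ge0.
apply: pair_norm_le => /=.
  apply: le_trans (hK _ _ _ _ _ _ _ _ (lt_le_trans h1 k1) (lt_le_trans h2 k1)
   (lt_le_trans h3 k1) (lt_le_trans h4 k1) erefl erefl erefl erefl) _.
  by rewrite ler_wpM2r//; lra.
apply: le_trans (hL _ _ _ _ _ _ _ _ (lt_le_trans h1 k2) (lt_le_trans h2 k2)
   (lt_le_trans h3 k2) (lt_le_trans h4 k2) erefl erefl erefl erefl) _.
by rewrite ler_wpM2r//; lra.
Qed.

Lemma tame_mul V (f g : V -> R^o) w0 :
  tame f w0 -> tame g w0 -> tame (fun w => f w * g w : R^o) w0.
Proof.
move=> tf tg.
have [K' [K'0 hK']] := tame_lip tf; have [L' [L'0 hL']] := tame_lip tg.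
have [K [K0 hK]] := tf; have [L [L0 hL]] := tg.
pose A := `|f w0| + 1; pose B := `|g w0| + 1.
have A0 : 0 < A by rewrite ltr_wpDl. have B0 : 0 < B by rewrite ltr_wpDl.
pose C := K * B + A * L + 2 * (K' * L'); pose M := K + L + K' + L' + C.
have [KB0 AL0 KL0] : [/\ 0 < K * B, 0 < A * L & 0 < K' * L'] by rewrite !mulr_gt0.
have M0 : 0 < M by rewrite /M /C; lra.
have m1 : M^-1 <= K^-1 by rewrite lef_pV2 ?posrE// /M /C; lra.
have m2 : M^-1 <= L^-1 by rewrite lef_pV2 ?posrE// /M /C; lra.
have m3 : M^-1 <= K'^-1 by rewrite lef_pV2 ?posrE// /M /C; lra.
have m4 : M^-1 <= L'^-1 by rewrite lef_pV2 ?posrE// /M /C; lra.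
have w00 : `|w0 - w0| < M^-1 by rewrite subrr normr0 invr_gt0.
exists M; split=> // w1 w2 w3 w4 y1 y2 y3 y4 h1 h2 h3 h4 -> -> -> ->.
have bf w : `|w - w0| < M^-1 -> `|f w| <= A.
  move=> h; have := hK' _ _ _ _ (lt_le_trans h m3) (lt_le_trans w00 m3) erefl erefl.
  have : K' * `|w - w0| <= 1.
    by rewrite -(@mulfV _ K') ?gt_eqF// ler_wpM2l ?ltW// (lt_le_trans h).
  have := ler_normD (f w - f w0) (f w0); rewrite subrK /A; lra.
have bg w : `|w - w0| < M^-1 -> `|g w| <= B.
  move=> h; have := hL' _ _ _ _ (lt_le_trans h m4) (lt_le_trans w00 m4) erefl erefl.
  have : L' * `|w - w0| <= 1.
    by rewrite -(@mulfV _ L') ?gt_eqF// ler_wpM2l ?ltW// (lt_le_trans h).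
  have := ler_normD (g w - g w0) (g w0); rewrite subrK /B; lra.
have e1 := hK _ _ _ _ _ _ _ _ (lt_le_trans h1 m1) (lt_le_trans h2 m1)
   (lt_le_trans h3 m1) (lt_le_trans h4 m1) erefl erefl erefl erefl.
have e2 := hL _ _ _ _ _ _ _ _ (lt_le_trans h1 m2) (lt_le_trans h2 m2)
   (lt_le_trans h3 m2) (lt_le_trans h4 m2) erefl erefl erefl erefl.
have f12 := hK' _ _ _ _ (lt_le_trans h1 m3) (lt_le_trans h2 m3) erefl erefl.
have f24 := hK' _ _ _ _ (lt_le_trans h2 m3) (lt_le_trans h4 m3) erefl erefl.
have g12 := hL' _ _ _ _ (lt_le_trans h1 m4) (lt_le_trans h2 m4) erefl erefl.
have g13 := hL' _ _ _ _ (lt_le_trans h1 m4) (lt_le_trans h3 m4) erefl erefl.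
have -> : f w1 * g w1 - f w2 * g w2 - (f w3 * g w3 - f w4 * g w4) =
   (f w1 - f w2 - (f w3 - f w4)) * g w3 + (f w1 - f w2) * (g w1 - g w3) +
   f w4 * (g w1 - g w2 - (g w3 - g w4)) + (f w2 - f w4) * (g w1 - g w2) by ring.
pose D : R := `|w1 - w2 - (w3 - w4)|.
pose E : R := `|w1 - w2| * (`|w1 - w3| + `|w2 - w4|).
rewrite -/D -/E in e1 e2 *.
have D0 : 0 <= D by exact: normr_ge0. have E0 : 0 <= E by rewrite mulr_ge0 ?addr_ge0.
have t1 : `|(f w1 - f w2 - (f w3 - f w4)) * g w3| <= K * (D + E) * B.
  by rewrite normrM ler_pM// bg.
have t2 : `|(f w1 - f w2) * (g w1 - g w3)| <= K' * L' * E.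
  rewrite normrM (le_trans (ler_pM _ _ f12 g13))//.
  rewrite (_ : K' * `|w1 - w2| * (L' * `|w1 - w3|) = K' * L' * (`|w1 - w2| * `|w1 - w3|)); last by ring.
  by rewrite ler_wpM2l ?(ltW KL0)// ler_wpM2l// lerDl.
have t3 : `|f w4 * (g w1 - g w2 - (g w3 - g w4))| <= A * (L * (D + E)).
  by rewrite normrM ler_pM// bf.
have t4 : `|(f w2 - f w4) * (g w1 - g w2)| <= K' * L' * E.
  rewrite normrM (le_trans (ler_pM _ _ f24 g12))//.
  rewrite (_ : K' * `|w2 - w4| * (L' * `|w1 - w2|) = K' * L' * (`|w1 - w2| * `|w2 - w4|)); last by ring.
  by rewrite ler_wpM2l ?(ltW KL0)// ler_wpM2l// lerDr.
apply: (@le_trans _ _ (C * (D + E))); last first.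
  by rewrite ler_wpM2r ?addr_ge0// /M; lra.
have klD : 0 <= K' * L' * D by rewrite mulr_ge0// ltW.
have -> : C * (D + E) = K * (D + E) * B + K' * L' * E + A * (L * (D + E)) + K' * L' * E + 2 * (K' * L' * D).
  by rewrite /C; ring.
have n1 := ler_normD ((f w1 - f w2 - (f w3 - f w4)) * g w3 + (f w1 - f w2) * (g w1 - g w3) +
   f w4 * (g w1 - g w2 - (g w3 - g w4))) ((f w2 - f w4) * (g w1 - g w2)).
have n2 := ler_normD ((f w1 - f w2 - (f w3 - f w4)) * g w3 + (f w1 - f w2) * (g w1 - g w3))
   (f w4 * (g w1 - g w2 - (g w3 - g w4))).
have n3 := ler_normD ((f w1 - f w2 - (f w3 - f w4)) * g w3) ((f w1 - f w2) * (g w1 - g w3)).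
lra.
Qed.

End tame.

(** * Maps of class C^2 *)

Section class_C2.
Context {R : realType}.
Implicit Types V W X : normedModType R.

(** One constant serves for the radius and for both bounds. *)
Definition C11_at V W (f : V -> W) (L : V -> V -> W) (w0 : V) (K : R) : Prop :=
  0 < K /\ forall a, `|a - w0| < K^-1 ->
    [/\ has_diff_within setT f a (L a), forall v, `|L a v| <= K * `|v| &
        forall b, `|b - w0| < K^-1 -> forall v, `|L a v - L b v| <= K * `|a - b| * `|v|].

Lemma segment_in_ball V (w0 a b : V) (r t : R) : 0 <= t <= 1 ->
  `|a - w0| < r -> `|b - w0| < r -> `|b + t *: (a - b) - w0| < r.
Proof.
move=> /andP[t0 t1] ha hb.
rewrite (_ : _ - w0 = t *: (a - w0) + (1 - t) *: (b - w0)); last by module_eq.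
rewrite (le_lt_trans (ler_normD _ _))// !normrZ ger0_norm// (ger0_norm (_ : 0 <= 1 - t)) ?subr_ge0//.
have [->|t0'] := eqVneq t 0; first by rewrite mul0r add0r subr0 mul1r.
have tp : 0 < t by rewrite lt_neqAle eq_sym t0'.
have h1 : t * `|a - w0| < t * r by rewrite ltr_pM2l.
have h2 : (1 - t) * `|b - w0| <= (1 - t) * r by rewrite ler_wpM2l ?subr_ge0// ltW.
lra.
Qed.

Lemma deriv_on_segment V W (f : V -> W) (L : V -> V -> W) (b h : V) :
  finite_frame V ->
  (forall t : R, 0 <= t <= 1 -> has_diff_within setT f (b + t *: h) (L (b + t *: h))) ->
  deriv_on 0 1 (fun t : R => f (b + t *: h)) (fun t => L (b + t *: h) h).
Proof.
move=> fV hL.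
apply: (@deriv_on_comp R V W 0 1 (fun t => b + t *: h) (fun=> h) setT f
  (fun t => L (b + t *: h))) => [|t /hL//].
move=> t _ e e0; exists 1 => // s _ _.
rewrite (_ : _ - _ - _ = 0); last by module_eq.
by rewrite normr0 mulr_ge0// ltW.
Qed.

Lemma mean_value01 W (u v : R -> W) (K : R) : deriv_on 0 1 u v ->
  (forall t, 0 <= t <= 1 -> `|v t| <= K) -> `|u 1 - u 0| <= K.
Proof. by move=> /(mean_value ler01) h /h; rewrite subr0 mulr1. Qed.

Lemma segment0 V (b h : V) : b + (0 : R) *: h = b.
Proof. by module_eq. Qed.

Lemma segment1 V (a b : V) : b + (1 : R) *: (a - b) = a.
Proof. by module_eq. Qed.

(** The mean value inequality for the difference of the values of f along the
    segments from w2 to w1 and from w4 to w3, run simultaneously. *)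
Lemma C11_tame V W (f : V -> W) L w0 K : finite_frame V -> C11_at f L w0 K -> tame f w0.
Proof.
move=> fV [K0 hK]; exists K; split=> // w1 w2 w3 w4 y1 y2 y3 y4 h1 h2 h3 h4 -> -> -> ->.
have D1 := @deriv_on_segment _ _ f L w2 (w1 - w2) fV
  (fun t t01 => let: And3 d _ _ := hK _ (segment_in_ball t01 h1 h2) in d).
have D2 := @deriv_on_segment _ _ f L w4 (w3 - w4) fV
  (fun t t01 => let: And3 d _ _ := hK _ (segment_in_ball t01 h3 h4) in d).
have := mean_value01 (deriv_onB D1 D2).
rewrite !segment0 !segment1 => H.
rewrite (_ : _ - _ - (_ - _) = f w1 - f w3 - (f w2 - f w4)); last by module_eq.
apply: H => t t01; have [_ _ l1] := hK _ (segment_in_ball t01 h1 h2).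
have b2 := segment_in_ball t01 h3 h4; have [d2 l2 _] := hK _ b2.
set a := w2 + t *: _ in l1 *; set b := w4 + t *: _ in b2 d2 l2 *.
rewrite (_ : _ - _ = (L a (w1 - w2) - L b (w1 - w2)) + L b (w1 - w2 - (w3 - w4))); last first.
  by rewrite (islinearB d2.1 (w1 - w2) (w3 - w4)); module_eq.
rewrite (le_trans (ler_normD _ _))// addrC mulrDr lerD//.
rewrite (le_trans (l1 _ b2 _))// -mulrA ler_wpM2l ?(ltW K0)// mulrC ler_wpM2l//.
rewrite (_ : a - b = t *: (w1 - w3) + (1 - t) *: (w2 - w4)); last by rewrite /a /b; module_eq.
rewrite (le_trans (ler_normD _ _))// !normrZ; case/andP: t01 => t0 t1.
by rewrite ger0_norm// ger0_norm ?subr_ge0// lerD// ler_piMl// gerBl.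
Qed.

Lemma C11_taylor V W (f : V -> W) L w0 K a b : finite_frame V -> C11_at f L w0 K ->
  `|a - w0| < K^-1 -> `|b - w0| < K^-1 ->
  `|f b - f a - L a (b - a)| <= K * `|b - a| ^+ 2.
Proof.
move=> fV [K0 hK] ha hb.
have D1 := @deriv_on_segment _ _ f L a (b - a) fV
  (fun t t01 => let: And3 d _ _ := hK _ (segment_in_ball t01 hb ha) in d).
have D2 : deriv_on 0 1 (fun t : R => t *: L a (b - a)) (fun=> L a (b - a)).
  move=> t _ e e0; exists 1 => // s _ _.
  rewrite (_ : _ - _ - _ = 0); last by module_eq.
  by rewrite normr0 mulr_ge0// ltW.
have := mean_value01 (deriv_onB D1 D2).
rewrite !segment0 !segment1 scale0r scale1r subr0 => H.
rewrite (_ : _ - _ - _ = f b - L a (b - a) - f a); last by module_eq.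
apply: H => t t01; have [_ _ l1] := hK _ (segment_in_ball t01 hb ha).
rewrite (le_trans (l1 _ ha _))// -mulrA ler_wpM2l ?(ltW K0)// [a + _]addrC addrK normrZ expr2.
by case/andP: t01 => t0 t1; rewrite ler_wpM2r// ger0_norm// ler_piMl.
Qed.

Lemma Ck_near_bounded V W (O : set V) (f : V -> W) w0 : finite_frame V ->
  open O -> O w0 -> Ck 1 O f -> exists K : R, 0 < K /\
    forall a, `|a - w0| < K^-1 ->
      [/\ O a, has_diff_within setT f a (fun v => 'D_v f a) &
          forall v, `|'D_v f a| <= K * `|v|].
Proof.
move=> [I [e [k ek]]] oO Ow0 [df cf].
have h : \forall a \near nbhs w0, O a /\ forall i, `|'D_(e i) f a| <= `|'D_(e i) f w0| + 1.
  apply: filterI; first exact: open_nbhs_nbhs.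
  apply: filter_forall => i; have := cf (e i) _ Ow0.
  move=> /cvgrPdist_le/(_ 1 ltr01); apply: filterS => a ha.
  rewrite -[X in `|X| <= _](subrK ('D_(e i) f w0)) (le_trans (ler_normD _ _))//.
  by rewrite addrC lerD2l distrC.
move: h => /near_normP[d d0 hd].
pose S := \sum_i (`|'D_(e i) f w0| + 1) : R.
have S0 : 0 <= S by apply: sumr_ge0 => i _; rewrite addr_ge0.
exists (S + d^-1); split; first by rewrite ltr_wpDl ?invr_gt0.
move=> a ha; have [|Oa ha'] := hd a.
  rewrite (lt_le_trans ha)// invf_ple ?posrE ?ltr_wpDl ?invr_gt0//.
  by rewrite lerDr.
have dfa := df a Oa; split=> // [|v]; first exact: differentiable_hdw.
rewrite deriveE// [in 'd f a v](ek v).1 linear_sum/= (le_trans (ler_norm_sum _ _ _))//.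
apply: (@le_trans _ _ (\sum_i (`|'D_(e i) f w0| + 1) * `|v|)).
  apply: ler_sum => i _; rewrite linearZ normrZ mulrC ler_pM//.
    by rewrite -deriveE// ha'.
  exact: (ek v).2.
by rewrite -mulr_suml ler_wpM2r// lerDl invr_ge0 ltW.
Qed.

Lemma Ck1_lip V W (O : set V) (f : V -> W) w0 : finite_frame V ->
  open O -> O w0 -> Ck 1 O f -> exists K : R, 0 < K /\
    forall a b, `|a - w0| < K^-1 -> `|b - w0| < K^-1 -> `|f a - f b| <= K * `|a - b|.
Proof.
move=> fV oO Ow0 /(Ck_near_bounded fV oO Ow0)[K [K0 hK]]; exists K; split=> // a b ha hb.
have := mean_value01 (@deriv_on_segment _ _ f (fun a v => 'D_v f a) b (a - b) fV
  (fun t t01 => let: And3 _ d _ := hK _ (segment_in_ball t01 ha hb) in d)).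
rewrite !segment0 !segment1; apply.
by move=> t t01; have [_ _] := hK _ (segment_in_ball t01 ha hb).
Qed.

Lemma Ck_le V W k (A : set V) (f : V -> W) : Ck k.+1 A f -> Ck k A f.
Proof.
elim: k f => [f [df _] a Aa|k IH f [df h]] /=.
  exact: differentiable_continuous (df a Aa).
by split=> // v; apply: IH; exact: h.
Qed.

Lemma Ck2_C11 V W (O : set V) (f : V -> W) w0 : finite_frame V ->
  open O -> O w0 -> Ck 2 O f ->
  exists K : R, C11_at f (fun a v => 'D_v f a) w0 K /\ forall a, `|a - w0| < K^-1 -> O a.
Proof.
move=> fV oO Ow0 C2.
have [K [K0 hK]] := Ck_near_bounded fV oO Ow0 (Ck_le C2).
have [I [e [k ek]]] := fV.
have /choice[L hL] : forall i, exists L : R, 0 < L /\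
    forall a b, `|a - w0| < L^-1 -> `|b - w0| < L^-1 ->
      `|'D_(e i) f a - 'D_(e i) f b| <= L * `|a - b|.
  by move=> i; apply: Ck1_lip fV oO Ow0 _; case: C2 => _; apply.
have S0 : 0 <= \sum_i L i by apply: sumr_ge0 => i _; apply/ltW; case: (hL i).
have Li i : L i <= \sum_i L i.
  by rewrite (bigD1 i)//= lerDl sumr_ge0// => j _; apply/ltW; case: (hL j).
exists (K + \sum_i L i).
have kk : (K + \sum_i L i)^-1 <= K^-1 by rewrite lef_pV2 ?posrE; lra.
have kl i : (K + \sum_i L i)^-1 <= (L i)^-1.
  by have [Lp _] := hL i; have := Li i; rewrite lef_pV2 ?posrE; lra.
split; last by move=> a ha; have [] := hK a (lt_le_trans ha kk).
split=> [|a ha]; first by lra.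
have [Oa da ba] := hK a (lt_le_trans ha kk).
split=> // [v|b hb v]; first by rewrite (le_trans (ba v))// ler_wpM2r//; lra.
have [Ob db _] := hK b (lt_le_trans hb kk).
have E c (Oc : O c) : 'D_v f c = \sum_i k i v *: 'D_(e i) f c.
  rewrite deriveE; last exact: C2.1.
  rewrite [in LHS](ek v).1 linear_sum; apply: eq_bigr => i _.
  by rewrite linearZ /= deriveE//; exact: C2.1.
rewrite !E// -sumrB (le_trans (ler_norm_sum _ _ _))//.
apply: (@le_trans _ _ (\sum_i L i * (`|a - b| * `|v|))).
  apply: ler_sum => i _; rewrite -scalerBr normrZ mulrA mulrC ler_pM//.
    have [_ /(_ a b)] := hL i; apply; exact: lt_le_trans (kl i).
  exact: (ek v).2.
by rewrite -mulr_suml -mulrA ler_wpM2r ?mulr_ge0//; lra.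
Qed.

End class_C2.

(** * Integral curves *)

Section ode.
Context {R : realType}.
Implicit Types V W X : normedModType R.

(** The Gronwall inequality is applied to first differences, and then to second
    differences, whose equation has the products of first differences as a source
    term. *)
Lemma integral_curves_tame W (X : W -> W) w0 : tame X w0 ->
  exists r tau : R, [/\ 0 < r, 0 < tau & exists K : R, 0 < K /\
    forall a b, a <= b <= a + tau -> forall u1 u2 u3 u4 : R -> W,
    (forall u, u = u1 \/ u = u2 \/ u = u3 \/ u = u4 ->
      deriv_on a b u (X \o u) /\ forall t, a <= t <= b -> `|u t - w0| < r) ->
    forall t, a <= t <= b ->
    `|u1 t - u2 t - (u3 t - u4 t)| <= K * (`|u1 a - u2 a - (u3 a - u4 a)| +
       `|u1 a - u2 a| * (`|u1 a - u3 a| + `|u2 a - u4 a|))].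
Proof.
move=> tX; have [L [L0 hL]] := tame_lip tX; have [C [C0 hC]] := tX.
have i0 : 0 < (L + C)^-1 by rewrite invr_gt0 addr_gt0.
have iL : (L + C)^-1 <= L^-1 by rewrite lef_pV2 ?posrE ?addr_gt0// lerDl ltW.
have iC : (L + C)^-1 <= C^-1 by rewrite lef_pV2 ?posrE ?addr_gt0// lerDr ltW.
exists (L + C)^-1, ((L + C)^-1 / 2); split=> //; first by rewrite divr_gt0.
exists 4; split=> // a b /andP[ab bt] u1 u2 u3 u4 hu.
have LC : (L + C) * (b - a) <= 1 / 2.
  rewrite (@le_trans _ _ ((L + C) * ((L + C)^-1 / 2)))//.
    by rewrite ler_wpM2l ?addr_ge0 ?(ltW L0) ?(ltW C0)//; lra.
  by rewrite mulrA mulfV ?gt_eqF ?addr_gt0.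
have ba0 : 0 <= b - a by rewrite subr_ge0.
have CL : 0 <= C * (b - a) /\ 0 <= L * (b - a) by split; rewrite mulr_ge0 ?(ltW C0) ?(ltW L0).
have [d1 b1] := hu u1 (or_introl erefl).
have [d2 b2] := hu u2 (or_intror (or_introl erefl)).
have [d3 b3] := hu u3 (or_intror (or_intror (or_introl erefl))).
have [d4 b4] := hu u4 (or_intror (or_intror (or_intror erefl))).
have pair u v : deriv_on a b u (X \o u) -> (forall t, a <= t <= b -> `|u t - w0| < (L + C)^-1) ->
    deriv_on a b v (X \o v) -> (forall t, a <= t <= b -> `|v t - w0| < (L + C)^-1) ->
    forall t, a <= t <= b -> `|u t - v t| <= 2 * `|u a - v a|.
  move=> du bu dv bv t tab.
  have := @gronwall _ _ _ _ _ _ L 0 (ltW L0) (lexx _) _ (deriv_onB du dv) _ t tab.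
  rewrite mulr0 mul0r addr0; apply; first by lra.
  move=> s sab /=; rewrite addr0; apply: hL => //; apply: lt_le_trans iL; [exact: bu|exact: bv].
move=> t tab.
pose P : R := `|u1 a - u2 a| * (`|u1 a - u3 a| + `|u2 a - u4 a|).
have P0 : 0 <= P by rewrite mulr_ge0 ?addr_ge0.
have := @gronwall _ _ _ _ _ _ C (C * (4 * P)) (ltW C0) _ _
  (deriv_onB (deriv_onB d1 d2) (deriv_onB d3 d4)) _ t tab.
rewrite mulr_ge0 ?(ltW C0) ?mulr_ge0//.
move=> /(_ isT) h; apply: le_trans (h _ _) _; first by lra.
  move=> s sab /=; rewrite -mulrDr.
  have := hC _ _ _ _ _ _ _ _ (lt_le_trans (b1 s sab) iC) (lt_le_trans (b2 s sab) iC)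
   (lt_le_trans (b3 s sab) iC) (lt_le_trans (b4 s sab) iC) erefl erefl erefl erefl.
  move=> /le_trans; apply; rewrite ler_wpM2l ?(ltW C0)// lerD2l.
  have p12 := pair _ _ d1 b1 d2 b2 s sab; have p13 := pair _ _ d1 b1 d3 b3 s sab.
  have p24 := pair _ _ d2 b2 d4 b4 s sab.
  rewrite (_ : 4 * P = (2 * `|u1 a - u2 a|) * (2 * `|u1 a - u3 a| + 2 * `|u2 a - u4 a|)); last first.
    by rewrite /P; ring.
  by rewrite ler_pM ?addr_ge0// lerD.
rewrite -/P; have q : 0 <= P * (1 / 2 - C * (b - a)) by rewrite mulr_ge0// subr_ge0; lra.
have := normr_ge0 (u1 a - u2 a - (u3 a - u4 a)); nra.
Qed.

Lemma pow2_small (c e : R) : 0 < e -> exists k : nat, c / 2 ^+ k <= e.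
Proof.
move=> e0; have [k hk] : exists k : nat, c / e <= k%:R.
  have [c0|c0] := leP 0 (c / e); last by exists 0%N; exact: ltW.
  by exists (Num.bound (c / e)); apply/ltW; exact: archi_boundP.
exists k; rewrite ler_pdivrMr ?exprn_gt0// mulrC -ler_pdivrMr// (le_trans hk)//.
by rewrite -natrX ler_nat ltnW// ltn_expl.
Qed.

Lemma clamp_dist (lo hi x y : R) : lo <= hi ->
  `|Num.max lo (Num.min hi x) - Num.max lo (Num.min hi y)| <= `|x - y|.
Proof.
move=> lohi; wlog xy : x y / x <= y.
  by move=> H; have [/H//|/ltW/H] := leP x y; rewrite distrC [`|x - y|]distrC.
rewrite [X in _ <= X]distrC (ger0_norm (_ : 0 <= y - x)) ?subr_ge0// ler_norml.
have cl (z : R) : let v := Num.max lo (Num.min hi z) in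
    [\/ (z <= lo /\ v = lo), (lo <= z <= hi /\ v = z) | (hi <= z /\ v = hi)].
  rewrite /=; have [h|h] := leP hi z; first by apply: Or33; rewrite max_r.
  have [h'|h'] := leP lo z; first by apply: Or32; rewrite (ltW h).
  by apply: Or31; split=> //; exact: ltW.
by case: (cl x) => -[h1 ->]; case: (cl y) => -[h2 ->]; apply/andP; split; lra.
Qed.

(** What the Picard iteration requires of the phase space: limits of geometrically
    convergent sequences, primitives, and nonexpansive retractions onto balls,
    which turn a field that is Lipschitz in a ball into a globally Lipschitz one.
    All three pass to finite products. *)
Class picard_space W : Prop := picard_spaceP : [/\
  forall (u : nat -> W) (C : R), (forall k, `|u k.+1 - u k| <= C / 2 ^+ k) ->
    exists l, forall k, `|u k - l| <= 2 * C / 2 ^+ k,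
  forall (a b : R) (h : R -> W), a <= b -> (forall t, {for t, continuous h}) ->
    exists2 F : R -> W, deriv_on a b F h & F a = 0 &
  forall (w0 : W) (r : R), 0 < r -> exists c : W -> W,
    [/\ forall w, `|c w - w0| <= r, forall w w', `|c w - c w'| <= `|w - w'| &
        forall w, `|w - w0| <= r -> c w = w] ].

#[global] Instance picard_R : picard_space (R^o : normedModType R).
Proof.
split.
- move=> u C hu.
  have C0 : 0 <= C by have := hu 0%N; rewrite expr0 divr1; apply: le_trans.
  have pS k : C / 2 ^+ k = 2 * C / 2 ^+ k.+1.
    by rewrite exprS invfM mulrACA mulfV// mul1r.
  pose lo k := u k - 2 * C / 2 ^+ k; pose hi k := u k + 2 * C / 2 ^+ k.
  have p0 k : 0 <= 2 * C / 2 ^+ k by rewrite divr_ge0 ?mulr_ge0 ?exprn_ge0.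
  have step k : lo k <= lo k.+1 /\ hi k.+1 <= hi k.
    have := hu k; rewrite ler_norml /lo /hi -!pS.
    have : 2 * C / 2 ^+ k = C / 2 ^+ k + C / 2 ^+ k by rewrite -mulrA mulr_natl mulr2n.
    by move=> -> /andP[h1 h2]; split; lra.
  have mono k m : (k <= m)%N -> lo k <= lo m /\ hi m <= hi k.
    move=> /subnKC <-; elim: (m - k)%N => [|j [IH1 IH2]]; first by rewrite addn0.
    by rewrite addnS; have [s1 s2] := step (k + j)%N; split; [exact: le_trans IH1 s1|exact: le_trans s2 IH2].
  have lohi k m : lo k <= hi m.
    have lh j : lo j <= hi j by rewrite /lo /hi; have := p0 j; lra.
    have [/mono[h _]|/ltnW/mono[_ h]] := leqP k m; first exact: le_trans h (lh m).
    exact: le_trans (lh k) h.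
  have hs : has_sup (range lo).
    by split; [exists (lo 0%N), 0%N|exists (hi 0%N) => _ [k _ <-]; exact: lohi].
  exists (sup (range lo)) => k.
  have h1 : lo k <= sup (range lo) by apply: sup_upper_bound => //; exists k.
  have h2 : sup (range lo) <= hi k by apply: ge_sup; [exact: (proj1 hs)|move=> _ [m _ <-]; exact: lohi].
  have aux (x y c : R) : x - c <= y -> y <= x + c -> `|x - y| <= c.
    by move=> h h'; rewrite ler_norml; apply/andP; split; lra.
  exact: aux.
- move=> a b h ab ch.
  pose F (x : R) := (\int[lebesgue_measure]_(t in [set` Interval (BLeft (a - 1)) (BRight x)]) h t)%R.
  have dF t : a <= t <= b -> derivable F t 1 /\ F^`()%classic t = h t.
    move=> /andP[at_ tb]; apply: (@continuous_FTC1 _ h (BLeft (a - 1)) t (b + 1)).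
    - by rewrite (le_lt_trans tb)// ltrDl.
    - apply: continuous_compact_integrable; first exact: segment_compact.
      by apply: continuous_subspaceT => x; exact: ch.
    - by rewrite lte_fin; lra.
    - exact: ch.
  exists (fun t => F t - F a); last by rewrite subrr.
  apply/deriv_onP => t tab; have [dt et] := dF t tab.
  have /(@differentiable_hdw _ _ _ `[a, b]%classic) D := (derivable1_diffP F t).1 dt.
  have -> : (fun s : R^o => s *: (h t : R^o)) = (fun v => 'D_v F t + 0).
    apply/funext => s; rewrite addr0 deriveE; last exact/derivable1_diffP.
    rewrite -et derive1E deriveE; last exact/derivable1_diffP.
    by rewrite -[in RHS](mulr1 s) -[s * 1]/(s *: (1 : R^o)) linearZ.
  exact: hdwD D (hdw_cst _ _ _).
- move=> w0 r r0; exists (fun w => Num.max (w0 - r) (Num.min (w0 + r) w)); split.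
  + move=> w; rewrite ler_norml; case: (leP (w0 + r) w) => h1;
    case: (leP (w0 - r)) => h2; apply/andP; split; lra.
  + by move=> w w'; apply: clamp_dist; lra.
  + by move=> w; rewrite ler_norml => /andP[h1 h2]; rewrite min_r ?max_r//; lra.
Qed.

End ode.

Section picard.
Context {R : realType}.
Implicit Types V W X : normedModType R.

#[global] Instance picard_row n : picard_space ('rV[R]_n : normedModType R).
Proof.
have [c1 c2 c3] := @picard_R R; split.
- move=> u C hu.
  have C0 : 0 <= C by have := hu 0%N; rewrite expr0 divr1; apply: le_trans.
  have /choice[l hl] : forall i : 'I_n, exists l : R, forall k, `|u k 0 i - l| <= 2 * C / 2 ^+ k.
    move=> i; apply: (c1 (fun k => u k 0 i)) => k.
    by apply: le_trans (hu k); have := row_entry_le (u k.+1 - u k) i; rewrite !mxE.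
  exists (\row_i l i) => k; apply: row_norm_le => [|i].
    by rewrite divr_ge0 ?mulr_ge0 ?exprn_ge0.
  by rewrite !mxE; exact: hl.
- move=> a b h ab ch.
  have /choice[F hF] : forall i : 'I_n, exists F : R -> R^o,
      deriv_on a b F (fun t => h t 0 i) /\ F a = 0.
    move=> i; have [|F dF F0] := c2 a b (fun t => h t 0 i) ab; last by exists F.
    by move=> t; apply: (@continuous_comp _ _ _ h (fun v : 'rV[R]_n => v 0 i)); [exact: ch|exact: coord_continuous].
  exists (fun t => \row_i F i t); last first.
    by apply/rowP => i; rewrite !mxE; have [] := hF i.
  move=> t tab e e0.
  have /choice[d hd] : forall i : 'I_n, exists d : R, 0 < d /\ forall s, a <= s <= b ->
      `|s - t| < d -> `|F i s - F i t - (s - t) *: (h t 0 i : R^o)| <= e * `|s - t|.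
    by move=> i; have [dF _] := hF i; have [d d0 hd] := dF t tab e e0; exists d.
  have D0 : 0 < \sum_i (d i)^-1 + 1.
    by rewrite ltr_wpDl// sumr_ge0// => i _; rewrite invr_ge0; case: (hd i) => /ltW.
  exists (\sum_i (d i)^-1 + 1)^-1; first by rewrite invr_gt0.
  move=> s sab sd; apply: row_norm_le => [|i]; first by rewrite mulr_ge0// ltW.
  rewrite !mxE; have [di0 hdi] := hd i; apply: hdi => //; apply: lt_le_trans sd _.
  rewrite invf_ple ?posrE// (bigD1 i)//= -addrA lerDl addr_ge0// sumr_ge0// => j _.
  by rewrite invr_ge0; case: (hd j) => /ltW.
- move=> w0 r r0.
  have /choice[c hc] : forall i : 'I_n, exists c : R -> R, [/\ forall w, `|c w - w0 0 i| <= r,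
      forall w w', `|c w - c w'| <= `|w - w'| & forall w, `|w - w0 0 i| <= r -> c w = w].
    by move=> i; exact: (c3 (w0 0 i) r r0).
  exists (fun w : 'rV[R]_n => \row_i c i (w 0 i)); split.
  + move=> w; apply: row_norm_le => [|i]; rewrite ?(ltW r0)// !mxE.
    by have [h _ _] := hc i.
  + move=> w w'; apply: row_norm_le => // i; rewrite !mxE.
    have [_ h _] := hc i; rewrite (le_trans (h _ _))//.
    by have := row_entry_le (w - w') i; rewrite !mxE.
  + move=> w hw; apply/rowP => i; rewrite !mxE; have [_ _ h] := hc i; apply: h.
    by apply: le_trans hw; have := row_entry_le (w - w0) i; rewrite !mxE.
Qed.

#[global] Instance picard_prod V W : picard_space V -> picard_space W ->
  picard_space ((V * W)%type : normedModType R).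
Proof.
move=> [v1 v2 v3] [w1 w2 w3]; split.
- move=> u C hu.
  have [|l hl] := v1 (fun k => (u k).1) C.
    by move=> k; apply: le_trans (hu k); exact: (pair_fst_le (u k.+1 - u k)).
  have [|m hm] := w1 (fun k => (u k).2) C.
    by move=> k; apply: le_trans (hu k); exact: (pair_snd_le (u k.+1 - u k)).
  by exists (l, m) => k; apply: pair_norm_le; [exact: hl|exact: hm].
- move=> a b h ab ch.
  have [|F dF F0] := v2 a b (fun t => (h t).1) ab.
    move=> t; apply: (@continuous_comp _ _ _ h fst); [exact: ch|].
    exact: cvg_fst.
  have [|G dG G0] := w2 a b (fun t => (h t).2) ab.
    move=> t; apply: (@continuous_comp _ _ _ h snd); [exact: ch|].
    exact: cvg_snd.
  exists (fun t => (F t, G t)); last by rewrite F0 G0.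
  move=> t tab e e0.
  have [d d0 hd] := dF t tab e e0; have [d' d'0 hd'] := dG t tab e e0.
  exists (Num.min d d'); first by rewrite lt_min d0.
  move=> s sab; rewrite lt_min => /andP[sd sd'].
  by apply: pair_norm_le; [exact: hd|exact: hd'].
- move=> w0 r r0; have [c [h1 h2 h3]] := v3 w0.1 r r0; have [d [k1 k2 k3]] := w3 w0.2 r r0.
  exists (fun w => (c w.1, d w.2)); split.
  + by move=> w; apply: pair_norm_le; [exact: h1|exact: k1].
  + move=> w w'; apply: pair_norm_le => /=.
      by rewrite (le_trans (h2 _ _))//; exact: (pair_fst_le (w - w')).
    by rewrite (le_trans (k2 _ _))//; exact: (pair_snd_le (w - w')).
  + move=> [x y] hw; congr pair.
      by apply: h3; apply: le_trans hw; exact: (pair_fst_le ((x, y) - w0)).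
    by apply: k3; apply: le_trans hw; exact: (pair_snd_le ((x, y) - w0)).
Qed.

Lemma deriv_on_linear_part W (a b : R) (c : W) : deriv_on a b (fun t => t *: c) (fun=> c).
Proof.
move=> t _ e e0; exists 1 => // s _ _.
rewrite (_ : _ - _ - _ = 0); last by module_eq.
by rewrite normr0 mulr_ge0// ltW.
Qed.

Lemma mean_value_affine W a b (u v : R -> W) (K : R) (c : W) s t :
  deriv_on a b u v -> a <= s <= b -> a <= t <= b ->
  (forall r, a <= r <= b -> `|r - t| <= `|s - t| -> `|v r - c| <= K) ->
  `|u s - u t - (s - t) *: c| <= K * `|s - t|.
Proof.
move=> du sab tab hK.
have D := deriv_onB du (@deriv_on_linear_part W a b c).
have [st|/ltW ts] := leP s t.
  have tm0 : 0 <= t - s by rewrite subr_ge0.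
  rewrite (_ : _ - _ - _ = - ((u t - t *: c) - (u s - s *: c))); last by module_eq.
  rewrite normrN distrC (distrC s) (ger0_norm tm0) distrC.
  apply: (mean_value st (deriv_on_sub _ _ D)); [by case/andP: sab|by case/andP: tab|].
  move=> r /andP[sr rt]; apply: hK.
    by case/andP: sab => as_ _; case/andP: tab => _ tb; rewrite (le_trans as_)// (le_trans rt).
  by rewrite distrC ger0_norm ?subr_ge0// distrC ger0_norm// lerD2l lerN2.
have tm0 : 0 <= s - t by rewrite subr_ge0.
rewrite (_ : _ - _ - _ = ((u s - s *: c) - (u t - t *: c))); last by module_eq.
rewrite (ger0_norm tm0).
apply: (mean_value ts (deriv_on_sub _ _ D)); [by case/andP: tab|by case/andP: sab|].
move=> r /andP[tr rs]; apply: hK.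
  by case/andP: sab => _ sb; case/andP: tab => at_ _; rewrite (le_trans at_)// (le_trans rs).
by rewrite ger0_norm ?subr_ge0// ger0_norm// lerD2r.
Qed.

(** Successive approximations contract by 1/2 on an interval this short. *)
Lemma picard_iteration W (X : W -> W) (L a b : R) (w : W) : picard_space W -> 0 < L ->
  (forall x y, `|X x - X y| <= L * `|x - y|) -> a <= b -> L * (b - a) <= 1 / 2 ->
  exists2 u, u a = w & deriv_on a b u (X \o u).
Proof.
move=> [c1 c2 _] L0 lipX ab Lab; have ba0 : 0 <= b - a by rewrite subr_ge0.
(* time is projected to [a, b] because antiderivatives are taken of functions
   that are continuous on the whole line *)
pose pr (t : R) := Num.max a (Num.min b t).
have prE t : a <= t <= b -> pr t = t.
  by move=> /andP[h1 h2]; rewrite /pr (min_r h2) (max_r h1).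
have prab t : a <= pr t <= b by rewrite /pr le_max lexx /= ge_max ab ge_min lexx.
have prlip s t : `|pr s - pr t| <= `|s - t| by exact: clamp_dist.
have stepP (u : R -> W) : exists u' : R -> W, (exists v, deriv_on a b u v) ->
    u' a = w /\ deriv_on a b u' (X \o u).
  have [[v du]|nu] := pselect (exists v, deriv_on a b u v); last by exists u => /nu.
  have [|F dF F0] := c2 a b (fun t => X (u (pr t))) ab.
    move=> t; apply/cvgrPdist_lt => e e0.
    have [d d0 hd] := deriv_on_continuous du (prab t) (divr_gt0 e0 L0).
    exists d => //= s /=; rewrite distrC => sd.
    rewrite distrC (le_lt_trans (lipX _ _))//.
    by rewrite mulrC -ltr_pdivlMr// hd// (le_lt_trans (prlip _ _)).
  exists (fun t => w + F t) => _; rewrite F0 addr0; split=> //.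
  move=> t tab e e0; have [d d0 hd] := dF t tab e e0; exists d => // s sab sd.
  have := hd s sab sd; rewrite prE//=.
  by rewrite (_ : w + F s - (w + F t) = F s - F t)//; module_eq.
have /choice[step hstep] := stepP.
pose u k := iter k step (fun=> w).
have du k : exists v, deriv_on a b (u k) v.
  elim: k => [|k /hstep[_ h]]; last by exists (X \o u k).
  by exists (fun=> 0) => t _ e e0; exists 1 => // s _ _; rewrite subrr scaler0 subr0 normr0 mulr_ge0// ltW.
have ua k : u k a = w by case: k => // k; have [] := hstep _ (du k).
have duS k : deriv_on a b (u k.+1) (X \o u k) by have [] := hstep _ (du k).
pose M : R := `|X w| * (b - a); have M0 : 0 <= M by rewrite mulr_ge0.
have geo k t : a <= t <= b -> `|u k.+1 t - u k t| <= M / 2 ^+ k.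
  elim: k t => [|k IH] t tab.
    have := @mean_value _ _ a t _ _ (`|X w|) _ (deriv_on_sub (lexx a) _ (duS 0%N)).
    rewrite ua expr0 divr1; case/andP: tab => at_ tb => /(_ at_ tb) h.
    by rewrite (le_trans (h _))// ler_wpM2l// lerD2r.
  have := @mean_value _ _ a t _ _ (L * (M / 2 ^+ k)) _
    (deriv_on_sub (lexx a) _ (deriv_onB (duS k.+1) (duS k))).
  rewrite !ua subrr subr0; case/andP: tab => at_ tb => /(_ at_ tb) h.
  apply: le_trans (h _) _ => [s /andP[as_ st]|].
    rewrite /= (le_trans (lipX _ _))// ler_wpM2l ?(ltW L0)// IH//.
    by rewrite as_ (le_trans st).
  have p0 : 0 <= M / 2 ^+ k by rewrite divr_ge0 ?exprn_ge0.
  rewrite exprSr invfM [leRHS]mulrA mulrAC [leLHS]mulrC ler_wpM2l//.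
  have : L * (t - a) <= L * (b - a) by rewrite ler_wpM2l ?(ltW L0)// lerD2r.
  by move=> /le_trans; apply; rewrite -div1r.
have /choice[l hl] : forall t, exists l : W, a <= t <= b ->
    forall k, `|u k t - l| <= 2 * M / 2 ^+ k.
  move=> t; have [tab|ntab] := pselect (a <= t <= b); last by exists 0.
  by have [l hl] := c1 (fun k => u k t) M (fun k => geo k t tab); exists l.
have aab : a <= a <= b by rewrite lexx.
exists l.
  apply/esym/eqP; rewrite -subr_eq0 -normr_le0; apply/ler_addgt0Pr => e e0.
  have [k hk] := pow2_small (2 * M) e0; rewrite add0r (le_trans _ hk)//.
  by rewrite -(ua k); exact: hl.
pose B := `|X w| + L * (4 * M).
have B0 : 0 <= B by rewrite addr_ge0 ?mulr_ge0// ltW.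
have uB k t : a <= t <= b -> `|X (u k t)| <= B.
  move=> tab; rewrite -[X (u k t)](subrK (X w)) addrC (le_trans (ler_normD _ _))//.
  rewrite lerD2l (le_trans (lipX _ _))// ler_wpM2l ?(ltW L0)//.
  have p1 : 1 / 2 ^+ k <= 1 :> R.
    by rewrite ler_pdivrMr ?exprn_gt0// mul1r exprn_ege1// ler1n.
  have h0 := hl t tab 0%N; rewrite expr0 divr1 in h0; have hk := hl t tab k.
  have : 2 * M / 2 ^+ k <= 2 * M by rewrite ler_piMr ?mulr_ge0// -div1r.
  have := ler_normB (u k t - l t) (u 0%N t - l t).
  rewrite (_ : u k t - _ - _ = u k t - w); last by rewrite /u /=; module_eq.
  by lra.
have ulip k s t : a <= s <= b -> a <= t <= b -> `|u k.+1 s - u k.+1 t| <= B * `|s - t|.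
  move=> sab tab; have := @mean_value_affine _ _ _ _ _ B 0 s t (duS k) sab tab.
  rewrite scaler0 subr0; apply=> r rab _; rewrite subr0; exact: uB.
have LB0 : 0 < L * (B + 1) by rewrite mulr_gt0// ltr_wpDl.
move=> t tab e e0; exists (e / (L * (B + 1))); first by rewrite divr_gt0.
move=> s sab sd; apply/ler_addgt0Pr => d d0.
have c0 : 0 < 2 + L * `|s - t| by rewrite ltr_wpDr// mulr_ge0// ltW.
have [k hk] := pow2_small (2 * M) (divr_gt0 d0 c0).
have {}hk j : (k <= j)%N -> 2 * M / 2 ^+ j <= d / (2 + L * `|s - t|).
  move=> kj; apply: le_trans hk; rewrite ler_wpM2l ?mulr_ge0//.
  by rewrite lef_pV2 ?posrE ?exprn_gt0// ler_eXn2l ?ltr1n.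
pose c : R := d / (2 + L * `|s - t|); rewrite -/c in hk.
have cE : c * (2 + L * `|s - t|) = d by rewrite /c divfK ?gt_eqF.
have h1 := le_trans (hl s sab k.+2) (hk _ (leqW (leqnSn k))).
have h2 := le_trans (hl t tab k.+2) (hk _ (leqW (leqnSn k))).
have h3 : `|u k.+2 s - u k.+2 t - (s - t) *: X (l t)| <= L * (B * `|s - t| + c) * `|s - t|.
  apply: (mean_value_affine (duS k.+1) sab tab) => r rab rst.
  apply: le_trans (lipX (u k.+1 r) (l t)) _; rewrite ler_wpM2l ?(ltW L0)//.
  rewrite (_ : _ - l t = (u k.+1 r - u k.+1 t) + (u k.+1 t - l t)); last by module_eq.
  rewrite (le_trans (ler_normD _ _))// lerD//.
    by rewrite (le_trans (ulip _ _ _ rab tab))// ler_wpM2l.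
  by rewrite (le_trans (hl _ tab _))// hk.
rewrite -[(X \o l) t]/(X (l t)) (_ : _ - _ - _ = (u k.+2 s - u k.+2 t - (s - t) *: X (l t)) -
   (u k.+2 s - l s) + (u k.+2 t - l t)); last by module_eq.
have n1 := ler_normD (u k.+2 s - u k.+2 t - (s - t) *: X (l t) - (u k.+2 s - l s)) (u k.+2 t - l t).
have n2 := ler_normB (u k.+2 s - u k.+2 t - (s - t) *: X (l t)) (u k.+2 s - l s).
have sd' : L * B * `|s - t| <= e.
  move: sd; rewrite ltr_pdivlMr// => sd.
  have : 0 <= L * `|s - t| by rewrite mulr_ge0// ltW.
  by move: sd; have := normr_ge0 (s - t); lra.
have : (L * B * `|s - t|) * `|s - t| <= e * `|s - t| by rewrite ler_wpM2r.
rewrite -cE; move: h1 h2 h3 n1 n2; lra.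
Qed.

(** The field is replaced by a globally Lipschitz one that agrees with it in a
    small ball, which the curves cannot leave in a short time. *)
Lemma integral_curve_exists W (X : W -> W) w0 (r : R) : picard_space W -> tame X w0 -> 0 < r ->
  exists rho tau : R, [/\ 0 < rho, 0 < tau & forall a b w, a <= b <= a + tau ->
    `|w - w0| < rho -> exists u, [/\ u a = w, deriv_on a b u (X \o u) &
      forall t, a <= t <= b -> `|u t - w0| < r]].
Proof.
move=> pW /tame_lip[K [K0 hK]] r0; have [_ _ retr] := pW.
pose r' := Num.min (r / 2) (K^-1 / 2).
have r'0 : 0 < r' by rewrite lt_min !divr_gt0// invr_gt0.
have r'K : r' < K^-1.
  by rewrite gt_min; apply/orP; right; rewrite ltr_pdivrMr// ltr_pMr ?invr_gt0// ltr1n.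
have r'r : r' < r by rewrite gt_min; apply/orP; left; rewrite ltr_pdivrMr// ltr_pMr// ltr1n.
have [c [c1 c2 c3]] := retr w0 r' r'0.
pose B := `|X w0| + K * r'; have B0 : 0 < B by rewrite ltr_wpDl// mulr_gt0.
have lipX x y : `|X (c x) - X (c y)| <= K * `|x - y|.
  rewrite (le_trans (hK _ _ _ _ _ _ erefl erefl))// ?(le_lt_trans (c1 _))//.
  by rewrite ler_wpM2l ?(ltW K0).
have bX x : `|X (c x)| <= B.
  rewrite -[X (c x)](subrK (X w0)) addrC (le_trans (ler_normD _ _))// lerD2l.
  rewrite (le_trans (hK _ _ _ _ _ _ erefl erefl))// ?(le_lt_trans (c1 _))//.
    by rewrite subrr normr0 invr_gt0.
  by rewrite ler_wpM2l ?(ltW K0).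
exists (r' / 2), (Num.min (r' / 2 / B) (K^-1 / 2)); split.
- by rewrite divr_gt0.
- by rewrite lt_min !divr_gt0 ?invr_gt0.
move=> a b w /andP[ab bt] hw.
have bt1 : b - a <= r' / 2 / B by rewrite lerBlDl (le_trans bt)// lerD2l ge_min lexx.
have bt2 : b - a <= K^-1 / 2 by rewrite lerBlDl (le_trans bt)// lerD2l ge_min lexx orbT.
have Kab : K * (b - a) <= 1 / 2.
  by rewrite (le_trans (ler_wpM2l (ltW K0) bt2))// mulrA mulfV ?gt_eqF.
have [u ua du] := @picard_iteration _ (X \o c) K a b w pW K0 lipX ab Kab.
have near t : a <= t <= b -> `|u t - w0| <= r'.
  move=> /andP[at_ tb].
  have := @mean_value _ _ a t u _ B at_ (deriv_on_sub (lexx _) tb du) (fun _ _ => bX _).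
  rewrite ua => h; rewrite (_ : u t - w0 = (u t - w) + (w - w0)); last by module_eq.
  rewrite (le_trans (ler_normD _ _))// (splitr r') lerD ?(ltW hw)//.
  rewrite (le_trans h)// mulrC -ler_pdivlMr// (le_trans _ bt1)// lerD2r//.
exists u; split=> //; last by move=> t /near h; exact: le_lt_trans h r'r.
by apply: deriv_on_ext du => t tab; rewrite /= c3// near.
Qed.

End picard.

(** * Charts and covectors *)

Section pairing.
Context {R : realType} {n : nat}.
Implicit Types z v : 'rV[R]_n.

Lemma pairing_linearr z : islinear (pairing z : 'rV[R]_n -> R^o).
Proof.
move=> k u v; rewrite /pairing scaler_sumr -big_split; apply: eq_bigr => i _.
by rewrite !mxE mulrDr [k *: _]mulrCA.
Qed.

Lemma pairing_linearl v : islinear (fun z => pairing z v : R^o).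
Proof.
move=> k u w; rewrite /pairing scaler_sumr -big_split; apply: eq_bigr => i _.
by rewrite !mxE mulrDl -mulrA.
Qed.

Lemma pairing_delta z i : pairing z (delta_mx 0 i) = z 0 i.
Proof.
rewrite /pairing (bigD1 i)//= mxE !eqxx mulr1 big1 ?addr0// => j ji.
by rewrite mxE eqxx (negbTE ji) mulr0.
Qed.

Lemma pairing_inj z z' : (forall v, pairing z v = pairing z' v) -> z = z'.
Proof. by move=> h; apply/rowP => i; rewrite -!pairing_delta. Qed.

Lemma pairing_sum (L : 'rV[R]_n -> R^o) v : islinear L ->
  L v = pairing (\row_i L (delta_mx 0 i)) v.
Proof.
move=> linL; rewrite [in LHS](row_sum_delta v) islinear_sum//; apply: eq_bigr => i _.
by rewrite islinearZ// mxE mulrC.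
Qed.

Lemma pairing_bound z v : `|pairing z v| <= n%:R * (`|z| * `|v|).
Proof.
rewrite /pairing (le_trans (ler_norm_sum _ _ _))//.
apply: (@le_trans _ _ (\sum_(i < n) `|z| * `|v|)).
  by apply: ler_sum => i _; rewrite normrM ler_pM// row_entry_le.
by rewrite sumr_const card_ord -[leLHS]mulr_natl.
Qed.

Lemma pairingBl z z' v : pairing (z - z') v = pairing z v - pairing z' v.
Proof. exact: (islinearB (pairing_linearl v)). Qed.
Lemma pairingBr z v v' : pairing z (v - v') = pairing z v - pairing z v'.
Proof. exact: (islinearB (pairing_linearr z)). Qed.
Lemma pairingZl k z v : pairing (k *: z) v = k * pairing z v.
Proof. exact: (islinearZ (pairing_linearl v)). Qed.
Lemma pairingZr k z v : pairing z (k *: v) = k * pairing z v.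
Proof. exact: (islinearZ (pairing_linearr z)). Qed.
Lemma pairingNl z v : pairing (- z) v = - pairing z v.
Proof. exact: (islinearN (pairing_linearl v)). Qed.
Lemma pairing0r z : pairing z 0 = 0.
Proof. exact: (islinear0 (pairing_linearr z)). Qed.

Lemma hdw_pairing (w0 : 'rV[R]_n * 'rV[R]_n) :
  @has_diff_within R ('rV[R]_n * 'rV[R]_n)%type R^o setT (fun w => pairing w.1 w.2) w0
    (fun h => pairing h.1 w0.2 + pairing w0.1 h.2).
Proof.
apply/has_diff_withinP; split=> [k u v|e e0].
  rewrite (pairing_linearl w0.2 k u.1 v.1) (pairing_linearr w0.1 k u.2 v.2).
  by rewrite scalerDr addrACA.
have n1 : 0 < n%:R + 1 :> R by rewrite ltr_wpDl.
exists (e / (n%:R + 1)); first by rewrite divr_gt0.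
move=> w; rewrite ltr_pdivlMr// => hw _.
rewrite (_ : _ - _ - _ = pairing (w - w0).1 (w - w0).2 :> R); last first.
  case: w w0 {hw} => [a b] [a0 b0].
  rewrite -[(a, b) - (a0, b0)]/(a - a0, b - b0) /= !pairingBl !pairingBr; ring.
rewrite (le_trans (pairing_bound _ _))//.
have h1 := pair_fst_le (w - w0); have h2 := pair_snd_le (w - w0).
rewrite (@le_trans _ _ (n%:R * (`|w - w0| * `|w - w0|)))//.
  by rewrite ler_wpM2l// ler_pM.
by rewrite mulrA ler_wpM2r//; have := normr_ge0 (w - w0); lra.
Qed.

Lemma coord0_linear : islinear (@coord0 R n : 'rV[R]_n -> R^o).
Proof.
move=> k u v; rewrite /coord0 scaler_sumr -big_split; apply: eq_bigr => i _.
by rewrite !mxE.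
Qed.

Lemma coord0_bound v : `|coord0 v| <= `|v|.
Proof.
rewrite /coord0; case: n v => [|m] v; first by rewrite big_ord0 normr0.
rewrite (big_pred1 ord0); first exact: row_entry_le.
by move=> i.
Qed.

End pairing.

Section manifold.
Context {R : realType} {n : nat} {M : topologicalType} (A : smooth_manifold R n M).
Local Notation V := 'rV[R]_n.
Implicit Types (c : chart A) (x : M) (p q : cotangent A).

Lemma cinvK c z : chart_image c z -> cdom c (cinv c z) /\ cmap c (cinv c z) = z.
Proof. by move=> [x hx <-]; rewrite cmapK. Qed.

Lemma chart_image_map c x : cdom c x -> chart_image c (cmap c x).
Proof. by move=> h; exists x. Qed.

Lemma chart_coord0_ge0 c z : chart_image c z -> 0 <= coord0 z.
Proof. by move=> h; have [P _ E] := cimg_open c; move: h; rewrite /chart_image E => -[]. Qed.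

Lemma chart_image_near c x : cdom c x -> exists2 d : R, 0 < d &
  forall z, `|z - cmap c x| < d -> 0 <= coord0 z -> chart_image c z.
Proof.
move=> hx; have [P oP E] := cimg_open c.
have [Px _] : (P `&` half_space n) (cmap c x) by rewrite -E; exists x.
have /near_normP[d d0 hd] : nbhs (cmap c x) P by exact: open_nbhs_nbhs.
by exists d => // z zd z0; rewrite /chart_image E; split; [exact: hd|].
Qed.

Lemma cinv_near c x (U : set M) : cdom c x -> nbhs x U -> exists2 d : R, 0 < d &
  forall z, chart_image c z -> `|z - cmap c x| < d -> U (cinv c z).
Proof.
move=> hx hU; have /subspace_continuousP h := @cinv_continuous _ _ _ A c.
have := h (cmap c x) (chart_image_map hx).
move=> /(_ U); rewrite /from_subspace /= cmapK// => /(_ hU).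
by move=> /near_normP[d d0 hd]; exists d => // z iz zd; exact: hd.
Qed.

Lemma cmap_near_inv c x (U : set M) : cdom c x -> nbhs x U -> exists2 d : R, 0 < d &
  forall y, cdom c y -> `|cmap c y - cmap c x| < d -> U y.
Proof.
move=> hx /(cinv_near hx)[d d0 hd]; exists d => // y hy yd.
by rewrite -(cmapK hy); apply: hd => //; exact: chart_image_map.
Qed.

Lemma cmap_near c x (d : R) : cdom c x -> 0 < d ->
  \forall y \near nbhs x, cdom c y /\ `|cmap c y - cmap c x| < d.
Proof.
move=> hx d0; have /subspace_continuousP h := @cmap_continuous _ _ _ A c.
have nx : nbhs x (cdom c) by apply: open_nbhs_nbhs; split=> //; exact: cdom_open.
have /cvgrPdist_lt/(_ d d0) h' := h x hx.
have {}h' : \forall y \near nbhs x, cdom c y -> `|cmap c x - cmap c y| < d by exact: h'.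
by apply: filterS (filterI nx h') => y [hy /(_ hy)]; rewrite distrC.
Qed.

Lemma accessible_chart c x (D : set V) (d : R) : cdom c x -> 0 < d ->
  (forall z, chart_image c z -> `|z - cmap c x| < d -> D z) -> accessible D (cmap c x).
Proof.
move=> hx d0 hD v e e0; have [r r0 hr] := chart_image_near hx.
have v1 : 0 < `|v| + 1 by rewrite ltr_wpDl.
pose s := Num.min (e / 2) (Num.min d r / (`|v| + 1) / 2).
have dr0 : 0 < Num.min d r by rewrite lt_min d0.
have s0 : 0 < s by rewrite lt_min !divr_gt0.
have se : s < e by rewrite gt_min ltr_pdivrMr// ltr_pMr// ltr1n.
have sv : s * `|v| < Num.min d r.
  have : s <= Num.min d r / (`|v| + 1) / 2 by rewrite ge_min lexx orbT.
  rewrite ler_pdivlMr// ler_pdivlMr//.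
  have : 0 <= s * `|v| by rewrite mulr_ge0// ltW.
  by lra.
have ix := chart_coord0_ge0 (chart_image_map hx).
have ok (t : R) : `|t| = s -> 0 <= t * coord0 v -> D (cmap c x + t *: v).
  move=> ts tv; have nd : `|cmap c x + t *: v - cmap c x| < Num.min d r.
    by rewrite addrC addKr normrZ ts.
  move: nd; rewrite lt_min => /andP[n1 n2]; apply: hD => //; apply: hr => //.
  by rewrite addrC coord0_linear addr_ge0.
have [cv|cv] := leP 0 (coord0 v).
  exists s; rewrite gt_eqF// gtr0_norm//; split=> //.
  by apply: ok; rewrite ?gtr0_norm// mulr_ge0// ltW.
exists (- s); rewrite oppr_eq0 gt_eqF// normrN gtr0_norm//; split=> //.
by apply: ok; rewrite ?normrN ?gtr0_norm// mulNr oppr_ge0 mulr_ge0_le0// ltW.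
Qed.

Lemma accessible_image c x : cdom c x -> accessible (chart_image c) (cmap c x).
Proof. by move=> hx; exact: (accessible_chart hx (@ltr01 R)). Qed.

Definition overlap c1 c2 : set V := cmap c1 @` (cdom c1 `&` cdom c2).

Lemma overlap_near c1 c2 x : cdom c1 x -> cdom c2 x -> exists2 d : R, 0 < d &
  forall z, chart_image c1 z -> `|z - cmap c1 x| < d -> overlap c1 c2 z.
Proof.
move=> h1 h2; have n2 : nbhs x (cdom c2).
  by apply: open_nbhs_nbhs; split=> //; exact: cdom_open.
have [d d0 hd] := cinv_near h1 n2; exists d => // z iz zd.
have [k1 k2] := cinvK iz; exists (cinv c1 z) => //; split=> //; exact: hd.
Qed.

Lemma accessible_overlap c1 c2 x : cdom c1 x -> cdom c2 x ->
  accessible (overlap c1 c2) (cmap c1 x).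
Proof.
by move=> h1 h2; have [d d0 hd] := overlap_near h1 h2; exact: accessible_chart hd.
Qed.

(** The differentials within the overlap are those of a smooth extension, because
    the points of the overlap are accessible. *)
Lemma transition_ext c1 c2 x : cdom c1 x -> cdom c2 x ->
  exists (O : set V) (tau : V -> V) (d : R), [/\ open O, O (cmap c1 x),
    (forall k, Ck k O tau), 0 < d &
    forall y, cdom c1 y -> `|cmap c1 y - cmap c1 x| < d ->
      [/\ cdom c2 y, O (cmap c1 y), tau (cmap c1 y) = cmap c2 y &
          transition_diff c1 c2 y = fun v => 'D_v tau (cmap c1 y)] ].
Proof.
move=> h1 h2; have [|P [tau [oP Px Ct E]]] := @transition_smooth _ _ _ A c1 c2 (cmap c1 x).
  by exists x.
have /near_normP[r r0 hr] : nbhs (cmap c1 x) P by exact: open_nbhs_nbhs.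
have [d d0 hd] := cmap_near_inv h1
  (open_nbhs_nbhs (conj (@cdom_open _ _ _ A c2) h2)).
have tE y : cdom c1 y -> cdom c2 y -> P (cmap c1 y) -> tau (cmap c1 y) = cmap c2 y.
  move=> y1 y2 Py; rewrite -E /= ?cmapK//; rewrite inE; split=> //.
  by exists y.
exists P, tau, (Num.min d r); split=> //; first by rewrite lt_min d0.
move=> y y1; rewrite lt_min => /andP[yd yr].
have y2 := hd y y1 yd; have Py := hr _ yr; split=> //; first exact: tE.
apply: diff_withinE; first exact: accessible_overlap.
have /near_normP[e e0 he] : nbhs (cmap c1 y) P by exact: open_nbhs_nbhs.
have [C1 _] := Ct 1%N.
apply: (hdw_local e0 _ _ (differentiable_hdw setT (C1 _ Py))).
  move=> z ze [y' [y1' y2'] E']; split=> //; rewrite -E' /= cmapK// tE//.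
  by rewrite E'; exact: he.
by rewrite /= cmapK// tE.
Qed.

Lemma transition_diffP c1 c2 x : cdom c1 x -> cdom c2 x ->
  has_diff_within (overlap c1 c2) (cmap c2 \o cinv c1) (cmap c1 x) (transition_diff c1 c2 x).
Proof.
move=> h1 h2; have [P [tau [d [oP Px Ct d0 h]]]] := transition_ext h1 h2.
have [|_ _ E ->] := h x h1; first by rewrite subrr normr0.
have [C1 _] := Ct 1%N.
apply: (hdw_local d0 _ _ (differentiable_hdw setT (C1 _ Px))).
  move=> z zd [y [y1 y2] Ey]; split=> //=; rewrite -Ey cmapK//.
  by rewrite -Ey in zd; have [] := h y y1 zd.
by rewrite /= cmapK.
Qed.

Lemma transition_diff_linear c1 c2 x : cdom c1 x -> cdom c2 x ->
  islinear (transition_diff c1 c2 x).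
Proof. by move=> h1 h2; case: (transition_diffP h1 h2). Qed.

Lemma transition_diff_id c x v : cdom c x -> transition_diff c c x v = v.
Proof.
move=> hx; have -> // : transition_diff c c x = id.
apply: (hdw_unique (accessible_overlap hx hx)); first exact: transition_diffP.
apply: (hdw_local (@ltr01 R) _ _ (@hdw_linear _ _ _ setT id (cmap c x) _)) => //=.
- by move=> z _ [y [y1 _] <-]; rewrite cmapK.
- by rewrite cmapK.
Qed.

Lemma transition_diff_comp c1 c2 c3 x v : cdom c1 x -> cdom c2 x -> cdom c3 x ->
  transition_diff c2 c3 x (transition_diff c1 c2 x v) = transition_diff c1 c3 x v.
Proof.
move=> h1 h2 h3.
suff -> : transition_diff c1 c3 x = transition_diff c2 c3 x \o transition_diff c1 c2 x by [].
have [d d0 hd] := cmap_near_inv h1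
  (open_nbhs_nbhs (conj (@cdom_open _ _ _ A c2) h2)).
have [e e0 he] := cmap_near_inv h1
  (open_nbhs_nbhs (conj (@cdom_open _ _ _ A c3) h3)).
have acc : accessible (overlap c1 c2 `&` overlap c1 c3) (cmap c1 x).
  have [r r0 hr] := overlap_near h1 h2; have [s s0 hs] := overlap_near h1 h3.
  apply: (@accessible_chart _ _ _ (Num.min r s) h1); first by rewrite lt_min r0.
  by move=> z iz; rewrite lt_min => /andP[zr zs]; split; [exact: hr|exact: hs].
apply: (hdw_unique acc); first by apply: hdw_sub (transition_diffP h1 h3) => z [].
have T12 : has_diff_within (overlap c1 c2 `&` overlap c1 c3) (cmap c2 \o cinv c1)
    (cmap c1 x) (transition_diff c1 c2 x).
  by apply: hdw_sub (transition_diffP h1 h2) => z [].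
have T23 : has_diff_within (overlap c2 c3) (cmap c3 \o cinv c2)
    ((cmap c2 \o cinv c1) (cmap c1 x)) (transition_diff c2 c3 x).
  by rewrite /= cmapK//; exact: transition_diffP.
have E z : (overlap c1 c2 `&` overlap c1 c3) z ->
    overlap c2 c3 ((cmap c2 \o cinv c1) z) /\
    ((cmap c3 \o cinv c2) \o (cmap c2 \o cinv c1)) z = (cmap c3 \o cinv c1) z.
  move=> [[y [y1 y2] <-] [y' [y1' y3] E]] /=.
  have yy : y' = y by rewrite -(cmapK y1') E cmapK.
  by rewrite yy in y3; rewrite !cmapK//; split=> //; exists y.
have H := hdw_comp _ _ T12 T23 (ex_intro2 _ _ 1 ltr01 (fun z _ Dz => (E z Dz).1)).
apply: (hdw_local (@ltr01 R) _ _ (H _ _)) => [z _ Dz|].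
  by split=> //; exact: (E z Dz).2.
by rewrite /= !cmapK.
Qed.

Lemma cotangent_law p c1 c2 v : cdom c1 (base p) -> cdom c2 (base p) ->
  pairing (comp p c1) v = pairing (comp p c2) (transition_diff c1 c2 (base p) v).
Proof. by move=> h1 h2; exact: comp_law. Qed.

Lemma cotangent_eq p q c : cdom c (base p) -> base p = base q -> comp p c = comp q c -> p = q.
Proof.
move=> hc bpq cpq.
have E : comp p = comp q.
  apply/funext => c'; have [h'|h'] := pselect (cdom c' (base p)).
    apply: pairing_inj => v; rewrite (cotangent_law v h' hc) cpq bpq -cotangent_law//.
      by rewrite -bpq.
    by rewrite -bpq.
  by rewrite !comp_out// -bpq.
case: p q bpq E {hc cpq} => [x a ao al] [y b bo bl] /= E1 E2; subst y b.
by rewrite (Prop_irrelevance ao bo) (Prop_irrelevance al bl).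
Qed.

(** The components in the other charts are forced by the transformation law, which
    is consistent by the chain rule. *)
Lemma cotangent_exists c x (zeta : V) : cdom c x ->
  exists p, base p = x /\ comp p c = zeta.
Proof.
move=> hx.
pose a c' : V := if pselect (cdom c' x) then
   \row_i pairing zeta (transition_diff c' c x (delta_mx 0 i)) else 0.
have aE c' : cdom c' x -> forall v, pairing (a c') v = pairing zeta (transition_diff c' c x v).
  move=> h' v; rewrite /a; case: pselect => [?|//].
  rewrite -(@pairing_sum _ _ (fun v => pairing zeta (transition_diff c' c x v)))//.
  by move=> k u w; rewrite (transition_diff_linear h' hx) pairing_linearr.
have ao c' : ~ cdom c' x -> a c' = 0 by rewrite /a; case: pselect => [?|?] //.
have al c1 c2 : cdom c1 x -> cdom c2 x -> forall v,
    pairing (a c1) v = pairing (a c2) (transition_diff c1 c2 x v).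
  by move=> h1 h2 v; rewrite !aE// transition_diff_comp.
exists (@Cotangent _ _ _ A x a ao al); split=> //=.
by apply: pairing_inj => v; rewrite aE// transition_diff_id.
Qed.

Lemma cotangent_atE p c : cdom c (base p) ->
  cotangent_at c (cmap c (base p)) (comp p c) = p.
Proof.
move=> hc; rewrite /cotangent_at; case: xgetP => [q _ [/= bq cq]|/(_ p)[]]; last first.
  by rewrite cmapK.
by apply: (@cotangent_eq _ _ c) => //; rewrite bq cmapK.
Qed.

Lemma cotangent_at_map c x zeta : cdom c x ->
  base (cotangent_at c (cmap c x) zeta) = x /\ comp (cotangent_at c (cmap c x) zeta) c = zeta.
Proof.
move=> hx; have [p [bp cp]] := cotangent_exists zeta hx; subst x zeta.
by rewrite cotangent_atE.
Qed.

Lemma nonzero_comp p c : cdom c (base p) -> nonzero p <-> comp p c != 0.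
Proof.
move=> hc; split=> [[c' c'0]|]; last by exists c.
apply: contra_neq c'0 => c0; have [h'|h'] := pselect (cdom c' (base p)); last exact: comp_out.
apply: pairing_inj => v; rewrite (cotangent_law v h' hc) c0.
by rewrite /pairing !big1// => i _; rewrite mxE mul0r.
Qed.

End manifold.

Section charts.
Context {R : realType} {n : nat} {M : topologicalType} (A : smooth_manifold R n M).
Local Notation V := 'rV[R]_n.
Local Notation E := (V * V)%type.
Implicit Types (c : chart A) (x : M) (p q : cotangent A).

Definition state c p : E := (cmap c (base p), comp p c).

Lemma state_inj c p q : cdom c (base p) -> cdom c (base q) -> state c p = state c q -> p = q.
Proof.
move=> hp hq [E1 E2]; apply: (cotangent_eq hp) => //.
by rewrite -(cmapK hp) E1 cmapK.
Qed.

Lemma fst_linear : islinear (fst : E -> V).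
Proof. by []. Qed.

Lemma snd_linear : islinear (snd : E -> V).
Proof. by []. Qed.

Lemma entry_linear (i : 'I_n) : islinear (fun v : V => v 0 i : R^o).
Proof. by move=> k u v; rewrite !mxE. Qed.

Lemma tame_pairing (f g : E -> V) w0 : tame f w0 -> tame g w0 ->
  tame (fun w => pairing (f w) (g w) : R^o) w0.
Proof.
move=> tf tg; apply: tame_sum => i; apply: tame_mul.
  by apply: tame_comp tf (tame_linear _ _ (entry_linear i)).
by apply: tame_comp tg (tame_linear _ _ (entry_linear i)).
Qed.

(** Passing from one chart of the cotangent bundle to another; the last clause
    says that the canonical one-form, evaluated on a difference of base points,
    does not depend on the chart up to second order. *)
Lemma transition_tame p0 c1 c2 : cdom c1 (base p0) -> cdom c2 (base p0) ->
  exists (Psi : E -> E) (K : R), [/\ 0 < K, tame Psi (state c1 p0) &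
    forall p, cdom c1 (base p) -> `|state c1 p - state c1 p0| < K^-1 ->
      [/\ cdom c2 (base p), state c2 p = Psi (state c1 p) &
        forall p', cdom c1 (base p') -> `|state c1 p' - state c1 p0| < K^-1 ->
          `|pairing (comp p c2) (cmap c2 (base p') - cmap c2 (base p)) -
            pairing (comp p c1) (cmap c1 (base p') - cmap c1 (base p))|
          <= K * `|cmap c1 (base p') - cmap c1 (base p)| ^+ 2]].
Proof.
move=> h1 h2; have [P [tau [d [oP Px Ct d0 ht]]]] := transition_ext h1 h2.
have [Q [sig [e [oQ Qx Cs e0 hs]]]] := transition_ext h2 h1.
have := @cmap_near_inv _ _ _ _ c1 (base p0) _ h1 (cmap_near h2 e0).
move=> [r r0 hr].
have [|_ _ t0 _] := ht (base p0) h1; first by rewrite subrr normr0.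
pose Psi (w : E) : E := (tau w.1, \row_i pairing w.2 ('D_(delta_mx 0 i) sig (tau w.1))).
have [Kt [Ht _]] := Ck2_C11 (finite_frame_row n) oP Px (Ct 2%N).
have tt : tame (tau \o fst) (state c1 p0).
  apply: tame_comp; first exact: tame_linear fst_linear.
  exact: C11_tame Ht.
have tPsi : tame Psi (state c1 p0).
  apply: tame_pair => //; apply: tame_row => i; apply: tame_pairing.
    exact: tame_linear snd_linear.
  apply: (@tame_comp _ _ _ _ (tau \o fst) (fun z => 'D_(delta_mx 0 i) sig z) _ tt).
  rewrite /= t0.
  have [_ /(_ (delta_mx 0 i)) C2] := Cs 3%N.
  have [Ks [Hs _]] := Ck2_C11 (finite_frame_row n) oQ Qx C2.
  exact: C11_tame Hs.
have [b b0 hb] := tame_near tPsi erefl (@ltr01 R).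
have Kt0 : 0 < Kt := Ht.1.
pose B := `|Psi (state c1 p0)| + 1; have B0 : 0 < B by rewrite ltr_wpDl.
have di : 0 < d^-1 by rewrite invr_gt0. have ri : 0 < r^-1 by rewrite invr_gt0.
have bi : 0 < b^-1 by rewrite invr_gt0.
have nB : 0 <= n%:R * (B * Kt) by rewrite !mulr_ge0// ltW.
pose K := d^-1 + r^-1 + b^-1 + Kt + n%:R * (B * Kt).
have K0 : 0 < K by rewrite /K; lra.
have Kd : K^-1 <= d by rewrite invf_ple ?posrE// /K; lra.
have Kr : K^-1 <= r by rewrite invf_ple ?posrE// /K; lra.
have Kb : K^-1 <= b by rewrite invf_ple ?posrE// /K; lra.
have KKt : K^-1 <= Kt^-1 by rewrite lef_pV2 ?posrE// /K; lra.
exists Psi, K; split=> // p hp pK.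
have zK q : `|state c1 q - state c1 p0| < K^-1 ->
    `|cmap c1 (base q) - cmap c1 (base p0)| < K^-1.
  by apply: le_lt_trans; exact: (pair_fst_le (state c1 q - state c1 p0)).
have [k2 _ te td] := ht _ hp (lt_le_trans (zK _ pK) Kd).
have [_ pe] := hr _ hp (lt_le_trans (zK _ pK) Kr).
have [_ _ _ sd] := hs _ k2 pe.
have sE : state c2 p = Psi (state c1 p).
  rewrite /state /Psi /= te; congr pair; apply/rowP => i; rewrite mxE.
  have Ei := congr1 (fun f => f (delta_mx 0 i)) sd; rewrite /= in Ei.
  by rewrite -[in LHS]pairing_delta (cotangent_law _ k2 hp) Ei.
split=> // p' hp' pK'.
have [_ _ te' _] := ht _ hp' (lt_le_trans (zK _ pK') Kd).
rewrite (cotangent_law (_ - _) hp k2) td -te -te' -pairingBr.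
rewrite (le_trans (pairing_bound _ _))//.
have c2B : `|comp p c2| <= B.
  have /(_ _ _ (lt_le_trans pK Kb) erefl) := hb; rewrite -sE => hB.
  rewrite -[comp p c2]/((state c2 p).2) (le_trans (pair_snd_le _))//.
  rewrite -[state c2 p](subrK (Psi (state c1 p0))) (le_trans (ler_normD _ _))//.
  by rewrite addrC lerD2l ltW.
have := C11_taylor _ Ht (lt_le_trans (zK _ pK) KKt) (lt_le_trans (zK _ pK') KKt).
move=> /(_ _) T.
apply: (@le_trans _ _ (n%:R * (B * (Kt * `|cmap c1 (base p') - cmap c1 (base p)| ^+ 2)))).
  by rewrite ler_wpM2l// ler_pM.
by rewrite [B * _]mulrA mulrA ler_wpM2r ?exprn_ge0// /K; lra.
Qed.

(** A function of s that is nonnegative for s of both signs and vanishes at s = 0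
    has zero derivative there. *)
Lemma coord0_derivative (D : set V) (f : V -> V) a L u :
  has_diff_within D f a L -> coord0 (f a) = 0 -> (forall z, D z -> 0 <= coord0 (f z)) ->
  (exists2 d : R, 0 < d & forall s : R, `|s| < d -> D (a + s *: u)) -> coord0 (L u) = 0.
Proof.
move=> /has_diff_withinP[linL hL] fa fge [d d0 hd].
apply: (@small_norm_eq0 _ _ (coord0 (L u) : R^o) `|u|) => // e e0.
have [r r0 hr] := hL e e0.
have u1 : 0 < `|u| + 1 by rewrite ltr_wpDl.
pose s : R := Num.min (d / 2) (r / (`|u| + 1) / 2).
have s0 : 0 < s by rewrite lt_min !divr_gt0.
have sd : s < d by rewrite gt_min ltr_pdivrMr// ltr_pMr// ltr1n.
have sr : s * `|u| < r.
  have : s <= r / (`|u| + 1) / 2 by rewrite ge_min lexx orbT.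
  rewrite ler_pdivlMr// ler_pdivlMr//.
  have : 0 <= s * `|u| by rewrite mulr_ge0// ltW.
  by lra.
have key (t : R) : `|t| = s -> - (e * `|u|) * s <= t * coord0 (L u).
  move=> ts; have Dt : D (a + t *: u) by apply: hd; rewrite ts.
  have := hr (a + t *: u); rewrite [a + _]addrC addrK normrZ ts => /(_ sr).
  rewrite [t *: u + a]addrC => /(_ Dt) H.
  have := le_trans (coord0_bound _) H.
  rewrite !(islinearB coord0_linear) fa subr0 (islinearZ linL) (islinearZ coord0_linear).
  rewrite ler_norml => /andP[_]; have := fge _ Dt.
  rewrite -[t *: (_ : R^o)]/(t * _); lra.
rewrite -(ler_pM2l s0) -[X in X * _ <= _]gtr0_norm// -normrM ler_norml.
have := key s (gtr0_norm s0); have := key (- s); rewrite normrN (gtr0_norm s0) => /(_ erefl).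
by move=> *; apply/andP; split; lra.
Qed.

Lemma transition_diff_coord0 c c' x v : cdom c x -> cdom c' x -> coord0 (cmap c' x) = 0 ->
  0 < coord0 (cmap c x) \/ coord0 v = 0 -> coord0 (transition_diff c c' x v) = 0.
Proof.
move=> h h' c0 hv; apply: (coord0_derivative (transition_diffP h h')).
- by rewrite /= cmapK.
- move=> z [y [y1 y2] <-] /=; rewrite cmapK//.
  exact: chart_coord0_ge0 (chart_image_map y2).
have [d d0 hd] := overlap_near h h'; have [r r0 hr] := chart_image_near h.
have v1 : 0 < `|v| + 1 by rewrite ltr_wpDl.
have cge := chart_coord0_ge0 (chart_image_map h).
have [m m0 hm] : exists2 m : R, 0 < m & forall s : R, `|s| < m -> 0 <= coord0 (cmap c x + s *: v).
  case: hv => hv; last first.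
    exists 1 => // s _; rewrite (islinearD coord0_linear) (islinearZ coord0_linear) hv.
    by rewrite scaler0 addr0.
  exists (coord0 (cmap c x) / (`|v| + 1)); first by rewrite divr_gt0.
  move=> s; rewrite ltr_pdivlMr// => sv.
  rewrite (islinearD coord0_linear) (islinearZ coord0_linear) -[s *: (_ : R^o)]/(s * _).
  have : `|s * coord0 v| <= `|s| * `|v| by rewrite normrM ler_wpM2l// coord0_bound.
  by rewrite ler_norml => /andP[]; have := normr_ge0 s; lra.
exists (Num.min m (Num.min d r / (`|v| + 1))).
  by rewrite lt_min m0 divr_gt0// lt_min d0.
move=> s; rewrite lt_min => /andP[sm]; rewrite ltr_pdivlMr// => sv.
have : `|cmap c x + s *: v - cmap c x| < Num.min d r.
  rewrite addrC addKr normrZ (le_lt_trans _ sv)// ler_wpM2l// lerDl//.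
by rewrite lt_min => /andP[sd sr]; apply: hd => //; apply: hr => //; exact: hm.
Qed.

(** If x were interior in the chart c, the differential of the change of charts,
    although invertible, would take its values in the hyperplane coord0 v = 0. *)
Lemma boundary_chart c x : boundary A x -> cdom c x -> coord0 (cmap c x) = 0.
Proof.
move=> [c' h' c'0] h; have := chart_coord0_ge0 (chart_image_map h).
rewrite le_eqVlt => /orP[/eqP//|c0].
have [v hv] : exists v, transition_diff c c' x v = cmap c x.
  by exists (transition_diff c' c x (cmap c x)); rewrite transition_diff_comp// transition_diff_id.
by rewrite -hv; apply: transition_diff_coord0 => //; left.
Qed.

Lemma interior_chart c x : ~ boundary A x -> cdom c x -> 0 < coord0 (cmap c x).
Proof.
move=> nb h; have := chart_coord0_ge0 (chart_image_map h).
by rewrite le_eqVlt => /orP[/eqP c0|//]; case: nb; exists c.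
Qed.

Lemma is_differential_chart (f : M -> R) p c : cdom c (base p) ->
  @has_diff_within R V R^o (chart_image c) (f \o cinv c) (cmap c (base p)) (pairing (comp p c)) ->
  is_differential f p.
Proof.
move=> h D c' h'; have [d d0 hd] := overlap_near h' h.
have D' : @has_diff_within R V R^o (chart_image c) (f \o cinv c)
    ((cmap c \o cinv c') (cmap c' (base p))) (pairing (comp p c)) by rewrite /= cmapK.
have ov z : overlap c' c z -> chart_image c ((cmap c \o cinv c') z).
  by move=> [y [y1 y2] <-] /=; rewrite cmapK//; exact: chart_image_map.
have H := hdw_comp _ _ (transition_diffP h' h) D' (ex_intro2 _ _ 1 ltr01 (fun z _ => @ov z)).
have -> : pairing (comp p c') = pairing (comp p c) \o transition_diff c' c (base p).
  by apply/funext => v; rewrite /= -cotangent_law.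
apply: (hdw_local d0 _ _ (H _ _)) => [z zd iz|].
  have oz := hd z iz zd; split=> //; case: oz => y [y1 y2] <- /=.
  by rewrite !cmapK.
by rewrite /= !cmapK.
Qed.

Lemma is_differential_unique (f : M -> R) p q :
  is_differential f p -> is_differential f q -> base p = base q -> p = q.
Proof.
move=> dp dq bpq; have [c hc] := cdom_cover A (base p).
apply: (cotangent_eq hc bpq); apply: pairing_inj => v.
have hq : cdom c (base q) by rewrite -bpq.
have := dq c hq; rewrite -bpq => dq'.
by have -> := hdw_unique (accessible_image hc) (dp c hc) dq'.
Qed.

End charts.

(** * The Hamiltonian in a chart *)

Section hamiltonian_chart.
Context {R : realType} {n : nat} {M : topologicalType} {A : smooth_manifold R n M}
  (H : cotangent A -> R).
Hypothesis hH : hamiltonian_conditions H.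
Local Notation V := 'rV[R]_n.
Local Notation E := (V * V)%type.
Implicit Types (c : chart A) (x : M) (p q : cotangent A).

Lemma phase_image_state c p : cdom c (base p) -> nonzero p -> phase_image c (state c p).
Proof.
by move=> hc /(nonzero_comp hc) h; split=> //; exact: chart_image_map.
Qed.

Lemma Hchart_state c p : cdom c (base p) -> Hchart H c (state c p) = H p.
Proof. by move=> hc; rewrite /Hchart /= cotangent_atE. Qed.

Lemma phase_imageP c w : phase_image c w ->
  exists p, [/\ cdom c (base p), nonzero p & w = state c p].
Proof.
case: w => z zeta [/= /cinvK[k1 k2] z0].
have [p [bp cp]] := cotangent_exists zeta k1.
exists p; have hc : cdom c (base p) by rewrite bp.
by split=> //; [apply/(nonzero_comp hc); rewrite cp|rewrite /state bp k2 cp].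
Qed.

Lemma nonzero_near c p : cdom c (base p) -> nonzero p -> exists2 d : R, 0 < d &
  forall w : E, `|w - state c p| < d -> w.2 != 0.
Proof.
move=> hc /(nonzero_comp hc) h; exists `|comp p c|; first by rewrite normr_gt0.
move=> w wd; apply/eqP => w0.
have := le_lt_trans (pair_snd_le (w - state c p)) wd.
by rewrite -[(w - _).2]/(w.2 - comp p c) w0 sub0r normrN ltxx.
Qed.

Lemma accessible_phase c p : cdom c (base p) -> nonzero p ->
  accessible (phase_image c) (state c p).
Proof.
move=> hc p0 w d d0; have [e e0 he] := nonzero_near hc p0.
have w1 : 0 < `|w| + 1 by rewrite ltr_wpDl.
have [s [s0 sd iz]] := accessible_image hc w.1 (d := Num.min d (e / (`|w| + 1)))
  ltac:(by rewrite lt_min d0 divr_gt0).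
move: sd; rewrite lt_min => /andP[sd]; rewrite ltr_pdivlMr// => se.
exists s; split=> //; split=> //=; apply: (he (state c p + s *: w)).
by rewrite addrC addKr normrZ (le_lt_trans _ se)// ler_wpM2l// lerDl.
Qed.

(** As for the changes of charts, the differentials within the phase space are
    those of a smooth extension. *)
Lemma hamiltonian_ext c p0 : cdom c (base p0) -> nonzero p0 ->
  exists (P : set E) (h : E -> R^o) (d : R), [/\ open P, P (state c p0),
    (forall k, Ck k P h), 0 < d &
    forall p, cdom c (base p) -> `|state c p - state c p0| < d ->
      [/\ nonzero p, P (state c p), h (state c p) = H p,
          @has_diff_within R E R^o (phase_image c) (Hchart H c) (state c p) (dHchart H c p) &
          dHchart H c p = fun v => 'D_v h (state c p)]].
Proof.
move=> hc p00; have [|P [h [oP P0 Ch Eh]]] := H_smooth hH (c := c) (a := state c p0).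
  exact: phase_image_state.
have /near_normP[r r0 hr] : nbhs (state c p0) P by exact: open_nbhs_nbhs.
have [e e0 he] := nonzero_near hc p00.
exists P, h, (Num.min r e); split=> //; first by rewrite lt_min r0.
move=> p pc; rewrite lt_min => /andP[pr pe].
have pn : nonzero p by apply/(nonzero_comp pc); exact: (he _ pe).
have Pp := hr _ pr.
have hE q : cdom c (base q) -> nonzero q -> P (state c q) -> h (state c q) = H q.
  move=> qc qn Pq; rewrite -Eh ?Hchart_state// inE; split=> //.
  exact: phase_image_state.
have D : @has_diff_within R E R^o (phase_image c) (Hchart H c) (state c p)
    (fun v => 'D_v h (state c p)).
  have /near_normP[s s0 hs] : nbhs (state c p) P by exact: open_nbhs_nbhs.
  apply: (hdw_local s0 _ _ (differentiable_hdw setT ((Ch 1%N).1 _ Pp))).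
    move=> w ws /phase_imageP[q [qc qn Eq]]; split=> //.
    by rewrite Eq hE// ?Hchart_state// -Eq; exact: hs.
  by rewrite hE// Hchart_state.
have dE : dHchart H c p = fun v => 'D_v h (state c p).
  by apply: diff_withinE => //; exact: accessible_phase.
by split=> //; [exact: hE|rewrite dE].
Qed.

Lemma dHchartP c p : cdom c (base p) -> nonzero p ->
  @has_diff_within R E R^o (phase_image c) (Hchart H c) (state c p) (dHchart H c p).
Proof.
move=> hc p0; have [P [h [d [_ _ _ d0 /(_ p hc)]]]] := hamiltonian_ext hc p0.
by rewrite subrr normr0 => /(_ d0)[].
Qed.

Lemma linear_split (L : E -> R^o) a b : islinear L ->
  L (a, b) = pairing (\row_i L (delta_mx 0 i, 0)) a + pairing (\row_i L (0, delta_mx 0 i)) b.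
Proof.
move=> linL.
have -> : (a, b) = (a, 0) + (0, b) :> E by rewrite -[RHS]/(a + 0, 0 + b) addr0 add0r.
rewrite (islinearD linL); congr (_ + _).
  apply: (@pairing_sum _ _ (fun a => L (a, 0))) => k u v.
  by rewrite -linL -[_ *: (u, 0) + _]/(k *: u + v, k *: 0 + 0) scaler0 addr0.
apply: (@pairing_sum _ _ (fun a => L (0, a))) => k u v.
by rewrite -linL -[_ *: (0, u) + _]/(k *: 0 + 0, k *: u + v) scaler0 addr0.
Qed.

Lemma dHchart_split c p a b : cdom c (base p) -> nonzero p ->
  dHchart H c p (a, b) = pairing (H_x H c p) a + pairing (H_xi H c p) b.
Proof. by move=> hc p0; rewrite linear_split//; case: (dHchartP hc p0). Qed.

Lemma scale_state c k p : state c (covector_scale k p) = (cmap c (base p), k *: comp p c).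
Proof. by []. Qed.

Lemma nonzero_scale k p : k != 0 -> nonzero p -> nonzero (covector_scale k p).
Proof. by move=> k0 [c hc]; exists c; rewrite /= scaler_eq0 negb_or k0. Qed.

Lemma covector_scale_scale k l p : covector_scale k (covector_scale l p) = covector_scale (k * l) p.
Proof.
have [c hc] := cdom_cover A (base p).
by apply: (@cotangent_eq _ _ _ _ _ _ c) => //=; rewrite scalerA.
Qed.

Lemma covector_scale1 p : covector_scale 1 p = p.
Proof.
have [c hc] := cdom_cover A (base p).
by apply: (@cotangent_eq _ _ _ _ _ _ c) => //=; rewrite scale1r.
Qed.

(** The identity of Euler: differentiate H (x, (1 + s) xi) = (1 + s)^2 H (x, xi) at
    s = 0. *)
Lemma euler_identity c p : cdom c (base p) -> nonzero p ->
  pairing (comp p c) (H_xi H c p) = 2 * H p.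
Proof.
move=> hc p0; have D := dHchartP hc p0.
have <- : dHchart H c p (0, comp p c) = pairing (comp p c) (H_xi H c p).
  rewrite dHchart_split// pairing0r add0r.
  by apply: eq_bigr => i _; rewrite mulrC.
pose B := [set s : R^o | `|s| < 1].
have accB : accessible B 0.
  move=> v d d0; have v1 : 0 < `|v| + 1 by rewrite ltr_wpDl.
  pose s : R := Num.min (d / 2) (2^-1 / (`|v| + 1)).
  have s0 : 0 < s by rewrite lt_min !divr_gt0.
  exists s; rewrite gt_eqF// gtr0_norm//; split=> //.
    by rewrite gt_min ltr_pdivrMr// ltr_pMr// ltr1n.
  rewrite /B /= add0r normrM gtr0_norm//.
  have : s <= 2^-1 / (`|v| + 1) by rewrite ge_min lexx orbT.
  rewrite ler_pdivlMr//; have : 0 <= s * `|v| by rewrite mulr_ge0// ltW.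
  by lra.
have D1 : @has_diff_within R R^o E B (fun s => state c p + s *: (0, comp p c)) 0
    (fun s => 0 + s *: (0, comp p c)).
  apply: hdwD; first exact: hdw_cst.
  by apply: hdw_linear => k u v; rewrite scalerDl scalerA.
have stE (s : R) : state c p + s *: (0, comp p c) = state c (covector_scale (1 + s) p).
  rewrite scale_state -[LHS]/(cmap c (base p) + s *: 0, comp p c + s *: comp p c).
  by rewrite scaler0 addr0 scalerDl scale1r.
have D2 : @has_diff_within R R^o R^o B (fun s => (1 + s) ^+ 2 * H p) 0 (fun s => s * (2 * H p)).
  apply/has_diff_withinP; split=> [k u v|e e0].
    by rewrite mulrDl -[k *: u]/(k * u) -mulrA.
  have h1 : 0 < `|H p| + 1 by rewrite ltr_wpDl.
  exists (e / (`|H p| + 1)); first by rewrite divr_gt0.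
  move=> s; rewrite subr0 ltr_pdivlMr// => sd _.
  rewrite (_ : _ - _ - _ = s * (s * H p)); last by ring.
  rewrite !normrM mulrC ler_wpM2r//.
  by have := normr_ge0 s; lra.
have D3 : @has_diff_within R E R^o (phase_image c) (Hchart H c)
    (state c p + 0 *: (0, comp p c)) (dHchart H c p) by rewrite scale0r addr0.
have pos (s : R^o) : B s -> 0 < 1 + s by rewrite /B /= ltr_norml => /andP[]; lra.
have ex : exists2 d : R, 0 < d & forall z : R^o, `|z - 0| < d -> B z ->
    phase_image c (state c p + z *: (0, comp p c)).
  exists 1 => // s _ /pos s0; rewrite stE; apply: phase_image_state => //.
  by apply: nonzero_scale; rewrite ?gt_eqF.
have D4 := hdw_comp _ _ D1 D3 ex.
have D5 : @has_diff_within R R^o R^o B (fun s => (1 + s) ^+ 2 * H p) 0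
    (dHchart H c p \o (fun s => 0 + s *: (0, comp p c))).
  apply: (hdw_local (@ltr01 R) _ _ (D4 _ _)) => [s _ /[dup] Bs /pos s0|].
    split=> //=; rewrite stE Hchart_state// (H_homogeneous hH)//.
  by rewrite /= scale0r addr0 Hchart_state// addr0 expr1n mul1r.
have := congr1 (fun f => f 1) (hdw_unique accB D5 D2).
by rewrite /= add0r scale1r mul1r.
Qed.

(** Differentiate the homogeneity relation with respect to x and to xi. *)
Lemma dHchart_scale c k p : cdom c (base p) -> nonzero p -> 0 < k ->
  H_x H c (covector_scale k p) = k ^+ 2 *: H_x H c p /\
  H_xi H c (covector_scale k p) = k *: H_xi H c p.
Proof.
move=> hc p0 k0; have k0' : k != 0 by rewrite gt_eqF.
have n0 : nonzero (covector_scale k p) by exact: nonzero_scale.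
pose S (w : E) : E := (w.1, k^-1 *: w.2).
have linS : islinear S.
  move=> l u v; rewrite /S -[RHS]/(l *: u.1 + v.1, l *: (k^-1 *: u.2) + k^-1 *: v.2).
  by rewrite /= scalerDr !scalerA mulrC.
have D3 : @has_diff_within R E R^o (phase_image c) (Hchart H c)
    (S (state c (covector_scale k p))) (dHchart H c p).
  by rewrite /S /= scalerA mulVf// scale1r; exact: dHchartP.
have ph w : phase_image c w -> phase_image c (S w).
  by move=> [h1 h2]; split=> //=; rewrite scaler_eq0 negb_or invr_eq0 k0'.
have D4 := hdw_comp _ _ (@hdw_linear _ _ _ (phase_image c) S _ linS) D3
  (ex_intro2 _ _ 1 ltr01 (fun w _ => @ph w)).
have D5 := hdwZ (k ^+ 2) (D4 _ _).
have D6 : @has_diff_within R E R^o (phase_image c) (Hchart H c)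
    (state c (covector_scale k p)) (fun v => k ^+ 2 *: (dHchart H c p \o S) v).
  have hE w : phase_image c w -> k ^+ 2 *: ((Hchart H c \o S) w : R^o) = Hchart H c w.
    move=> /phase_imageP[q [qc qn ->]].
    have -> : (Hchart H c \o S) (state c q) = Hchart H c (state c (covector_scale k^-1 q)) by [].
    rewrite !Hchart_state// (H_homogeneous hH) ?invr_gt0//.
    by rewrite -[_ *: _]/(_ * _) exprVn mulrA mulfV ?mul1r// expf_neq0.
  apply: (hdw_local (@ltr01 R) _ _ (D5 _ _)) => [w _ pw|]; first by split=> //; exact: hE.
  by apply: hE; exact: phase_image_state.
have dE : dHchart H c (covector_scale k p) = fun v => k ^+ 2 *: (dHchart H c p \o S) v.
  by apply: diff_withinE => //; exact: accessible_phase.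
split; apply/rowP => i; rewrite !mxE dE /= /S /=.
  by rewrite scaler0.
have linL : islinear (dHchart H c p) by case: (dHchartP hc p0).
have -> : (0, k^-1 *: delta_mx 0 i) = k^-1 *: (0, delta_mx 0 i) :> E.
  by rewrite -[RHS]/(k^-1 *: 0, k^-1 *: delta_mx 0 i) scaler0.
rewrite (islinearZ linL) -[k ^+ 2 *: _]/(k ^+ 2 * (k^-1 * _)) mulrA expr2.
by rewrite -[k * k * k^-1]mulrA mulfV// mulr1.
Qed.

End hamiltonian_chart.

(** * Bicharacteristics and the flow *)

Section bicharacteristics.
Context {R : realType} {n : nat} {M : topologicalType} {A : smooth_manifold R n M}
  (H : cotangent A -> R).
Hypothesis hH : hamiltonian_conditions H.
Local Notation V := 'rV[R]_n.
Local Notation E := (V * V)%type.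
Implicit Types (c d : chart A) (p q : cotangent A) (g : R -> cotangent A).

Lemma within_curveP (f : R -> M) (a b : R) : {within `[a, b], continuous f} <->
  forall t, a <= t <= b -> forall U, nbhs (f t) U ->
    exists2 d : R, 0 < d & forall s, a <= s <= b -> `|s - t| < d -> U (f s).
Proof.
split=> [/subspace_continuousP h t tab U hU|h].
  have /(_ t) := h; rewrite /= in_itv /= => /(_ tab) /(_ U hU).
  move=> [d d0 hd]; exists d => //= s sab st; apply: hd; last by rewrite /= in_itv.
  by rewrite /= distrC.
apply/subspace_continuousP => t; rewrite /= in_itv /= => tab U /(h t tab)[d d0 hd].
exists d => //= s /=; rewrite distrC => st; rewrite in_itv /= => sab; exact: hd.
Qed.

Lemma bichar_near (a b : R) g t (U : set M) : bicharacteristic H a b g -> a <= t <= b ->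
  nbhs (base (g t)) U ->
  exists2 d : R, 0 < d & forall s, a <= s <= b -> `|s - t| < d -> U (base (g s)).
Proof. by move=> [/within_curveP h _] tab hU; exact: (h t tab U hU). Qed.

Lemma bichar_at (a b : R) g t c : bicharacteristic H a b g -> a <= t <= b ->
  cdom c (base (g t)) ->
  nonzero (g t) /\ @has_diff_within R R^o E `[a, b] (state c \o g) t
    (fun s => s *: (H_xi H c (g t), - H_x H c (g t))).
Proof.
move=> [_ /(_ t)]; rewrite /= in_itv /= => h tab hc; have [h1 h2] := h tab.
by split=> //; exact: h2.
Qed.

Lemma bichar_intro (a b : R) g :
  (forall t, a <= t <= b -> forall U, nbhs (base (g t)) U ->
    exists2 d : R, 0 < d & forall s, a <= s <= b -> `|s - t| < d -> U (base (g s))) ->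
  (forall t, a <= t <= b -> nonzero (g t) /\ forall c, cdom c (base (g t)) ->
    @has_diff_within R R^o E `[a, b] (state c \o g) t
      (fun s => s *: (H_xi H c (g t), - H_x H c (g t)))) ->
  bicharacteristic H a b g.
Proof.
move=> h1 h2; split; first by apply/within_curveP; exact: h1.
by move=> t; rewrite /= in_itv /= => /h2.
Qed.

Lemma bichar_sub (a b a' b' : R) g : a <= a' -> b' <= b ->
  bicharacteristic H a b g -> bicharacteristic H a' b' g.
Proof.
move=> aa bb hg; have sub t : a' <= t <= b' -> a <= t <= b.
  by move=> /andP[h1 h2]; rewrite (le_trans aa h1) (le_trans h2 bb).
apply: bichar_intro => [t tab U hU|t tab].
  have [d d0 hd] := bichar_near hg (sub _ tab) hU; exists d => // s sab.
  by apply: hd; exact: sub.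
have [c0 hc0] := cdom_cover A (base (g t)).
split=> [|c hc]; first by have [] := bichar_at hg (sub _ tab) hc0.
have [_] := bichar_at hg (sub _ tab) hc; apply: hdw_sub => s /=.
by rewrite !in_itv /=; exact: sub.
Qed.

Lemma bichar_deriv (a b a' b' : R) g c : a <= a' -> b' <= b -> bicharacteristic H a b g ->
  (forall t, a' <= t <= b' -> cdom c (base (g t))) ->
  deriv_on a' b' (state c \o g) (fun t => (H_xi H c (g t), - H_x H c (g t)) : E).
Proof.
move=> aa bb /(bichar_sub aa bb) hg hc; apply/deriv_onP => t tab.
by have [] := bichar_at hg tab (hc t tab).
Qed.

(** H_xi is homogeneous of degree one and H_x of degree two in xi, so that
    multiplying the covectors by k amounts to running k times faster. *)
Lemma bichar_reparam (a b k m : R) g : 0 < k ->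
  bicharacteristic H (k * a + m) (k * b + m) g ->
  bicharacteristic H a b (fun s => covector_scale k (g (k * s + m))).
Proof.
move=> k0 hg; have tt t : a <= t <= b -> k * a + m <= k * t + m <= k * b + m.
  by move=> /andP[h1 h2]; rewrite !lerD2r !ler_pM2l// h1.
apply: bichar_intro => [t tab U /= hU|t tab].
  have [d d0 hd] := bichar_near hg (tt t tab) hU; exists (d / k); first by rewrite divr_gt0.
  move=> s sab; rewrite ltr_pdivlMr// => st; apply: hd; first exact: tt.
  by rewrite opprD addrACA subrr addr0 -mulrBr normrM gtr0_norm// mulrC.
have [c0 hc0] := cdom_cover A (base (g (k * t + m))).
split=> [|c /= hc].
  by apply: nonzero_scale; [rewrite gt_eqF|have [] := bichar_at hg (tt t tab) hc0].
have [n0 D] := bichar_at hg (tt t tab) hc.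
have [-> ->] := dHchart_scale hH hc n0 k0.
pose S (w : E) : E := (w.1, k *: w.2).
have linS : islinear S.
  move=> l u v; rewrite /S -[RHS]/(l *: u.1 + v.1, l *: (k *: u.2) + k *: v.2).
  by rewrite /= scalerDr !scalerA mulrC.
have D1 : @has_diff_within R R^o R^o `[a, b] (fun s => k * s + m) t (fun s => k *: s + 0).
  apply: hdwD; last exact: hdw_cst.
  by apply: hdw_linear => l u v; rewrite mulrDr; congr (_ + _); exact: mulrCA.
have D2 := hdw_comp _ _ D1 D (ex_intro2 _ _ 1 ltr01 _).
have D3 := hdw_comp _ _ (D2 _ _ _) (@hdw_linear _ _ _ setT S _ linS) (ex_intro2 _ _ 1 ltr01 (fun _ _ _ => I)).
have -> : (fun s : R^o => s *: (k *: H_xi H c (g (k * t + m)), - (k ^+ 2 *: H_x H c (g (k * t + m)))) : E) =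
   S \o ((fun s : R^o => s *: (H_xi H c (g (k * t + m)), - H_x H c (g (k * t + m)))) \o (fun s => k *: s + 0)).
  apply/funext => s; rewrite /S /= addr0 -[k *: s]/(k * s).
  rewrite -[LHS]/(s *: (k *: _), s *: - (k ^+ 2 *: _)); congr pair.
    by rewrite scalerA mulrC.
  by rewrite !scalerN !scalerA; congr (- (_ *: _)); ring.
by apply: D3 => z _ /=; rewrite !in_itv /= => /tt.
Qed.

Lemma hdw_union (V1 W1 : normedModType R) (B1 B2 : set V1) (f : V1 -> W1) a L :
  has_diff_within B1 f a L -> has_diff_within B2 f a L -> has_diff_within (B1 `|` B2) f a L.
Proof.
move=> /has_diff_withinP[lL h1] /has_diff_withinP[_ h2]; apply/has_diff_withinP; split=> // e e0.
have [d1 d10 k1] := h1 e e0; have [d2 d20 k2] := h2 e e0.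
exists (Num.min d1 d2); first by rewrite lt_min d10.
by move=> z; rewrite lt_min => /andP[z1 z2] [Bz|Bz]; [exact: k1|exact: k2].
Qed.

Lemma bichar_cat (a b e : R) g1 g2 : a <= b <= e -> g1 b = g2 b ->
  bicharacteristic H a b g1 -> bicharacteristic H b e g2 ->
  bicharacteristic H a e (fun t => if t <= b then g1 t else g2 t).
Proof.
move=> /andP[ab be] gb h1 h2; set g := fun t => _.
have gl t : t <= b -> g t = g1 t by rewrite /g => ->.
have gr t : b <= t -> g t = g2 t.
  rewrite /g le_eqVlt => /predU1P[<-|bt]; first by rewrite lexx.
  by rewrite leNgt bt.
have L t : a <= t <= b -> (forall U, nbhs (base (g t)) U ->
    exists2 d : R, 0 < d & forall s, a <= s <= b -> `|s - t| < d -> U (base (g s))) /\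
    (nonzero (g t) /\ forall c, cdom c (base (g t)) -> @has_diff_within R R^o E `[a, b] (state c \o g) t
      (fun s => s *: (H_xi H c (g t), - H_x H c (g t)))).
  move=> tab; have [_ tb] := andP tab; rewrite (gl t tb).
  have [c0 hc0] := cdom_cover A (base (g1 t)).
  split=> [U hU|].
    have [d d0 hd] := bichar_near h1 tab hU; exists d => // s sab.
    by rewrite gl; [exact: hd|case/andP: sab].
  split=> [|c hc]; first by have [] := bichar_at h1 tab hc0.
  have [_ D] := bichar_at h1 tab hc; apply: (hdw_local (@ltr01 R) _ _ D) => [z _|].
    by rewrite /= in_itv /= => zab; split=> //=; rewrite gl//; case/andP: zab.
  by rewrite /= gl.
have Rr t : b <= t <= e -> (forall U, nbhs (base (g t)) U ->
    exists2 d : R, 0 < d & forall s, b <= s <= e -> `|s - t| < d -> U (base (g s))) /\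
    (nonzero (g t) /\ forall c, cdom c (base (g t)) -> @has_diff_within R R^o E `[b, e] (state c \o g) t
      (fun s => s *: (H_xi H c (g t), - H_x H c (g t)))).
  move=> tab; have [tb _] := andP tab; rewrite (gr t tb).
  have [c0 hc0] := cdom_cover A (base (g2 t)).
  split=> [U hU|].
    have [d d0 hd] := bichar_near h2 tab hU; exists d => // s sab.
    by rewrite gr; [exact: hd|case/andP: sab].
  split=> [|c hc]; first by have [] := bichar_at h2 tab hc0.
  have [_ D] := bichar_at h2 tab hc; apply: (hdw_local (@ltr01 R) _ _ D) => [z _|].
    by rewrite /= in_itv /= => zab; split=> //=; rewrite gr//; case/andP: zab.
  by rewrite /= gr.
apply: bichar_intro => [t /andP[at_ te] U hU|t /andP[at_ te]].
  have [tb|bt|tb] := ltgtP t b.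
  - have [/(_ U hU)[d d0 hd] _] := L t ltac:(by rewrite at_ ltW).
    exists (Num.min d (b - t)); first by rewrite lt_min d0 subr_gt0.
    move=> s /andP[as_ se]; rewrite lt_min => /andP[s1 s2]; apply: hd => //.
    by rewrite as_ /=; move: s2; rewrite ltr_norml => /andP[_]; rewrite ltrD2r => /ltW.
  - have [/(_ U hU)[d d0 hd] _] := Rr t ltac:(by rewrite te ltW).
    exists (Num.min d (t - b)); first by rewrite lt_min d0 subr_gt0.
    move=> s /andP[as_ se]; rewrite lt_min => /andP[s1 s2]; apply: hd => //.
    rewrite se andbT; move: s2; rewrite ltr_norml => /andP[+ _]; lra.
  - have [/(_ U hU)[d d0 hd] _] := L t ltac:(by rewrite at_ tb lexx).
    have [/(_ U hU)[d' d'0 hd'] _] := Rr t ltac:(by rewrite te tb lexx).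
    exists (Num.min d d'); first by rewrite lt_min d0.
    move=> s /andP[as_ se]; rewrite lt_min => /andP[s1 s2].
    have [sb|/ltW sb] := leP s b; first by apply: hd => //; rewrite as_.
    by apply: hd' => //; rewrite sb.
have [tb|bt|tb] := ltgtP t b.
- have [_ [n0 h]] := L t ltac:(by rewrite at_ ltW); split=> // c hc.
  have bt0 : 0 < b - t by rewrite subr_gt0.
  apply: (hdw_local bt0 _ _ (h c hc)) => // s sd; rewrite /= !in_itv /= => /andP[as_ se].
  split=> //; rewrite as_ /=.
  by move: sd; rewrite ltr_norml => /andP[_]; rewrite ltrD2r => /ltW.
- have [_ [n0 h]] := Rr t ltac:(by rewrite te ltW); split=> // c hc.
  have bt0 : 0 < t - b by rewrite subr_gt0.
  apply: (hdw_local bt0 _ _ (h c hc)) => // s sd; rewrite /= !in_itv /= => /andP[as_ se].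
  split=> //; rewrite se andbT.
  by move: sd; rewrite ltr_norml => /andP[+ _]; lra.
- have [_ [n0 h]] := L t ltac:(by rewrite at_ tb lexx).
  have [_ [_ h']] := Rr t ltac:(by rewrite te tb lexx).
  split=> // c hc; apply: hdw_sub (hdw_union (h c hc) (h' c hc)) => s /=.
  rewrite !in_itv /= => /andP[as_ se]; have [sb|/ltW sb] := leP s b.
    by left; rewrite as_.
  by right; rewrite sb.
Qed.

(** The derivative of H is the pairing of H_x with H_xi minus itself. *)
Lemma bichar_energy (a b s t : R) g : bicharacteristic H a b g ->
  a <= s <= b -> a <= t <= b -> H (g s) = H (g t).
Proof.
move=> hg sab tab.
have D : deriv_on a b (H \o g : R -> R^o) (fun=> 0).
  apply/deriv_onP => r rab; have [c hc] := cdom_cover A (base (g r)).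
  have [n0 Dg] := bichar_at hg rab hc.
  have nc : nbhs (base (g r)) (cdom c) by apply: open_nbhs_nbhs; split=> //; exact: cdom_open.
  have [d d0 hd] := bichar_near hg rab nc.
  have ex : exists2 d : R, 0 < d & forall z : R^o, `|z - r| < d -> `[a, b]%classic z ->
      phase_image c ((state c \o g) z).
    exists d => // z zd; rewrite /= in_itv /= => zab; have zc := hd z zab zd.
    by apply: phase_image_state => //; have [] := bichar_at hg zab zc.
  have Dh := hdw_comp _ _ Dg (dHchartP hH hc n0) ex.
  have -> : (fun s : R^o => s *: (0 : R^o)) =
      dHchart H c (g r) \o (fun s : R^o => s *: (H_xi H c (g r), - H_x H c (g r))).
    have linL : islinear (dHchart H c (g r)) by case: (dHchartP hH hc n0).
    apply/funext => z /=; rewrite (islinearZ linL) dHchart_split//.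
    rewrite (islinearN (pairing_linearr _)).
    rewrite (_ : pairing (H_x H c (g r)) _ = pairing (H_xi H c (g r)) (H_x H c (g r))).
      by rewrite subrr.
    by apply: eq_bigr => i _; rewrite mulrC.
  apply: (hdw_local d0 _ _ (Dh _ _)) => [z zd|]; last by rewrite /= Hchart_state.
  rewrite /= in_itv /= => zab; split=> //.
  by rewrite Hchart_state//; exact: hd.
have : `|(H \o g : R -> R^o) s - (H \o g) t - (s - t) *: (0 : R^o)| <= 0 * `|s - t|.
  by apply: (mean_value_affine D sab tab) => r _ _; rewrite subrr normr0.
by rewrite scaler0 subr0 mul0r normr_le0 subr_eq0 => /eqP.
Qed.

Lemma flowP (t : R) p q : 0 <= t -> flow H t p q <->
  exists g, [/\ bicharacteristic H 0 t g, g 0 = p & g t = q].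
Proof. by move=> t0; rewrite /flow (min_l t0) (max_r t0). Qed.

Lemma flow_split (s t : R) p r : 0 <= s -> 0 <= t -> flow H (s + t) p r ->
  exists2 q, flow H s p q & flow H t q r.
Proof.
move=> s0 t0 /(flowP _ _ (addr_ge0 s0 t0))[g [hg g0 gst]].
exists (g s); first by apply/flowP => //; exists g; split=> //; apply: bichar_sub hg => //; rewrite lerDl.
apply/flowP => //; exists (fun u => g (u + s)); split; last 2 first.
- by rewrite add0r.
- by rewrite addrC.
have := @bichar_reparam 0 t 1 s g ltr01; rewrite mulr0 add0r mul1r => h.
have {}h := h (bichar_sub s0 (_ : t + s <= s + t) hg).
have -> : (fun u => g (u + s)) = (fun u => covector_scale 1 (g (1 * u + s))).
  by apply/funext => u; rewrite covector_scale1 mul1r.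
by apply: h; rewrite addrC.
Qed.

Lemma flow_cat (s t : R) p q r : 0 <= s -> 0 <= t -> flow H s p q -> flow H t q r ->
  flow H (s + t) p r.
Proof.
move=> s0 t0 /(flowP _ _ s0)[g1 [h1 g10 g1s]] /(flowP _ _ t0)[g2 [h2 g20 g2t]].
apply/flowP; first exact: addr_ge0.
have h2' : bicharacteristic H s (s + t) (fun u => g2 (u - s)).
  have := @bichar_reparam s (s + t) 1 (- s) g2 ltr01.
  rewrite !mul1r subrr [s + t]addrC addrK => /(_ h2).
  rewrite [X in bicharacteristic _ _ _ X](_ : _ = fun u => g2 (u - s))//.
  by apply/funext => u; rewrite covector_scale1 mul1r.
exists (fun u => if u <= s then g1 u else g2 (u - s)); split.
- by apply: bichar_cat => //; rewrite ?s0 ?lerDl// subrr g1s g20.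
- by rewrite s0.
- case: leP => [st|_]; last by rewrite [s + t]addrC addrK.
  have t00 : t = 0 by apply/eqP; rewrite eq_le t0 andbT -(lerD2l s) addr0.
  by rewrite t00 addr0 g1s -g20 -g2t t00.
Qed.

Lemma flow_scale (k t : R) p q : 0 < k -> 0 <= t -> flow H t p q ->
  flow H (t / k) (covector_scale k p) (covector_scale k q).
Proof.
move=> k0 t0 /(flowP _ _ t0)[g [hg g0 gt]]; apply/flowP; first by rewrite divr_ge0// ltW.
exists (fun s => covector_scale k (g (k * s + 0))); split.
- by apply: bichar_reparam => //; rewrite mulr0 !addr0 mulrC divfK ?gt_eqF.
- by rewrite mulr0 addr0 g0.
- by rewrite addr0 mulrC divfK ?gt_eqF// gt.
Qed.

Lemma flow_refl p : nonzero p -> flow H 0 p p.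
Proof.
move=> pn; apply/flowP => //; exists (fun=> p); split=> //.
have z0 (s : R) : 0 <= s <= 0 -> s = 0 by rewrite andbC -eq_le => /eqP.
apply: bichar_intro => [s _ U hU|s /z0 ->].
  by exists 1 => // *; exact: nbhs_singleton.
split=> // c hc; apply/has_diff_withinP; split=> [k u v|e e0].
  by rewrite scalerDl scalerA.
exists 1 => // z _; rewrite /= in_itv /= => /z0 ->.
by rewrite !subrr scale0r subrr !normr0 mulr0.
Qed.

Lemma flow0 p q : flow H 0 p q -> p = q.
Proof. by move=> /(flowP _ _ (lexx _))[g [_ <- <-]]. Qed.

Lemma flow_energy (t : R) p q : 0 <= t -> flow H t p q -> H q = H p.
Proof.
move=> t0 /(flowP _ _ t0)[g [hg <- <-]].
by apply: bichar_energy hg _ _; rewrite ?lexx ?t0.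
Qed.

Lemma flow_nonzero (t : R) p q : 0 <= t -> flow H t p q -> nonzero p /\ nonzero q.
Proof.
move=> t0 /(flowP _ _ t0)[g [hg <- <-]].
have [c0 hc0] := cdom_cover A (base (g 0)); have [c1 hc1] := cdom_cover A (base (g t)).
split; first by have [] := bichar_at hg (_ : 0 <= 0 <= t) hc0; rewrite ?lexx ?t0.
by have [] := bichar_at hg (_ : 0 <= t <= t) hc1; rewrite ?lexx ?t0.
Qed.

End bicharacteristics.

(** * The first variation of the action *)

Section evolution.
Context {R : realType} {n : nat} {M : topologicalType} {A : smooth_manifold R n M}
  (H : cotangent A -> R).
Hypothesis hH : hamiltonian_conditions H.
Local Notation V := 'rV[R]_n.
Local Notation E := (V * V)%type.
Implicit Types (c d e : chart A) (p q : cotangent A) (g : R -> cotangent A).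

Lemma position_gap_bound (a a' b b' v v' : E) (k x : R) :
  `|a - b - k *: v| <= x -> `|a' - b' - k *: v'| <= x ->
  `|((a.2, a'.1 - a.1) - (b.2, b'.1 - b.1) - k *: (v.2, v'.1 - v.1) : E)| <= x + x.
Proof.
case: a a' b b' v v' => [a1 a2] [a1' a2'] [b1 b2] [b1' b2'] [v1 v2] [v1' v2'] h h'.
apply: pair_norm_le => /=.
  have := le_trans (pair_snd_le _) h; have x0 := le_trans (normr_ge0 _) h.
  by move=> /= h2; apply: (le_trans h2); rewrite lerDl.
rewrite (_ : _ - _ - _ = (a1' - b1' - k *: v1') - (a1 - b1 - k *: v1)); last by module_eq.
rewrite (le_trans (ler_normB _ _))// lerD//.
  exact: le_trans (pair_fst_le _) h'.
exact: le_trans (pair_fst_le _) h.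
Qed.

(** The derivative of <z, z' - z> along two trajectories, reduced by the Euler
    identities of both to a Taylor remainder of H and a quadratic term. *)
Lemma variation_identity (hx x x' z z' dz : V) (a a' : R) :
  pairing z x = 2 * a -> pairing z' x' = 2 * a' ->
  pairing (- hx) dz + pairing z (x' - x) - (a' - a) =
  (a' - a - (pairing hx dz + pairing x (z' - z))) - pairing (z' - z) (x' - x).
Proof.
move=> e1 e2; rewrite pairingNl !pairingBl !pairingBr e1 e2.
have sym (u v : V) : pairing u v = pairing v u by apply: eq_bigr => i _; rewrite mulrC.
by rewrite (sym x z) e1 (sym x z'); ring.
Qed.

Lemma coord0_continuous m : continuous (fun z : 'rV[R]_m => coord0 z : R).
Proof.
case: m => [|m].
  have -> : (fun z : 'rV[R]_0 => coord0 z : R) = fun=> 0.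
    by apply/funext => z; rewrite /coord0 big_ord0.
  exact: cst_continuous.
have -> : (fun z : 'rV[R]_m.+1 => coord0 z : R) = fun z => z 0 ord0.
  by apply/funext => z; rewrite /coord0 (big_pred1 ord0)// => i.
by move=> z; exact: coord_continuous.
Qed.

Definition near_state c p0 (r : R) p : Prop :=
  cdom c (base p) /\ `|state c p - state c p0| < r.

(** The components of the field are derivatives of a smooth extension of H, hence
    tame themselves. *)
Lemma hamiltonian_field c p0 : cdom c (base p0) -> nonzero p0 ->
  exists (h : E -> R^o) (X : E -> E) (K : R),
    [/\ C11_at h (fun a v => 'D_v h a) (state c p0) K, tame X (state c p0) &
     forall p, near_state c p0 K^-1 p ->
      [/\ nonzero p, h (state c p) = H p, dHchart H c p = fun v => 'D_v h (state c p) &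
          (H_xi H c p, - H_x H c p) = X (state c p)]].
Proof.
move=> hc n0; have [P [h [d [oP P0 Ch d0 hd]]]] := hamiltonian_ext hH hc n0.
have fE : finite_frame (E : normedModType R) by exact: _.
have [K [HK _]] := Ck2_C11 fE oP P0 (Ch 2%N); have K0 : 0 < K := HK.1.
pose X (w : E) : E := (\row_i 'D_(0, delta_mx 0 i) h w, - \row_i 'D_(delta_mx 0 i, 0) h w).
have tD v : tame (fun w => 'D_v h w : R^o) (state c p0).
  have [_ /(_ v) C2] := Ch 3%N; have [L [HL _]] := Ck2_C11 fE oP P0 C2.
  exact: C11_tame HL.
have tX : tame X (state c p0).
  apply: tame_pair; first by apply: tame_row => i; exact: tD.
  apply: (@tame_comp _ _ _ _ (fun w => \row_i 'D_(delta_mx 0 i, 0) h w) (fun v : V => - v)).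
    by apply: tame_row => i; exact: tD.
  by apply: tame_linear => k u v; rewrite opprD scalerN.
have K1 : 0 < K + d^-1 by rewrite addr_gt0 ?invr_gt0.
have kK : (K + d^-1)^-1 <= K^-1 by rewrite lef_pV2 ?posrE// lerDl invr_ge0 ltW.
have kd : (K + d^-1)^-1 <= d by rewrite invf_ple ?posrE// lerDr ltW.
exists h, X, (K + d^-1); split=> //.
  split=> // a ha; have [_ /(_ a (lt_le_trans ha kK))[h1 h2 h3]] := HK.
  have le1 (x : R) : 0 <= x -> K * x <= (K + d^-1) * x.
    by move=> x0; rewrite ler_wpM2r// lerDl invr_ge0 ltW.
  split=> // [v|b hb v]; first by rewrite (le_trans (h2 v))// le1.
  by rewrite (le_trans (h3 _ (lt_le_trans hb kK) v))// -!mulrA le1// mulr_ge0.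
move=> p [pc pK]; have [pn _ hE _ dE] := hd p pc (lt_le_trans pK kd).
split=> //; rewrite /X /H_xi /H_x; congr pair; first by apply/rowP => i; rewrite !mxE dE.
by apply/rowP => i; rewrite !mxE dE.
Qed.

(** The speed is bounded near p0, so that leaving a ball takes time; and the domain
    of the chart is not left before the ball, because the set of points of M whose
    coordinates lie in a small closed ball is compact, hence closed. *)
Lemma bichar_stays c p0 (r : R) : cdom c (base p0) -> nonzero p0 -> 0 < r ->
  exists rho : R, 0 < rho /\ forall g b, 0 <= b <= rho -> bicharacteristic H 0 b g ->
    near_state c p0 rho (g 0) -> forall t, 0 <= t <= b -> near_state c p0 r (g t).
Proof.
move=> hc n0 r0; have [h [X [K [HK tX hK]]]] := hamiltonian_field hc n0.
have K0 : 0 < K := HK.1.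
have [L [L0 lipX]] := tame_lip tX.
have [m m0 him] := chart_image_near hc.
pose r' := Num.min (Num.min (r / 2) (m / 2)) (Num.min (K^-1 / 2) (L^-1 / 2)).
have r'0 : 0 < r' by rewrite !lt_min !divr_gt0 ?invr_gt0.
have r'r : r' < r by rewrite !gt_min ltr_pdivrMr// ltr_pMr// ltr1n.
have r'm : r' < m by rewrite !gt_min; apply/orP; left; apply/orP; right; lra.
have r'K : r' < K^-1.
  by rewrite !gt_min; apply/orP; right; apply/orP; left; rewrite ltr_pdivrMr// ltr_pMr ?invr_gt0// ltr1n.
have r'L : r' < L^-1.
  by rewrite !gt_min; apply/orP; right; apply/orP; right; rewrite ltr_pdivrMr// ltr_pMr ?invr_gt0// ltr1n.
pose B := `|X (state c p0)| + L * r' + 1.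
have B0 : 0 < B by rewrite ltr_wpDl// addr_ge0// mulr_ge0// ltW.
have bX w : `|w - state c p0| <= r' -> `|X w| + 1 <= B.
  move=> hw; rewrite lerD2r -[X w](subrK (X (state c p0))) addrC (le_trans (ler_normD _ _))//.
  rewrite lerD2l (le_trans (lipX _ _ _ _ _ _ erefl erefl))//.
  - exact: le_lt_trans r'L.
  - by rewrite subrr normr0 invr_gt0.
  - by rewrite ler_wpM2l ?(ltW L0).
pose rho := Num.min (r' / 2) (r' / 2 / B).
have rho0 : 0 < rho by rewrite lt_min !divr_gt0.
have rhor : rho <= r' / 2 by rewrite ge_min lexx.
have rhoB : B * rho <= r' / 2.
  have : rho <= r' / 2 / B by rewrite ge_min lexx orbT.
  by rewrite ler_pdivlMr// mulrC.
exists rho; split=> // g b /andP[b0 brho] hg [c0 s0].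
pose KK : set M := cinv c @` (closed_ball_ (fun x => `|x|) (cmap c (base p0)) r' `&` half_space n).
have KKdom y : KK y -> cdom c y.
  move=> [z [/= zb zh] <-]; apply: (cinvK _).1; apply: him => //.
  by rewrite distrC (le_lt_trans zb).
have cKK : closed KK.
  apply: (compact_closed (@manifold_hausdorff _ _ _ A)).
  apply: continuous_compact.
    apply: continuous_subspaceW (@cinv_continuous _ _ _ A c) => z [/= zb zh].
    by apply: him => //; rewrite distrC (le_lt_trans zb).
  apply: bounded_closed_compact.
    exists (`|cmap c (base p0)| + r'); split; first exact: num_real.
    move=> x xb z [/= zb _]; rewrite (le_trans _ (ltW xb))//.
    rewrite -[z](subrK (cmap c (base p0))) addrC (le_trans (ler_normD _ _))//.
    by rewrite lerD2l distrC.
  apply: closedI; first exact: closed_closed_ball_.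
  rewrite (_ : half_space n = [set z | 0 <= (coord0 z : R)])//.
  apply: (@closed_comp _ _ (@coord0 R n : 'rV[R]_n -> R) [set x | 0 <= x]); last exact: closed_ge.
  by move=> z _; exact: coord0_continuous.
have inKK y : cdom c y -> `|cmap c y - cmap c (base p0)| <= r' -> KK y.
  move=> yc yr; exists (cmap c y); last by rewrite cmapK.
  split; first by rewrite /closed_ball_ /= distrC.
  exact: (chart_coord0_ge0 (chart_image_map yc)).
suff key t : 0 <= t <= b -> cdom c (base (g t)) /\ `|state c (g t) - state c (g 0)| <= B * t.
  move=> t tb; have [ct st] := key t tb; split=> //.
  rewrite (_ : state c (g t) - _ = (state c (g t) - state c (g 0)) + (state c (g 0) - state c p0));
    last by module_eq.
  rewrite (le_lt_trans (ler_normD _ _))//.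
  have : B * t <= B * rho by rewrite ler_wpM2l ?(ltW B0)// (le_trans _ brho)//; case/andP: tb.
  by have := lt_le_trans s0 rhor; lra.
have close s : s <= b -> `|state c (g s) - state c (g 0)| <= B * s -> `|state c (g s) - state c p0| <= r'.
  move=> sb hs.
  rewrite (_ : state c (g s) - _ = (state c (g s) - state c (g 0)) + (state c (g 0) - state c p0));
    last by module_eq.
  rewrite (le_trans (ler_normD _ _))//.
  have : B * s <= B * rho by rewrite ler_wpM2l ?(ltW B0)// (le_trans _ brho).
  by have := lt_le_trans s0 rhor; lra.
move: t; apply: real_induction => t tb IH.
  have [->|t0] := eqVneq t 0; first by rewrite subrr normr0 mulr0.
  have {t0}tp : 0 < t by rewrite lt_neqAle eq_sym t0; case/andP: tb.
  have ct : cdom c (base (g t)).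
    apply: KKdom; apply: contrapT => nK.
    have nb : nbhs (base (g t)) (~` KK).
      by apply: open_nbhs_nbhs; split=> //; exact: closed_openC.
    have [d d0 hd] := bichar_near hg tb nb.
    pose s := Num.max 0 (t - d / 2).
    have st : s < t by rewrite gt_max tp ltrBlDr ltrDl divr_gt0.
    have s00 : 0 <= s by rewrite le_max lexx.
    have sb : s <= b by rewrite (le_trans (ltW st))//; case/andP: tb.
    have [|cs hs] := IH s; first by rewrite s00 st.
    apply: (hd s); first by rewrite s00 sb.
      rewrite distrC gtr0_norm ?subr_gt0// ltrBlDr -ltrBlDl lt_max; apply/orP; right; lra.
    apply: inKK => //; apply: le_trans (close s sb hs).
    exact: (pair_fst_le (state c (g s) - state c p0)).
  split=> //; apply/ler_addgt0Pr => e e0.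
  have [_ Dg] := bichar_at hg tb ct.
  have [C [d [C0 d0 hd]]] := hdw_bound (finite_frame_R) Dg.
  pose s := Num.max 0 (t - Num.min (d / 2) (e / C)).
  have m1 : 0 < Num.min (d / 2) (e / C) by rewrite lt_min !divr_gt0.
  have st : s < t by rewrite gt_max tp ltrBlDr ltrDl.
  have s00 : 0 <= s by rewrite le_max lexx.
  have sb : s <= b by rewrite (le_trans (ltW st))//; case/andP: tb.
  have [|cs hs] := IH s; first by rewrite s00 st.
  have ts : t - s <= Num.min (d / 2) (e / C).
    by rewrite lerBlDr -lerBlDl le_max lexx orbT.
  have tsd : t - s <= d / 2 by rewrite (le_trans ts)// ge_min lexx.
  have tse : (t - s) * C <= e by rewrite -ler_pdivlMr// (le_trans ts)// ge_min lexx orbT.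
  have := hd s; rewrite [`|s - t|]distrC gtr0_norm ?subr_gt0// => /(_ _ _) h1.
  have h2 : `|state c (g s) - state c (g t)| <= C * (t - s).
    by apply: h1; [lra|rewrite /= in_itv /= s00].
  rewrite (_ : state c (g t) - _ = (state c (g s) - state c (g 0)) - (state c (g s) - state c (g t)));
    last by module_eq.
  rewrite (le_trans (ler_normB _ _))//.
  have : B * s <= B * t by rewrite ler_wpM2l ?(ltW B0)// ltW.
  by lra.
have tb' : 0 <= t <= b by case/andP: tb => -> /ltW.
have [ct ht] := IH t ltac:(by case/andP: tb' => -> _; rewrite lexx).
have cl := close t (ltW (andP tb).2) ht.
have [_ Dg] := bichar_at hg tb' ct.
have [|pn _ _ EX] := hK (g t); first by split=> //; exact: le_lt_trans r'K.
rewrite EX in Dg.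
have nc : nbhs (base (g t)) (cdom c) by apply: open_nbhs_nbhs; split=> //; exact: cdom_open.
have [d d0 hd] := bichar_near hg tb' nc.
have /has_diff_withinP[_ /(_ 1 ltr01)[d' d'0 hd']] := Dg.
exists (Num.min d d'); first by rewrite lt_min d0.
move=> s /andP[ts std] sb; have ab : 0 <= s <= b.
  by rewrite sb andbT (le_trans _ (ltW ts))//; case/andP: tb.
have sd : `|s - t| < Num.min d d' by rewrite gtr0_norm ?subr_gt0// ltrBlDl.
move: sd; rewrite lt_min => /andP[sd sd']; split; first exact: hd.
have := hd' s sd'; rewrite /= in_itv /= => /(_ ab); rewrite mul1r => h1.
rewrite (_ : state c (g s) - _ = (state c (g s) - state c (g t) - (s - t) *: X (state c (g t))) +
   (s - t) *: X (state c (g t)) + (state c (g t) - state c (g 0))); last by module_eq.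
rewrite (le_trans (ler_normD _ _))// (_ : B * s = B * (s - t) + B * t); last by ring.
rewrite lerD// (le_trans (ler_normD _ _))// normrZ.
have := ler_wpM2r (normr_ge0 (s - t)) (bX _ cl).
rewrite [X in _ <= B * X -> _]gtr0_norm ?subr_gt0//.
by lra.
Qed.

Definition chart_rel c d (F : cotangent A -> cotangent A -> Prop) (w y : E) : Prop :=
  exists p q, [/\ cdom c (base p), F p q, w = state c p & y = state d q].

(** What the estimates retain of the Hamiltonian flow at time tau, as seen near p0
    in the charts c and d; it is preserved by composition. *)
Definition tame_evolution c d (tau : R) (F : cotangent A -> cotangent A -> Prop) p0 : Prop :=
  tame_rel (chart_rel c d F) (state c p0) /\
  exists K : R, 0 < K /\ forall p q, near_state c p0 K^-1 p -> F p q ->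
    [/\ cdom d (base q), H q = H p &
     forall p' q', near_state c p0 K^-1 p' -> F p' q' ->
      `|pairing (comp q d) (cmap d (base q') - cmap d (base q)) -
        pairing (comp p c) (cmap c (base p') - cmap c (base p)) - tau * (H p' - H p)| <=
      K * `|state c p' - state c p| ^+ 2].

Lemma tame_evolution_sub c d tau (F G : cotangent A -> cotangent A -> Prop) p0 :
  (forall p q, G p q -> F p q) -> tame_evolution c d tau F p0 -> tame_evolution c d tau G p0.
Proof.
move=> GF [t1 [K [K0 hK]]]; split.
  apply: (tame_rel_sub (@ltr01 R) _ t1) => w y _ [p [q [pc Gpq wE yE]]].
  by exists p, q; split=> //; exact: GF.
exists K; split=> // p q np /GF Fpq; have [h1 h2 h3] := hK p q np Fpq.
by split=> // p' q' np' /GF; exact: h3.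
Qed.

Lemma evolution_near c d tau (F : cotangent A -> cotangent A -> Prop) p0 q0 (r : R) :
  tame_evolution c d tau F p0 -> cdom c (base p0) -> F p0 q0 -> 0 < r ->
  exists rho : R, 0 < rho /\ forall p q, near_state c p0 rho p -> F p q -> near_state d q0 r q.
Proof.
move=> [t1 [K [K0 hK]]] hc F0 r0.
have P0 : chart_rel c d F (state c p0) (state d q0) by exists p0, q0.
have [e e0 he] := tame_near t1 P0 r0.
exists (Num.min e K^-1); split=> [|p q [pc]]; first by rewrite lt_min e0 invr_gt0.
rewrite lt_min => /andP[pe pK] Fpq.
by split; [have [] := hK p q (conj pc pK) Fpq|apply: (he _ _ pe); exists p, q].
Qed.

Lemma evolution_lip c d tau (F : cotangent A -> cotangent A -> Prop) p0 :
  tame_evolution c d tau F p0 -> exists K : R, 0 < K /\ forall p q p' q',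
    near_state c p0 K^-1 p -> near_state c p0 K^-1 p' -> F p q -> F p' q' ->
    `|state d q' - state d q| <= K * `|state c p' - state c p|.
Proof.
move=> [/tame_lip[K [K0 hK]] _]; exists K; split=> // p q p' q' [pc pK] [pc' pK'] Fq Fq'.
by apply: hK => //; [exists p', q'|exists p, q].
Qed.

Lemma evolution_comp c d e tau sig (F G : cotangent A -> cotangent A -> Prop) p0 q0 :
  cdom c (base p0) -> F p0 q0 -> tame_evolution c d tau F p0 -> tame_evolution d e sig G q0 ->
  tame_evolution c e (tau + sig) (fun p r => exists2 q, F p q & G q r) p0.
Proof.
move=> hc F0 tF tG.
have P0 : chart_rel c d F (state c p0) (state d q0) by exists p0, q0.
have [tF1 [K [K0 hK]]] := tF; have [tG1 [L [L0 hL]]] := tG.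
have Li : 0 < L^-1 by rewrite invr_gt0.
have [rho [rho0 hrho]] := evolution_near tF hc F0 Li.
split.
  have Ki : 0 < K^-1 by rewrite invr_gt0.
  apply: (tame_rel_sub Ki _ (tame_rel_comp tF1 tG1 P0)) => w y wK [p [r [pc [q Fq Gq] wE ->]]].
  have [|qd _ _] := hK p q _ Fq; first by split=> //; rewrite -wE.
  by exists (state d q); [exists p, q|exists q, r].
have [C [C0 hC]] := evolution_lip tF.
pose K' : R := rho^-1 + K + C + (L * C ^+ 2 + K).
have ri : 0 < rho^-1 by rewrite invr_gt0.
have LC : 0 <= L * C ^+ 2 by rewrite mulr_ge0 ?exprn_ge0// ltW.
have K'0 : 0 < K' by rewrite /K'; lra.
have k1 : K'^-1 <= rho by rewrite invf_ple ?posrE// /K'; lra.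
have k2 : K'^-1 <= K^-1 by rewrite lef_pV2 ?posrE// /K'; lra.
have k3 : K'^-1 <= C^-1 by rewrite lef_pV2 ?posrE// /K'; lra.
exists K'; split=> // p r [pc pK] [q Fq Gr].
have nq := hrho p q (conj pc (lt_le_trans pK k1)) Fq.
have [qd Eq v1] := hK p q (conj pc (lt_le_trans pK k2)) Fq.
have [re Er v2] := hL q r nq Gr.
split=> //; first by rewrite Er.
move=> p' r' [pc' pK'] [q' Fq' Gr'].
have nq' := hrho p' q' (conj pc' (lt_le_trans pK' k1)) Fq'.
have [qd' Eq' _] := hK p' q' (conj pc' (lt_le_trans pK' k2)) Fq'.
have {}v1 := v1 p' q' (conj pc' (lt_le_trans pK' k2)) Fq'.
have {}v2 := v2 q' r' nq' Gr'.
have lip := hC p q p' q' (conj pc (lt_le_trans pK k3)) (conj pc' (lt_le_trans pK' k3)) Fq Fq'.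
rewrite Eq Eq' in v2.
set a := pairing (comp r e) _ in v2 *; set b := pairing (comp q d) _ in v1 v2.
set a0 := pairing (comp p c) _ in v1 *.
rewrite (_ : a - a0 - _ = (a - b - sig * (H p' - H p)) + (b - a0 - tau * (H p' - H p)));
  last by ring.
rewrite (le_trans (ler_normD _ _))//.
have sq : `|state d q' - state d q| ^+ 2 <= C ^+ 2 * `|state c p' - state c p| ^+ 2.
  by rewrite -exprMn ler_sqr ?nnegrE// mulr_ge0// ltW.
have sq0 : 0 <= `|state c p' - state c p| ^+ 2 by exact: exprn_ge0.
have := ler_wpM2l (ltW L0) sq; rewrite mulrA => h.
have : 0 <= (rho^-1 + K + C) * `|state c p' - state c p| ^+ 2 by rewrite mulr_ge0// ltW// !addr_gt0.
by rewrite /K' [(_ + (_ + _)) * _]mulrDl [(L * _ + K) * _]mulrDl; lra.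
Qed.

Lemma evolution_id c d p0 : cdom c (base p0) -> cdom d (base p0) ->
  tame_evolution c d 0 (fun p q => p = q) p0.
Proof.
move=> hc hd; have [Psi [K [K0 tPsi hK]]] := transition_tame hc hd.
split.
  have Ki : 0 < K^-1 by rewrite invr_gt0.
  apply: (tame_rel_sub Ki _ tPsi) => w y wK [p [q [pc <- wE ->]]].
  by rewrite wE in wK *; have [] := hK p pc wK.
exists (K + 1); have K1 : 0 < K + 1 by rewrite addr_gt0.
have k1 : (K + 1)^-1 <= K^-1 by rewrite lef_pV2 ?posrE// lerDl.
split=> // p q [pc pK] <-; have [pd _ v] := hK p pc (lt_le_trans pK k1).
split=> // p' q' [pc' pK'] <-; rewrite mul0r subr0.
rewrite (le_trans (v p' pc' (lt_le_trans pK' k1)))//.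
rewrite ler_pM ?(ltW K0) ?exprn_ge0//; first by rewrite lerDl.
by rewrite ler_sqr ?nnegrE//; exact: (pair_fst_le (state c p' - state c p)).
Qed.

(** The action estimate over a short time.  With u and u' the states along two
    bicharacteristics, the derivative of the pairing of the covector of u with
    the difference of base points is, by the Euler identity, the difference of
    energies up to a quadratic error. *)
Lemma first_variation_short c p0 : cdom c (base p0) -> nonzero p0 ->
  exists r C : R, [/\ 0 < r, 0 < C & forall b g g' (m : R), 0 <= b <= r ->
    bicharacteristic H 0 b g -> bicharacteristic H 0 b g' ->
    (forall t, 0 <= t <= b -> near_state c p0 r (g t) /\ near_state c p0 r (g' t)) ->
    (forall t, 0 <= t <= b -> `|state c (g' t) - state c (g t)| <= m) ->
    `|pairing (comp (g b) c) (cmap c (base (g' b)) - cmap c (base (g b))) -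
      pairing (comp (g 0) c) (cmap c (base (g' 0)) - cmap c (base (g 0))) -
      b * (H (g' 0) - H (g 0))| <= C * m ^+ 2].
Proof.
move=> hc n0; have [h [X [K [HK tX hK]]]] := hamiltonian_field hc n0.
have K0 : 0 < K := HK.1; have [L [L0 lipX]] := tame_lip tX.
pose r : R := (K + L + 1)^-1.
have s0 : 0 < K + L + 1 by rewrite !addr_gt0.
have r0 : 0 < r by rewrite invr_gt0.
have rK : r <= K^-1 by rewrite lef_pV2 ?posrE//; lra.
have rL : r <= L^-1 by rewrite lef_pV2 ?posrE//; lra.
have r1 : r <= 1 by rewrite invf_le1// lerDr addr_ge0// ltW.
have nL : 0 <= n%:R * L by rewrite mulr_ge0// ltW.
exists r, (K + n%:R * L); split=> //; first by rewrite ltr_wpDr.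
move=> b g g' m /andP[b0 br] hg hg' near dist.
have D : deriv_on 0 b (state c \o g) (fun t => (H_xi H c (g t), - H_x H c (g t)) : E).
  by apply: bichar_deriv (lexx _) (lexx _) hg _ => t /near[[]].
have D' : deriv_on 0 b (state c \o g') (fun t => (H_xi H c (g' t), - H_x H c (g' t)) : E).
  by apply: bichar_deriv (lexx _) (lexx _) hg' _ => t /near[_ []].
pose w t : E := (comp (g t) c, cmap c (base (g' t)) - cmap c (base (g t))).
have Dw : deriv_on 0 b w (fun t => (- H_x H c (g t), H_xi H c (g' t) - H_xi H c (g t)) : E).
  move=> t tb e e0.
  have [d1 d10 h1] := D t tb (e / 2) ltac:(by rewrite divr_gt0).
  have [d2 d20 h2] := D' t tb (e / 2) ltac:(by rewrite divr_gt0).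
  exists (Num.min d1 d2); first by rewrite lt_min d10.
  move=> s sb; rewrite lt_min => /andP[/(h1 _ sb) k1 /(h2 _ sb) k2].
  rewrite (splitr e) mulrDl.
  exact: (position_gap_bound k1 k2).
have fE : finite_frame (E : normedModType R) by exact: _.
have Dphi := @deriv_on_comp R E (R^o) 0 b w _ setT (fun w => pairing w.1 w.2)
  (fun t h => pairing h.1 (w t).2 + pairing (w t).1 h.2) fE Dw (fun t _ => conj I (hdw_pairing (w t))).
have {Dphi}Dphi := deriv_onB Dphi (@deriv_on_linear_part R (R^o) 0 b (H (g' 0) - H (g 0))).
have := mean_value b0 Dphi (K := (K + n%:R * L) * m ^+ 2).
rewrite /w /= subr0 scale0r subr0 -[b *: _]/(b * _) => MV.
rewrite (_ : _ - _ - _ = pairing (comp (g b) c) (cmap c (base (g' b)) - cmap c (base (g b))) -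
  b * (H (g' 0) - H (g 0)) - pairing (comp (g 0) c) (cmap c (base (g' 0)) - cmap c (base (g 0)))); last by ring.
apply: le_trans (MV _) _; last first.
  have m0 : 0 <= m by apply: le_trans (dist 0 _); rewrite ?lexx.
  have c0 : 0 <= (K + n%:R * L) * m ^+ 2.
    by rewrite mulr_ge0 ?exprn_ge0// addr_ge0// ltW.
  by rewrite ler_piMr// (le_trans br).
move=> t tb {MV}.
have [[gc gr] [gc' gr']] := near t tb.
have [gn hE dE XE] := hK _ (conj gc (lt_le_trans gr rK)).
have [gn' hE' dE' XE'] := hK _ (conj gc' (lt_le_trans gr' rK)).
have b0b : 0 <= (0 : R) <= b by rewrite lexx.
rewrite -(bichar_energy hH hg tb b0b) -(bichar_energy hH hg' tb b0b).
have eu := euler_identity hH gc gn; have eu' := euler_identity hH gc' gn'.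
have T := C11_taylor fE HK (lt_le_trans gr rK) (lt_le_trans gr' rK).
rewrite hE hE' -[('D_(state c (g' t) - state c (g t)) h (state c (g t)))]/((fun v => 'D_v h (state c (g t))) _) -dE in T.
rewrite -[state c (g' t) - state c (g t)]/((cmap c (base (g' t)) - cmap c (base (g t)), comp (g' t) c - comp (g t) c)) in T.
rewrite dHchart_split// in T.
have Lx := lipX _ _ _ _ (lt_le_trans gr' rL) (lt_le_trans gr rL) erefl erefl.
rewrite -XE -XE' in Lx.
have Lxi : `|H_xi H c (g' t) - H_xi H c (g t)| <= L * m.
  apply: le_trans (le_trans (pair_fst_le ((H_xi H c (g' t), - H_x H c (g' t)) - (H_xi H c (g t), - H_x H c (g t)))) Lx) _.
  by rewrite ler_wpM2l ?(ltW L0)// dist.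
set dz := cmap c (base (g' t)) - cmap c (base (g t)) in T *.
set dzeta := comp (g' t) c - comp (g t) c in T.
have m0 : 0 <= m by apply: le_trans (dist t tb).
have Tm : `|(dz, dzeta) : E| ^+ 2 <= m ^+ 2.
  by rewrite ler_sqr ?nnegrE//; exact: dist.
have PB : `|pairing dzeta (H_xi H c (g' t) - H_xi H c (g t))| <= n%:R * L * m ^+ 2.
  rewrite (le_trans (pairing_bound _ _))// -mulrA ler_wpM2l//.
  rewrite expr2 mulrCA ler_pM//.
  exact: le_trans (pair_snd_le ((dz, dzeta) : E)) (dist t tb).
rewrite (variation_identity _ _ eu eu').
rewrite (le_trans (ler_normB _ _))// mulrDl lerD// (le_trans T)//.
by rewrite ler_wpM2l// ltW.
Qed.

End evolution.

(** * Dependence of the flow on initial conditions *)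

Section flow.
Context {R : realType} {n : nat} {M : topologicalType} {A : smooth_manifold R n M}
  (H : cotangent A -> R).
Hypothesis hH : hamiltonian_conditions H.
Local Notation V := 'rV[R]_n.
Local Notation E := (V * V)%type.
Implicit Types (c d e : chart A) (p q : cotangent A) (g : R -> cotangent A).

Lemma bichar_flow (a b s t : R) g : bicharacteristic H a b g -> a <= s -> s <= t -> t <= b ->
  flow H (t - s) (g s) (g t).
Proof.
move=> hg as_ st tb; apply/flowP; first by rewrite subr_ge0.
exists (fun u => g (u + s)); rewrite add0r subrK; split=> //.
have := @bichar_reparam _ _ _ _ _ hH 0 (t - s) 1 s g ltr01; rewrite mulr0 add0r mul1r subrK => h.
have {}h := h (bichar_sub as_ tb hg).
have -> // : (fun u => g (u + s)) = (fun u => covector_scale 1 (g (1 * u + s))).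
by apply/funext => u; rewrite covector_scale1 mul1r.
Qed.

Lemma bichar_near_left (b t m : R) g d : bicharacteristic H 0 b g -> 0 < t <= b ->
  cdom d (base (g t)) -> 0 < m ->
  exists s : R, [/\ 0 <= s, s < t, t - s < m & near_state d (g t) m (g s)].
Proof.
move=> hg /andP[tp tb'] td m0; have tb : 0 <= t <= b by rewrite (ltW tp).
have [_ Dg] := bichar_at hg tb td.
have [C [e [C0 e0 hC]]] := hdw_bound finite_frame_R Dg.
have [e' e'0 he'] := bichar_near hg tb (open_nbhs_nbhs (conj (@cdom_open _ _ _ A d) td)).
have [s [s0 ss sm]] : exists s : R, [/\ 0 <= s, s < t &
    t - s < Num.min (Num.min e e') (Num.min m (m / C))].
  have mm : 0 < Num.min (Num.min e e') (Num.min m (m / C)).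
    by rewrite !lt_min e0 e'0 m0 !divr_gt0.
  move: (Num.min _ (Num.min _ _)) mm => k k0.
  exists (Num.max 0 (t - k / 2)); rewrite le_max lexx; split=> //.
    by rewrite gt_max tp ltrBlDr ltrDl divr_gt0.
  rewrite ltrBlDl -ltrBlDr lt_max; apply/orP; right; rewrite ltrD2l ltrN2.
  by rewrite ltr_pdivrMr// ltr_pMr// ltr1n.
move: sm; rewrite !lt_min => /andP[/andP[se se'] /andP[sm sC]].
have sb : 0 <= s <= b by rewrite s0 (le_trans (ltW ss)).
have st : `|s - t| = t - s by rewrite distrC gtr0_norm ?subr_gt0.
exists s; split=> //; split; first by apply: he' => //; rewrite st.
have := hC s; rewrite st /= in_itv /= => /(_ se sb) h1.
by rewrite (le_lt_trans h1)// mulrC -ltr_pdivlMr.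
Qed.

Lemma short_evolution c p0 : cdom c (base p0) -> nonzero p0 ->
  exists rho : R, 0 < rho /\ forall p, near_state c p0 rho p -> forall sig, 0 <= sig <= rho ->
    tame_evolution H c c sig (flow H sig) p.
Proof.
move=> hc n0; have [h [X [K [HK tX hK]]]] := hamiltonian_field hH hc n0.
have K0 : 0 < K := HK.1.
have [r1 [tau1 [r10 tau10 [K1 [K10 hK1]]]]] := integral_curves_tame tX.
have [r2 [C2 [r20 C20 hC2]]] := first_variation_short hH hc n0.
pose r := Num.min (Num.min r1 r2) K^-1.
have r0 : 0 < r by rewrite !lt_min r10 r20 invr_gt0.
have rr1 : r <= r1 by rewrite !ge_min lexx.
have rr2 : r <= r2 by rewrite !ge_min lexx orbT.
have rK : r <= K^-1 by rewrite ge_min lexx orbT.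
have [rho1 [rho10 stays]] := bichar_stays hH hc n0 r0.
pose rho := Num.min (Num.min (rho1 / 2) tau1) r2.
have rho0 : 0 < rho by rewrite !lt_min divr_gt0// tau10.
have rhor1 : rho <= rho1 / 2 by rewrite !ge_min lexx.
have rhot : rho <= tau1 by rewrite !ge_min lexx orbT.
have rhor2 : rho <= r2 by rewrite ge_min lexx orbT.
exists rho; split=> // p [pc pr] sig /andP[sig0 sigr].
have curve p' q' : cdom c (base p') -> `|state c p' - state c p| < rho1 / 2 -> flow H sig p' q' ->
  exists g, [/\ bicharacteristic H 0 sig g, g 0 = p', g sig = q',
    (forall t, 0 <= t <= sig -> near_state c p0 r (g t)) &
    deriv_on 0 sig (state c \o g) (X \o (state c \o g)) /\
    forall t, 0 <= t <= sig -> `|(state c \o g) t - state c p0| < r1].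
  move=> pc' pr' /(flowP _ _ _ sig0)[g [hg g0 gs]]; exists g.
  have nr : forall t, 0 <= t <= sig -> near_state c p0 r (g t).
    apply: (stays g sig _ hg); first by rewrite sig0 (le_trans sigr)// (le_trans rhor1)//; lra.
    rewrite g0; split=> //.
    rewrite (_ : _ - _ = (state c p' - state c p) + (state c p - state c p0)); last by module_eq.
    by rewrite (le_lt_trans (ler_normD _ _))//; have := lt_le_trans pr rhor1; lra.
  split=> //; split=> [|t /nr[_ h']]; last exact: lt_le_trans rr1.
  have D := bichar_deriv (lexx 0) (lexx sig) hg (fun t tb => (nr t tb).1).
  apply: deriv_on_ext D => t tb; split=> //.
  by have [_ _ _ ->] := hK _ (conj (nr t tb).1 (lt_le_trans (nr t tb).2 rK)).
have sigt : 0 <= sig <= 0 + tau1 by rewrite sig0 add0r (le_trans sigr).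
have sigs : 0 <= sig <= sig by rewrite sig0 lexx.
pose L := K1 + (rho1 / 2)^-1 + 1.
have ri : 0 < (rho1 / 2)^-1 by rewrite invr_gt0 divr_gt0.
have L0 : 0 < L by rewrite /L; lra.
have LK : K1 <= L by rewrite /L; lra.
have Lr : L^-1 <= rho1 / 2 by rewrite invf_ple ?posrE ?divr_gt0// /L; lra.
have L1 : L^-1 <= 1 by rewrite invf_le1// /L; lra.
split.
  exists L; split=> // w1 w2 w3 w4 y1 y2 y3 y4 h1 h2 h3 h4.
  move=> [p1 [q1 [c1 F1 E1 ->]]] [p2 [q2 [c2 F2 E2 ->]]] [p3 [q3 [c3 F3 E3 ->]]] [p4 [q4 [c4 F4 E4 ->]]].
  subst w1 w2 w3 w4.
  have [g1 [_ g10 g1s _ u1]] := curve _ _ c1 (lt_le_trans h1 Lr) F1.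
  have [g2 [_ g20 g2s _ u2]] := curve _ _ c2 (lt_le_trans h2 Lr) F2.
  have [g3 [_ g30 g3s _ u3]] := curve _ _ c3 (lt_le_trans h3 Lr) F3.
  have [g4 [_ g40 g4s _ u4]] := curve _ _ c4 (lt_le_trans h4 Lr) F4.
  have := hK1 0 sig sigt (state c \o g1) (state c \o g2) (state c \o g3) (state c \o g4) _ sig sigs.
  rewrite /= g10 g20 g30 g40 g1s g2s g3s g4s => H1.
  apply: le_trans (H1 _) _; last by rewrite ler_wpM2r// addr_ge0// mulr_ge0// addr_ge0.
  by move=> u [->|[->|[->|->]]].
pose C := L + C2 * (3 * K1) ^+ 2.
have C20' : 0 <= C2 * (3 * K1) ^+ 2 by rewrite mulr_ge0 ?exprn_ge0 ?mulr_ge0 ?(ltW K10) ?(ltW C20).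
have C0 : 0 < C by rewrite /C; lra.
have CL : C^-1 <= L^-1 by rewrite lef_pV2 ?posrE// /C; lra.
exists C; split=> // p1 q1 [c1 h1] F1.
have {}h1 := lt_le_trans h1 CL.
have [g1 [b1 g10 g1s n1 u1]] := curve _ _ c1 (lt_le_trans h1 Lr) F1.
split; [by rewrite -g1s; have [] := n1 sig sigs|exact: (flow_energy hH sig0 F1)|].
move=> p2 q2 [c2 h2] F2; have {}h2 := lt_le_trans h2 CL.
have [g2 [b2 g20 g2s n2 u2]] := curve _ _ c2 (lt_le_trans h2 Lr) F2.
have nn t : 0 <= t <= sig -> near_state c p0 r2 (g1 t) /\ near_state c p0 r2 (g2 t).
  by move=> tb; have [a1 a2] := n1 t tb; have [a3 a4] := n2 t tb;
    split; split=> //; exact: lt_le_trans rr2.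
have := hC2 sig g1 g2 (3 * K1 * `|state c p2 - state c p1|) _ b1 b2 nn _.
rewrite g10 g20 g1s g2s => H1.
apply: le_trans (H1 _ _) _; first by rewrite sig0 (le_trans sigr).
  move=> t tb.
  have := hK1 0 sig sigt (state c \o g2) (state c \o g1) (state c \o g1) (state c \o g1) _ t tb.
  rewrite /= g10 g20 !subrr !subr0 normr0 addr0 => H2.
  apply: le_trans (H2 _) _; first by move=> u [->|[->|[->|->]]].
  have : `|state c p2 - state c p1| <= 2.
    rewrite (_ : _ - _ = (state c p2 - state c p) - (state c p1 - state c p)); last by module_eq.
    by rewrite (le_trans (ler_normB _ _))//; have := lt_le_trans h1 L1; have := lt_le_trans h2 L1; lra.
  have := normr_ge0 (state c p2 - state c p1).
  move: `|_| => x x0 x2; have : 0 <= K1 * x * (2 - x).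
    by rewrite !mulr_ge0 ?(ltW K10)// subr_ge0.
  by lra.
rewrite exprMn mulrA ler_wpM2r ?exprn_ge0// /C; lra.
Qed.

(** Short evolutions are composed, by real induction along the bicharacteristic,
    with changes of charts on the way. *)
Theorem flow_tame c d (t : R) p q : 0 <= t -> flow H t p q ->
  cdom c (base p) -> cdom d (base q) -> tame_evolution H c d t (flow H t) p.
Proof.
move=> t0 /(flowP _ _ _ t0)[g [hg g0 gt]] hc; subst p q.
have nz s : 0 <= s <= t -> nonzero (g s).
  move=> st; have [e he] := cdom_cover A (base (g s)).
  by have [] := bichar_at hg st he.
have f0 s : 0 <= s <= t -> flow H s (g 0) (g s).
  by move=> /andP[s0 st]; rewrite -{1}[s]subr0; exact: (bichar_flow hg).
suff key s : 0 <= s <= t -> forall d, cdom d (base (g s)) ->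
    tame_evolution H c d s (flow H s) (g 0).
  by apply: key; rewrite t0 lexx.
have step d' s1 s2 : 0 <= s1 -> s1 <= s2 -> s2 <= t -> cdom d' (base (g s1)) ->
    tame_evolution H c d' s1 (flow H s1) (g 0) ->
    tame_evolution H d' d' (s2 - s1) (flow H (s2 - s1)) (g s1) ->
    tame_evolution H c d' s2 (flow H s2) (g 0).
  move=> s0 ss st hd t1 t2.
  have := evolution_comp hc (f0 s1 _) t1 t2; rewrite [s1 + _]addrC subrK.
  move=> T; apply: tame_evolution_sub (T _); last by rewrite s0 (le_trans ss).
  move=> p q; rewrite -{1}[s2](subrK s1) addrC => fl.
  by apply: (flow_split hH s0 _ fl); rewrite subr_ge0.
move: s; apply: real_induction => s sb IH.
  move=> d' hd'; have [s00|sn0] := eqVneq s 0.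
    subst s; apply: tame_evolution_sub (evolution_id H hc hd') => p q.
    exact: flow0.
  have sp : 0 < s by rewrite lt_neqAle eq_sym sn0; case/andP: sb.
  have [rho [rho0 hrho]] := short_evolution hd' (nz s sb).
  have spt : 0 < s <= t by rewrite sp; case/andP: sb.
  have [s' [s'0 s's ss' gs']] := bichar_near_left hg spt hd' rho0.
  have s'b : 0 <= s' <= t by rewrite s'0 (le_trans (ltW s's))//; case/andP: sb.
  apply: (step d' s') => //; [exact: ltW|by case/andP: sb|by case: gs'| |].
    by apply: IH; [rewrite s'0|case: gs'].
  by apply: hrho => //; rewrite subr_ge0 !ltW.
have sb' : 0 <= s <= t by case/andP: sb => -> /ltW.
have [d' hd'] := cdom_cover A (base (g s)).
have [rho [rho0 hrho]] := short_evolution hd' (nz s sb').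
have nb : nbhs (base (g s)) (cdom d') by apply: open_nbhs_nbhs; split=> //; exact: cdom_open.
have [e e0 he] := bichar_near hg sb' nb.
exists (Num.min rho e); first by rewrite lt_min rho0.
move=> s' /andP[ss]; rewrite -ltrBlDl lt_min => /andP[m1 m2] st d'' hd''.
have s'0 : 0 <= s' by rewrite (le_trans _ (ltW ss))//; case/andP: sb.
have s'b : 0 <= s' <= t by rewrite s'0.
have hs' : cdom d' (base (g s')) by apply: he => //; rewrite gtr0_norm// subr_gt0.
have T : tame_evolution H c d' s' (flow H s') (g 0).
  apply: (step d' s) => //; [by case/andP: sb|exact: ltW| |].
    by apply: IH => //; case/andP: sb => -> _; rewrite lexx.
  apply: hrho; last by rewrite subr_ge0 (ltW ss) ltW.
  by split=> //; rewrite subrr normr0.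
have := evolution_comp hc (f0 s' s'b) T (evolution_id H hs' hd''); rewrite addr0.
by apply: tame_evolution_sub => p q fl; exists q.
Qed.

(** A tame relation is single-valued. *)
Lemma flow_unique (t : R) p q q' : 0 <= t -> flow H t p q -> flow H t p q' -> q = q'.
Proof.
move=> t0 f1 f2; have [c hc] := cdom_cover A (base p); have [d hd] := cdom_cover A (base q).
have T := flow_tame t0 f1 hc hd; have [K [K0 hK]] := evolution_lip T.
have [_ [L [L0 hL]]] := T.
have nr (r : R) : 0 < r -> near_state c p r^-1 p by move=> r0; split=> //; rewrite subrr normr0 invr_gt0.
have [hd' _ _] := hL p q' (nr _ L0) f2.
have := hK p q p q' (nr _ K0) (nr _ K0) f1 f2.
rewrite subrr normr0 mulr0 normr_le0 subr_eq0 => /eqP E'.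
exact: state_inj hd hd' (esym E').
Qed.

End flow.

(** * Inverting the exponential map *)

Section inversion.
Context {R : realType} {n : nat}.
Local Notation V := 'rV[R]_n.
Local Notation E := (V * V)%type.

Lemma injective_linear_inverse (B : V -> V) : islinear B -> (forall u, B u = 0 -> u = 0) ->
  exists B' : V -> V, [/\ islinear B', forall v, B (B' v) = v & forall v, B' (B v) = v].
Proof.
move=> linB injB; pose m : 'M[R]_n := \matrix_(i, j) B (delta_mx 0 i) 0 j.
have mE u : B u = u *m m.
  rewrite [in LHS](row_sum_delta u) islinear_sum//; apply/rowP => j.
  rewrite summxE mxE; apply: eq_bigr => i _.
  by rewrite islinearZ// !mxE.
have um : m \in unitmx.
  rewrite -row_free_unit; apply: inj_row_free => v; rewrite -mE; exact: injB.
exists (fun v => v *m invmx m); split=> [k u v|v|v].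
- by rewrite mulmxDl scalemxAl.
- by rewrite mE mulmxKV.
- by rewrite mE mulmxK.
Qed.

(** Strict differentiability of a tame relation P between initial states (z, zeta)
    and final positions y, with respect to zeta.  For z = z0 the relation is
    inverted by a map G that is differentiable on the set D of final positions;
    D is only required to contain a half-ball, and second differences transfer
    the information to all zeta and to z close to z0. *)
Lemma tame_inversion (P : E -> V -> Prop) (z0 zeta0 y0 : V) (D : set V) (G B : V -> V) (d0 : R) :
  tame_rel P (z0, zeta0) -> G y0 = zeta0 -> 0 < d0 ->
  D y0 -> (forall y, D y -> `|y - y0| < d0 -> P (z0, G y) y) ->
  (forall u, `|u| < d0 -> D (y0 + u) \/ D (y0 - u)) ->
  has_diff_within D G y0 B ->
  exists B' : V -> V, [/\ islinear B', forall v, B (B' v) = v, forall v, B' (B v) = v &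
    forall e : R, 0 < e -> exists r C : R, [/\ 0 < r, 0 < C & forall w1 w2 y1 y2,
      `|w1 - (z0, zeta0)| < r -> `|w2 - (z0, zeta0)| < r -> P w1 y1 -> P w2 y2 ->
      `|y1 - y2 - B' (w1.2 - w2.2)| <= e * `|w1.2 - w2.2| + C * `|w1.1 - w2.1|] ].
Proof.
move=> tP G0 d00 Dy0 PG half /has_diff_withinP[linB hB].
have [K [K0 lip]] := tame_lip tP; have [C0 [C00 hC]] := tP.
have w0w0 (r : R) : 0 < r -> `|(z0, zeta0) - (z0, zeta0) : E| < r by rewrite subrr normr0.
have Pw0 : P (z0, zeta0) y0 by rewrite -G0; apply: PG; rewrite ?subrr ?normr0.
have Gnorm y : `|(z0, G y) - (z0, zeta0) : E| = `|G y - G y0|.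
  by rewrite G0 -[_ - _ : E]/(z0 - z0, G y - zeta0) subrr pair_norm normr0 max_r.
have [CB CB0 hCB] := islinear_bounded (finite_frame_row n) linB.
(* B is injective, since G is a right inverse of a Lipschitz relation *)
have low u : `|u| <= K * `|B u|.
  apply/ler_addgt0Pr => e e0.
  have ku : 0 < K * (`|u| + 1) by rewrite mulr_gt0// ltr_wpDl.
  have [r r0 hr] := hB (e / (K * (`|u| + 1))) ltac:(by rewrite divr_gt0).
  have u1 : 0 < `|u| + 1 by rewrite ltr_wpDl.
  pose X : R := e / (K * (`|u| + 1)) + CB; have X0 : 0 < X by rewrite addr_gt0// divr_gt0.
  pose m : R := Num.min (Num.min d0 r) (K^-1 / X).
  pose s : R := m / (`|u| + 1) / 2.
  have m0 : 0 < m by rewrite !lt_min d00 r0 divr_gt0// invr_gt0.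
  have s0 : 0 < s by rewrite !divr_gt0.
  have su : s * `|u| < m.
    have : s * (`|u| + 1) = m / 2.
      by rewrite /s mulrAC divfK ?gt_eqF.
    have : 0 <= s * `|u| by rewrite mulr_ge0// ltW.
    by lra.
  move: (su); rewrite /m !lt_min => /andP[/andP[su1 su2]]; rewrite ltr_pdivlMr// => su3.
  have key (t : R) : `|t| = s -> D (y0 + t *: u) -> `|u| <= K * `|B u| + e.
    move=> ts Dt; have nt : `|y0 + t *: u - y0| = s * `|u| by rewrite addrC addKr normrZ ts.
    have := hr (y0 + t *: u); rewrite nt => /(_ su2 Dt).
    rewrite [y0 + _]addrC addrK islinearZ// [t *: u + y0]addrC => hG.
    have GL : `|G (y0 + t *: u) - G y0| <= s * (e / (K * (`|u| + 1)) * `|u| + `|B u|).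
      rewrite -[G _ - G y0](subrK (t *: B u)) (le_trans (ler_normD _ _))// normrZ ts.
      by rewrite mulrDr lerD// mulrCA.
    have Pt : P (z0, G (y0 + t *: u)) (y0 + t *: u) by apply: PG => //; rewrite nt.
    have b1 : `|(z0, G (y0 + t *: u)) - (z0, zeta0) : E| < K^-1.
      rewrite Gnorm (le_lt_trans GL)//; apply: le_lt_trans su3.
      rewrite -[leRHS]mulrA ler_wpM2l ?(ltW s0)// [leRHS]mulrC /X [leRHS]mulrDl lerD2l.
      exact: hCB.
    have Ki : 0 < K^-1 by rewrite invr_gt0.
    have := lip _ _ _ _ b1 (w0w0 _ Ki) Pt Pw0; rewrite Gnorm nt.
    move=> h'; have := le_trans h' (ler_wpM2l (ltW K0) GL).
    rewrite [X in X <= _ -> _]mulrC [X in _ <= X -> _]mulrCA [`|u| * s]mulrC ler_pM2l// => h2.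
    rewrite (le_trans h2)// mulrDr addrC lerD2l.
    rewrite [leLHS](_ : _ = e * (`|u| / (`|u| + 1))); last by field; rewrite !gt_eqF.
    by rewrite ler_piMr ?(ltW e0)// ler_pdivrMr// mul1r lerDl.
  have [Dt|Dt] := half (s *: u) ltac:(by rewrite normrZ gtr0_norm).
    by apply: (key s); rewrite ?gtr0_norm.
  by apply: (key (- s)); rewrite ?normrN ?gtr0_norm// scaleNr.
have [|B' [linB' BB' B'B]] := injective_linear_inverse linB.
  by move=> u Bu; apply/eqP; rewrite -normr_le0 (le_trans (low u))// Bu normr0 mulr0.
have B'K v : `|B' v| <= K * `|v| by rewrite -{2}[v]BB'; exact: low.
exists B'; split=> // e e0.
pose e' := Num.min (e / 4 / (C0 * K)) K^-1.
have CK0 : 0 < C0 * K by rewrite mulr_gt0.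
have e'0 : 0 < e' by rewrite lt_min !divr_gt0// invr_gt0.
have e'1 : e' * (C0 * K) <= e / 4 by rewrite -ler_pdivlMr// ge_min lexx.
have e'2 : e' * K <= 1 by rewrite -ler_pdivlMr// div1r ge_min lexx orbT.
have [d d_0 hd] := hB e' e'0.
pose r := Num.min (Num.min (d0 / (2 * K)) (d / (2 * K))) (Num.min (C0^-1 / 4) (Num.min 1 (e / (12 * C0)))).
have K2 : 0 < 2 * K by rewrite mulr_gt0.
have C12 : 0 < 12 * C0 by rewrite mulr_gt0.
have Ci : 0 < C0^-1 by rewrite invr_gt0.
have r0 : 0 < r by rewrite !lt_min !divr_gt0//= ltr01.
have [[r1 r2] r3 [r4 r5]] : [/\ r <= d0 / (2 * K) /\ r <= d / (2 * K), r <= C0^-1 / 4 &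
   r <= 1 /\ r <= e / (12 * C0)].
  by rewrite /r !ge_min !lexx !orbT; split.
exists r, (7 * C0); split=> //; first by rewrite mulr_gt0.
(* D contains y0 + u or y0 - u, and exchanging w1 and w2 changes the sign of u *)
suff main w1 w2 y1 y2 : `|w1 - (z0, zeta0)| < r -> `|w2 - (z0, zeta0)| < r -> P w1 y1 -> P w2 y2 ->
    D (y0 + B' (w1.2 - w2.2)) ->
    `|y1 - y2 - B' (w1.2 - w2.2)| <= e * `|w1.2 - w2.2| + 7 * C0 * `|w1.1 - w2.1|.
  move=> w1 w2 y1 y2 h1 h2 p1 p2.
  have sm : `|B' (w1.2 - w2.2)| < d0.
    rewrite (le_lt_trans (B'K _))//.
    have : `|w1.2 - w2.2| < 2 * r.
      apply: le_lt_trans (pair_snd_le (w1 - w2)) _.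
      rewrite (_ : w1 - w2 = (w1 - (z0, zeta0)) - (w2 - (z0, zeta0))); last by module_eq.
      by rewrite (le_lt_trans (ler_normB _ _))//; lra.
    rewrite -(ltr_pM2l K0) => /lt_le_trans; apply.
    by move: r1; rewrite ler_pdivlMr ?mulr_gt0//; lra.
  have [Dp|Dm] := half _ sm; first exact: main.
  have := main w2 w1 y2 y1 h2 h1 p2 p1.
  rewrite -[w2.2 - w1.2]opprB (islinearN linB') => /(_ Dm).
  by rewrite normrN [`|w2.1 - w1.1|]distrC -[y2 - y1]opprB -opprD normrN.
move=> h1 h2 p1 p2; set v := w1.2 - w2.2; set u := B' v => Du.
have vr : `|v| < 2 * r.
  apply: le_lt_trans (pair_snd_le (w1 - w2)) _.
  rewrite (_ : w1 - w2 = (w1 - (z0, zeta0)) - (w2 - (z0, zeta0))); last by module_eq.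
  by rewrite (le_lt_trans (ler_normB _ _))//; lra.
have uK : `|u| <= K * `|v| by exact: B'K.
have Kv : K * `|v| < K * (2 * r) by rewrite ltr_pM2l.
have nu : `|y0 + u - y0| = `|u| by rewrite addrC addKr.
have u1 : `|u| < d0.
  by move: r1; rewrite ler_pdivlMr ?mulr_gt0//; lra.
have u2 : `|u| < d.
  by move: r2; rewrite ler_pdivlMr ?mulr_gt0//; lra.
have := hd (y0 + u); rewrite nu => /(_ u2 Du).
rewrite (_ : y0 + u - y0 = u); last by module_eq.
have Bu : B u = v by exact: BB'.
rewrite Bu => hG.
(* over z0 the relation is known: P relates w3 to y0 + u, and (z0, zeta0) to y0 *)
pose w3 : E := (z0, G (y0 + u)).
have e'v : e' * `|u| <= `|v|.
  have : e' * `|u| <= e' * (K * `|v|) by rewrite ler_wpM2l ?(ltW e'0).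
  by have := ler_wpM2r (normr_ge0 v) e'2; lra.
have w3w0 : `|w3 - (z0, zeta0)| <= 2 * `|v|.
  rewrite Gnorm -[G _ - G y0](subrK v) (le_trans (ler_normD _ _))//.
  by rewrite mulr_natl mulr2n lerD2r (le_trans hG).
have C4 : 4 * r <= C0^-1 by lra.
have rC : r < C0^-1 by lra.
have b3 : `|w3 - (z0, zeta0)| < C0^-1 by rewrite (le_lt_trans w3w0)//; lra.
have := hC w1 w2 w3 (z0, zeta0) y1 y2 (y0 + u) y0 (lt_trans h1 rC) (lt_trans h2 rC) b3 _ p1 p2 _ Pw0.
rewrite subrr normr0 invr_gt0 => /(_ C00); rewrite (_ : y0 + u - y0 = u); last by module_eq.
have Pw3 : P w3 (y0 + u) by apply: PG => //; rewrite nu.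
move=> /(_ Pw3)/le_trans; apply.
have D2 : `|w1 - w2 - (w3 - (z0, zeta0))| <= `|w1.1 - w2.1| + e' * `|u|.
  apply: pair_norm_le.
    rewrite [X in `|X|](_ : _ = w1.1 - w2.1); first by rewrite lerDl mulr_ge0// ltW.
    by rewrite -[LHS]/(w1.1 - w2.1 - (z0 - z0)) subrr subr0.
  rewrite [X in `|X|](_ : _ = - (G (y0 + u) - G y0 - v)).
    by rewrite normrN (le_trans hG)// lerDr.
  rewrite -[LHS]/(w1.2 - w2.2 - (G (y0 + u) - zeta0)) -/v G0; module_eq.
have D1 : `|w1 - w2| <= `|w1.1 - w2.1| + `|v|.
  by apply: pair_norm_le; rewrite ?lerDl ?lerDr.
have D3 : `|w1 - w3| + `|w2 - (z0, zeta0)| <= 6 * r.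
  have : `|w1 - w3| <= `|w1 - (z0, zeta0)| + `|w3 - (z0, zeta0)|.
    rewrite (_ : w1 - w3 = (w1 - (z0, zeta0)) - (w3 - (z0, zeta0))); last by module_eq.
    exact: ler_normB.
  by lra.
have D4 : `|w1 - w2| * (`|w1 - w3| + `|w2 - (z0, zeta0)|) <= (`|w1.1 - w2.1| + `|v|) * (6 * r).
  by rewrite ler_pM// addr_ge0.
have uu : e' * `|u| <= e' * (K * `|v|) by rewrite ler_wpM2l ?(ltW e'0).
apply: (@le_trans _ _ (C0 * (`|w1.1 - w2.1| + e' * (K * `|v|) + (`|w1.1 - w2.1| + `|v|) * (6 * r)))).
  by move: D2 D4 uu; clear - C00 => D2 D4 uu; rewrite ler_wpM2l ?(ltW C00)//; lra.
have z1 := normr_ge0 (w1.1 - w2.1); have v1 := normr_ge0 v.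
have q1 := ler_wpM2r v1 e'1.
have r5' : 12 * C0 * r <= e by move: r5; rewrite ler_pdivlMr// mulrC.
have q2 := ler_wpM2r v1 r5'.
have q3 : C0 * (`|w1.1 - w2.1| * (6 * r)) <= C0 * (`|w1.1 - w2.1| * 6).
  by rewrite ler_wpM2l ?(ltW C00)// ler_wpM2l// ler_piMr.
have ev : 0 <= e * `|v| by rewrite mulr_ge0// ltW.
by move: ev q1 q2 q3 z1 v1; clear; lra.
Qed.

End inversion.

(** * The travel time and its differentials *)

Section cotangent_neighbourhoods.
Context {R : realType} {n : nat} {M : topologicalType} {A : smooth_manifold R n M}.
Implicit Types (c : chart A) (p q : cotangent A) (W : set (cotangent A)).

Lemma nbhs_cotangent_state p W c : nbhs_cotangent p W -> cdom c (base p) ->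
  exists r : R, 0 < r /\ forall q, near_state c p r q -> W q.
Proof.
move=> [c' hc' [e e0 hW]] hc.
have [Psi [K [K0 tPsi hK]]] := transition_tame hc hc'.
have [r r0 hr] := tame_near tPsi erefl e0.
have [|_ E0 _] := hK p hc; first by rewrite subrr normr0 invr_gt0.
exists (Num.min r K^-1); split=> [|q [qc]]; first by rewrite lt_min r0 invr_gt0.
rewrite lt_min => /andP[qr qK]; have [qc' qE _] := hK q qc qK.
have qe : `|state c' q - state c' p| < e by rewrite qE E0; exact: hr qr erefl.
apply: hW => //.
  by apply: le_lt_trans qe; exact: (pair_fst_le (state c' q - state c' p)).
by apply: le_lt_trans qe; exact: (pair_snd_le (state c' q - state c' p)).
Qed.

Lemma state_nbhs_cotangent p W c (r : R) : cdom c (base p) -> 0 < r ->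
  (forall q, near_state c p r q -> W q) -> nbhs_cotangent p W.
Proof.
move=> hc r0 h; exists c => //; exists r => // q qc q1 q2; apply: h; split=> //.
exact: pair_norm_lt.
Qed.

Lemma nbhs_cotangentI p W W' :
  nbhs_cotangent p W -> nbhs_cotangent p W' -> nbhs_cotangent p (W `&` W').
Proof.
move=> hW hW'; have [c hc] := cdom_cover A (base p).
have [r [r0 h]] := nbhs_cotangent_state hW hc.
have [r' [r'0 h']] := nbhs_cotangent_state hW' hc.
apply: (@state_nbhs_cotangent _ _ c (Num.min r r')) => //; first by rewrite lt_min r0.
by move=> q [qc]; rewrite lt_min => /andP[q1 q2]; split; [apply: h|apply: h'].
Qed.

Lemma nbhs_prodP (x y : M) (Z : set (M * M)) : nbhs (x, y) Z ->
  exists U V' : set M, [/\ nbhs x U, nbhs y V' & forall a b, U a -> V' b -> Z (a, b)].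
Proof. by move=> [[U V'] [/= hU hV] h]; exists U, V'; split=> // a b Ua Vb; exact: h. Qed.

End cotangent_neighbourhoods.

Section travel_time.
Context {R : realType} {n : nat} {M : topologicalType} {A : smooth_manifold R n M}
  (H : cotangent A -> R).
Hypothesis hH : hamiltonian_conditions H.
Local Notation V := 'rV[R]_n.
Local Notation E := (V * V)%type.
Implicit Types (c d e : chart A) (p q : cotangent A) (g : R -> cotangent A).

(** The half-ball condition on D holds because D contains the points of a half
    space near the coordinates of y0, and u or - u points into it. *)
Lemma not_conjugate_charts p0 y0 : not_conjugate H p0 y0 ->
  exists c d (D : set V) (G B : V -> V) (d0 : R),
    [/\ [/\ cdom c (base p0), cdom d y0, 0 < d0 & D (cmap d y0)],
      G (cmap d y0) = comp p0 c,
      (forall y, D y -> `|y - cmap d y0| < d0 -> exists p q,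
        [/\ flow H 1 p q, base p = base p0, comp p c = G y & cmap d (base q) = y]),
      (forall u, `|u| < d0 -> D (cmap d y0 + u) \/ D (cmap d y0 - u)) &
      has_diff_within D G (cmap d y0) B].
Proof.
move=> [ex0 [c [d [W [P [f [g [[cx oW Wx] [oP Py Pd] [_ sg] hD hg]]]]]]]].
have dy : cdom d y0 by exact: Pd.
have f0 : f (comp p0 c) = cmap d y0 /\ g (cmap d y0) = comp p0 c.
  have [||h1 h2 h3] := hD (comp p0 c) y0; last by rewrite -h2.
    by split=> //; exists y0; rewrite cotangent_atE.
  by rewrite cotangent_atE.
have Dy : (cmap d @` P) (cmap d y0) by exists y0.
have [Q [gh [oQ Qy Cg Eg]]] := sg _ Dy.
have /near_normP[r r0 hr] : nbhs (cmap d y0) Q by exact: open_nbhs_nbhs.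
have [d1 d10 h1] := cinv_near dy (open_nbhs_nbhs (conj oP Py)).
have [d2 d20 h2] := chart_image_near dy.
exists c, d, (cmap d @` P), g, (fun v => 'D_v gh (cmap d y0)), (Num.min d1 d2).
split=> //; [by rewrite lt_min d10|by case: f0| | |].
- move=> y Dy' _; have [[Wg [y' ex]] fg] := hg y Dy'.
  have [Py' E _] := hD (g y) y' (conj Wg (ex_intro _ y' ex)) ex.
  case: ex => q fl bq; exists (cotangent_at c (cmap c (base p0)) (g y)), q.
  have [b1 b2] := cotangent_at_map (g y) cx.
  by split=> //; rewrite bq -E fg.
- have inD u : `|u| < Num.min d1 d2 -> 0 <= coord0 u -> (cmap d @` P) (cmap d y0 + u).
    rewrite lt_min => /andP[u1 u2] cu.
    have nu : `|cmap d y0 + u - cmap d y0| = `|u| by rewrite addrC addKr.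
    have iu : chart_image d (cmap d y0 + u).
      apply: h2; first by rewrite nu.
      rewrite (islinearD coord0_linear) addr_ge0//.
      exact: chart_coord0_ge0 (chart_image_map dy).
    exists (cinv d (cmap d y0 + u)); last by have [] := cinvK iu.
    by apply: h1; rewrite ?nu.
  move=> u hu; have [cu|/ltW cu] := leP 0 (coord0 u); first by left; exact: inD.
  by right; apply: inD; rewrite ?normrN// (islinearN coord0_linear) oppr_ge0.
- apply: (hdw_local r0 _ _ (differentiable_hdw setT ((Cg 1%N).1 _ Qy))).
    by move=> z zr Dz; split=> //; apply/esym/Eg; rewrite inE; split=> //; exact: hr.
  by apply/esym/Eg; rewrite inE.
Qed.

Lemma tame_rel_fst c d (F : cotangent A -> cotangent A -> Prop) p0 q0 :
  cdom c (base p0) -> F p0 q0 -> tame_rel (chart_rel c d F) (state c p0) ->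
  tame_rel (fun w y => exists p q, [/\ cdom c (base p), F p q, w = state c p &
    y = cmap d (base q)]) (state c p0).
Proof.
move=> hc F0 tF.
have P0 : chart_rel c d F (state c p0) (state d q0) by exists p0, q0.
have fE : finite_frame (E : normedModType R) by exact: _.
have := tame_rel_comp tF (tame_linear (state d q0) fE (@fst_linear R n)) P0.
apply: (tame_rel_sub (@ltr01 R)) => w y _ [p [q [pc Fpq wE yE]]].
by exists (state d q); [exists p, q|].
Qed.

(** Without conjugate points, a bicharacteristic depends in a Lipschitz way on
    its end points, and the first variation formula gives the differential of
    the energy as a function of the end points. *)
Lemma endpoint_estimates p0 q0 : flow H 1 p0 q0 -> not_conjugate H p0 (base q0) ->
  exists c d (r K : R), [/\ cdom c (base p0), cdom d (base q0), 0 < r /\ 0 < K &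
    forall p q p' q', near_state c p0 r p -> near_state c p0 r p' ->
      flow H 1 p q -> flow H 1 p' q' ->
      let s := `|cmap c (base p') - cmap c (base p)| + `|cmap d (base q') - cmap d (base q)| in
      [/\ cdom d (base q), `|comp p' c - comp p c| <= K * s &
      `|pairing (comp q d) (cmap d (base q') - cmap d (base q)) -
        pairing (comp p c) (cmap c (base p') - cmap c (base p)) - (H p' - H p)| <=
      K * s ^+ 2]].
Proof.
move=> fl /not_conjugate_charts[c [d [D [G [B [d0 [[hc hd d00 Dy] G0 hG half dG]]]]]]].
have T := flow_tame hH ler01 fl hc hd; have [tF [L [L0 hL]]] := T.
have [|B' [linB' BB' B'B inv]] := @tame_inversion _ _ _ _ (comp p0 c) _ _ _ B _
  (tame_rel_fst hc fl tF) G0 d00 Dy _ half dG.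
  move=> y Dy' yd; have [p [q [fpq bp cp bq]]] := hG y Dy' yd.
  by exists p, q; split=> //; rewrite ?bp// /state bp cp.
have linB : islinear B by case: dG.
have [CB CB0 hCB] := islinear_bounded (finite_frame_row n) linB.
have [r [C [r0 C0 hr]]] := inv (1 / (2 * CB)) ltac:(by rewrite divr_gt0// mulr_gt0).
pose K1 := 2 * CB * (1 + C).
have K10 : 0 < K1 by rewrite !mulr_gt0// addr_gt0.
exists c, d, (Num.min r L^-1), (K1 + L * (1 + K1) ^+ 2); split=> //.
  split; first by rewrite lt_min r0 invr_gt0.
  by rewrite addr_gt0// mulr_gt0// exprn_gt0// addr_gt0.
move=> p q p' q' [pc] + [pc'] + fq fq' s.
rewrite !lt_min => /andP[pr pL] /andP[pr' pL'].
have [qd _ /(_ p' q' (conj pc' pL') fq') var] := hL p q (conj pc pL) fq.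
have s0 : 0 <= s by rewrite addr_ge0.
have lip : `|comp p' c - comp p c| <= K1 * s.
  have := hr (state c p') (state c p) (cmap d (base q')) (cmap d (base q)) pr' pr
    (ex_intro _ p' (ex_intro _ q' (And4 pc' fq' erefl erefl)))
    (ex_intro _ p (ex_intro _ q (And4 pc fq erefl erefl))).
  rewrite /=; set v := comp p' c - comp p c; set y := cmap d (base q') - _.
  set z := cmap c (base p') - _ => h.
  have h1 : `|v| <= CB * `|B' v| by rewrite -{1}[v]BB'; exact: hCB.
  have h2 : `|B' v| <= `|y| + `|y - B' v|.
    by rewrite -{1}[B' v](subKr y) (le_trans (ler_normB _ _)).
  have h3 : CB * `|B' v| <= CB * (`|y| + (1 / (2 * CB) * `|v| + C * `|z|)).
    by rewrite ler_wpM2l ?(ltW CB0)// (le_trans h2)// lerD2l.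
  have h4 : CB * (1 / (2 * CB) * `|v|) = `|v| / 2 by field; rewrite gt_eqF.
  have yz : 0 <= CB * (C * `|y| + `|z|) by rewrite mulr_ge0 ?(ltW CB0)// addr_ge0// mulr_ge0// ltW.
  rewrite /s -/z -/y /K1; move: h1 h3 h4 yz; clear; lra.
have nn : 0 <= L * (1 + K1) ^+ 2 by rewrite mulr_ge0 ?(ltW L0)// exprn_ge0// addr_ge0// ltW.
split=> //; first by rewrite (le_trans lip)// ler_wpM2r// lerDl.
rewrite mul1r in var; apply: le_trans var _.
have : `|state c p' - state c p| <= (1 + K1) * s.
  apply: pair_norm_le.
    by rewrite mulrDl mul1r (le_trans (_ : _ <= s)) ?lerDl// mulr_ge0// ltW.
  by rewrite (le_trans lip)// ler_wpM2r// lerDr.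
move=> h; rewrite mulrDl (le_trans _ (_ : L * (1 + K1) ^+ 2 * s ^+ 2 <= _))//; last first.
  by rewrite lerDr mulr_ge0 ?exprn_ge0// ltW.
rewrite -mulrA ler_wpM2l ?(ltW L0)// -exprMn ler_sqr ?nnegrE//.
by rewrite mulr_ge0// addr_ge0// ltW.
Qed.

Lemma hdw_quadratic (V1 W1 : normedModType R) (D : set V1) (f : V1 -> W1) a L (r C : R) :
  islinear L -> 0 < r -> (forall z, `|z - a| < r -> D z ->
    `|f z - f a - L (z - a)| <= C * `|z - a| ^+ 2) -> has_diff_within D f a L.
Proof.
move=> linL r0 h; apply/has_diff_withinP; split=> // e e0.
have C1 : 0 < `|C| + 1 by rewrite ltr_wpDl.
exists (Num.min r (e / (`|C| + 1))); first by rewrite lt_min r0 divr_gt0.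
move=> z; rewrite lt_min => /andP[zr]; rewrite ltr_pdivlMr// => ze Dz.
rewrite (le_trans (h z zr Dz))// expr2 mulrA ler_wpM2r//.
have : C * `|z - a| <= `|C| * `|z - a| by rewrite ler_wpM2r// ler_norm.
by have := normr_ge0 (z - a); lra.
Qed.

(** From the variation of T^2 / 2 to the variation of T. *)
Lemma time_variation (T tau C K : R) : 0 < T -> 0 < tau -> 0 <= C -> 0 <= K ->
  exists C1 : R, 0 <= C1 /\ forall (T' s m : R), 0 <= T' -> tau <= T + T' -> 0 <= s <= 1 ->
    `|m| <= K * s -> `|T * m - (T' ^+ 2 / 2 - T ^+ 2 / 2)| <= C * s ^+ 2 ->
    `|T' - T - m| <= C1 * s ^+ 2.
Proof.
move=> T0 tau0 C0 K0.
pose L := 2 * (T * K + C) / tau.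
have L0 : 0 <= L by rewrite divr_ge0 ?(ltW tau0)// mulr_ge0// addr_ge0// mulr_ge0// ltW.
exists ((C + L ^+ 2 / 2) / T); split.
  by rewrite divr_ge0 ?(ltW T0)// addr_ge0// divr_ge0// exprn_ge0.
move=> T' s m' T'0 tT /andP[s0 s1] hm h.
have s2 : s ^+ 2 <= s by rewrite expr2 ler_piMl.
have d1 : `|T' - T| <= L * s.
  have : `|T'^+2 / 2 - T^+2 / 2| <= T * (K * s) + C * s.
    rewrite -[X in `|X|](subKr (T * m')) (le_trans (ler_normB _ _))// lerD//.
      by rewrite normrM gtr0_norm// ler_wpM2l// ltW.
    by rewrite (le_trans h)// ler_wpM2l.
  rewrite (_ : T'^+2 / 2 - T^+2 / 2 = (T' - T) * ((T + T') / 2)); last by field.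
  rewrite normrM [X in _ * X]ger0_norm; last by rewrite divr_ge0// addr_ge0// ltW.
  have : `|T' - T| * (tau / 2) <= `|T' - T| * ((T + T') / 2).
    by rewrite ler_wpM2l// ler_wpM2r.
  move=> h1 h2; have := le_trans h1 h2.
  by rewrite /L mulrAC ler_pdivlMr//; lra.
rewrite mulrAC ler_pdivlMr// -[X in _ * X](gtr0_norm T0) -normrM.
rewrite (_ : (T' - T - m') * T = - (T * m' - (T' ^+ 2 / 2 - T ^+ 2 / 2)) - (T' - T) ^+ 2 / 2);
  last by field.
rewrite (le_trans (ler_normB _ _))// normrN mulrDl lerD//.
rewrite ger0_norm; last by rewrite divr_ge0// sqr_ge0.
rewrite [leRHS]mulrAC ler_wpM2r// -exprMn -real_normK ?num_real//.
by rewrite ler_sqr ?nnegrE// mulr_ge0.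
Qed.

End travel_time.

Section travel_time_differential.
Context {R : realType} {n : nat} {M : topologicalType} {A : smooth_manifold R n M}
  (H : cotangent A -> R).
Hypothesis hH : hamiltonian_conditions H.
Local Notation V := 'rV[R]_n.
Local Notation E := (V * V)%type.
Implicit Types (c d : chart A) (p q : cotangent A) (g : R -> cotangent A).

Lemma scale_near c p0 (T0 r : R) : cdom c (base p0) -> 0 < T0 -> 0 < r ->
  exists delta : R, 0 < delta /\ forall p t, near_state c p0 delta p -> `|t - T0| < delta ->
    near_state c (covector_scale T0 p0) r (covector_scale t p).
Proof.
move=> hc T00 r0; pose B := `|comp p0 c| + 1 + T0 + 1.
have B0 : 0 < B by rewrite /B; have := normr_ge0 (comp p0 c); lra.
exists (Num.min 1 (r / B)); split; first by rewrite lt_min ltr01 divr_gt0.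
move=> p t [pc]; rewrite !lt_min => /andP[p1 pr] /andP[t1 tr]; split=> //.
have B1 : 1 <= B by rewrite /B; have := normr_ge0 (comp p0 c); lra.
have rB : r / B * B = r by rewrite divfK ?gt_eqF.
have rBr : r / B <= r by rewrite ler_pdivrMr// ler_peMr// ltW.
apply: pair_norm_lt => /=.
  by rewrite (lt_le_trans _ rBr)//; apply: le_lt_trans pr; exact: (pair_fst_le (state c p - state c p0)).
have z1 := le_lt_trans (pair_snd_le (state c p - state c p0)) p1.
have zr := le_lt_trans (pair_snd_le (state c p - state c p0)) pr.
rewrite -[(state c p - state c p0).2]/(comp p c - comp p0 c) in z1 zr.
rewrite (_ : t *: comp p c - T0 *: comp p0 c =
  (t - T0) *: comp p c + T0 *: (comp p c - comp p0 c)); last by module_eq.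
rewrite (le_lt_trans (ler_normD _ _))// !normrZ (gtr0_norm T00).
have zB : `|comp p c| <= `|comp p0 c| + 1.
  by rewrite -[comp p c](subrK (comp p0 c)) (le_trans (ler_normD _ _))// addrC lerD2l ltW.
have h1 : `|t - T0| * `|comp p c| <= r / B * (`|comp p0 c| + 1) by rewrite ler_pM// ltW.
have h2 : T0 * `|comp p c - comp p0 c| <= r / B * T0 by rewrite mulrC ler_wpM2r// ltW.
rewrite (le_lt_trans (lerD h1 h2))// -mulrDr -[ltRHS]rB ltr_pM2l ?divr_gt0//.
by rewrite /B ltrDl.
Qed.

Lemma flow_unit_time (t : R) p q : 0 < t -> flow H t p q ->
  flow H 1 (covector_scale t p) (covector_scale t q).
Proof.
by move=> t0 /(flow_scale hH t0 (ltW t0)); rewrite mulfV ?gt_eqF.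
Qed.

Lemma energy_scale (t : R) p : 0 < t -> unit_covector H p ->
  H (covector_scale t p) = t ^+ 2 / 2.
Proof. by move=> t0 [pn pH]; rewrite (H_homogeneous hH)// pH mul1r. Qed.

Lemma near_half (s T0 : R) : 0 < T0 -> `|s - T0| < T0 / 2 -> T0 / 2 <= s /\ 0 < s.
Proof. by rewrite ltr_norml => t0 /andP[h1 h2]; split; lra. Qed.

Lemma pairing_cross_bound (u v a b : V) :
  `|pairing u a - pairing v b| <= n%:R * (`|u| + `|v|) * (`|b| + `|a|).
Proof.
rewrite (le_trans (ler_normB _ _))//.
have := pairing_bound u a; have := pairing_bound v b.
have n0 : 0 <= n%:R * (`|u| * `|b| + `|v| * `|a|).
  by rewrite mulr_ge0// addr_ge0// mulr_ge0.
lra.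
Qed.

(** After rescaling to time one, the bicharacteristics from x to y and from x' to
    y' have energies T^2 / 2 and T'^2 / 2, and the end covectors of the first are
    T p and T q.  The first variation of the action then reads
    T (<q, dy> - <p, dx>) = (T'^2 - T^2) / 2 up to second order in dx and dy, and
    division by T gives both differentials of the travel time. *)
Theorem travel_differential p0 q0 (T0 : R) (T : M -> M -> R) (W1 : set (cotangent A)) (e1 : R) :
  unit_covector H p0 -> 0 < T0 -> flow H T0 p0 q0 ->
  not_conjugate H (covector_scale T0 p0) (base q0) ->
  nbhs_cotangent p0 W1 -> 0 < e1 ->
  (forall W e, nbhs_cotangent p0 W -> W `<=` W1 -> 0 < e <= e1 ->
      \forall z \near nbhs (base p0, base q0),
        exists2 p, travels H W T0 e z.1 z.2 p (T z.1 z.2) &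
        forall p' t', travels H W T0 e z.1 z.2 p' t' -> p' = p /\ t' = T z.1 z.2) ->
  forall W e, nbhs_cotangent p0 W -> 0 < e ->
  \forall z \near nbhs (base p0, base q0), exists p q,
    [/\ [/\ W p, W1 p & unit_covector H p], base p = z.1 /\ base q = z.2,
        [/\ `|T z.1 z.2 - T0| < e, `|T z.1 z.2 - T0| < e1 & 0 < T z.1 z.2],
        flow H (T z.1 z.2) p q &
        is_differential (fun x => T x z.2) (covector_scale (-1) p) /\
        is_differential (fun y => T z.1 y) q].
Proof.
move=> up T00 fl nc hW1 e10 hT W e hW e0.
have [c [d [r [K [hc hd [r0 K0] est]]]]] := endpoint_estimates hH (flow_unit_time T00 fl) nc.
have [delta [delta0 hdelta]] := scale_near (p0 := p0) hc T00 r0.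
pose W' : set (cotangent A) := (W `&` W1) `&` near_state c p0 delta.
have hW' : nbhs_cotangent p0 W'.
  apply: nbhs_cotangentI; first exact: nbhs_cotangentI.
  exact: (@state_nbhs_cotangent _ _ _ _ p0 _ c delta hc).
pose e' := Num.min (Num.min e e1) (Num.min delta (T0 / 2)).
have e'0 : 0 < e' by rewrite !lt_min e0 e10 delta0 divr_gt0.
have [] := nbhs_prodP (hT W' e' hW' _ _); first by move=> p [[]].
  by rewrite e'0 !ge_min lexx orbT.
move=> U [V' [hU hV hZ]].
have trav x y : U x -> V' y -> exists p q, [/\ [/\ W' p, unit_covector H p & base p = x /\ base q = y],
    `|T x y - T0| < e', 0 < T x y & flow H (T x y) p q].
  move=> Ux Vy; have [p [W'p pu bp Te [q fq bq]] _] := hZ x y Ux Vy.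
  exists p, q; split=> //=.
  have : `|T x y - T0| < T0 / 2 by rewrite (lt_le_trans Te)// !ge_min lexx !orbT.
  by case/(near_half T00).
exists (U^°, V'^°); first by split=> /=; apply: nbhs_interior.
move=> [x y] [/= Ux Vy].
have Ux' := interior_subset Ux; have Vy' := interior_subset Vy.
have [p [q [[[[Wp W1p] np] pu [bp bq]] Te t0 fq]]] := trav x y Ux' Vy'.
set t := T x y in Te t0 fq *.
have Tdelta s : `|s - T0| < e' -> `|s - T0| < delta.
  by move=> h; rewrite (lt_le_trans h)// !ge_min lexx !orbT.
have Thalf s : `|s - T0| < e' -> T0 / 2 <= s.
  move=> h; have : `|s - T0| < T0 / 2 by rewrite (lt_le_trans h)// !ge_min lexx !orbT.
  by case/(near_half T00).
have key x' y' : U x' -> V' y' ->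
    let s := `|cmap c x' - cmap c x| + `|cmap d y' - cmap d y| in
    let m := pairing (comp q d) (cmap d y' - cmap d y) -
       pairing (comp p c) (cmap c x' - cmap c x) in
    [/\ cdom d y, 0 < T x' y', T0 <= t + T x' y' &
      `|t * m - (T x' y' ^+ 2 / 2 - t ^+ 2 / 2)| <= K * s ^+ 2].
  move=> Ux0 Vy0 s m.
  have [p' [q' [[[_ np'] pu' [bp' bq']] Te' t0' fq']]] := trav x' y' Ux0 Vy0.
  have := est (covector_scale t p) (covector_scale t q) (covector_scale (T x' y') p')
    (covector_scale (T x' y') q') (hdelta _ _ np (Tdelta _ Te)) (hdelta _ _ np' (Tdelta _ Te'))
    (flow_unit_time t0 fq) (flow_unit_time t0' fq').
  rewrite /= bp bq bp' bq' !energy_scale// => -[dy _ h]; split=> //.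
    by rewrite [leLHS](splitr T0) lerD// Thalf.
  by move: h; rewrite !pairingZl -mulrBr.
have [dy _ _ _] := key x y Ux' Vy'.
have cx : cdom c x by rewrite -bp; case: np.
have K'0 : 0 <= n%:R * (`|comp q d| + `|comp p c|) by rewrite mulr_ge0// addr_ge0.
have [C1 [C10 tv]] := time_variation t0 T00 (ltW K0) K'0.
have fin x' y' : U x' -> V' y' ->
    `|cmap c x' - cmap c x| + `|cmap d y' - cmap d y| <= 1 ->
    `|T x' y' - t - (pairing (comp q d) (cmap d y' - cmap d y) -
       pairing (comp p c) (cmap c x' - cmap c x))| <=
      C1 * (`|cmap c x' - cmap c x| + `|cmap d y' - cmap d y|) ^+ 2.
  move=> Ux0 Vy0 s1; have [_ t0' tt h] := key x' y' Ux0 Vy0.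
  apply: tv => //; first exact: ltW.
    by rewrite s1 addr_ge0.
  exact: pairing_cross_bound.
exists p, q; split=> //.
  split=> //; first by rewrite (lt_le_trans Te)// !ge_min lexx.
  by rewrite (lt_le_trans Te)// !ge_min lexx !orbT.
split.
- apply: (is_differential_chart (c := c)); rewrite /= bp//.
  have [d1 d10 hd1] := cinv_near cx Ux.
  apply: (@hdw_quadratic _ _ _ _ _ _ _ (Num.min d1 1) C1).
  + exact: pairing_linearr.
  + by rewrite lt_min d10 ltr01.
  move=> z; rewrite lt_min => /andP[zd z1] iz.
  have [_ zE] := cinvK iz.
  have := fin (cinv c z) y (hd1 z iz zd) Vy'; rewrite zE subrr normr0 addr0 pairing0r sub0r.
  move=> /(_ (ltW z1)); rewrite /= cmapK// -/t pairingZl mulN1r.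
  by rewrite opprK.
- apply: (is_differential_chart (c := d)); rewrite /= bq//.
  have [d1 d10 hd1] := cinv_near dy Vy.
  apply: (@hdw_quadratic _ _ _ _ _ _ _ (Num.min d1 1) C1).
  + exact: pairing_linearr.
  + by rewrite lt_min d10 ltr01.
  move=> z; rewrite lt_min => /andP[zd z1] iz.
  have [_ zE] := cinvK iz.
  have := fin x (cinv d z) Ux' (hd1 z iz zd); rewrite zE subrr normr0 add0r pairing0r subr0.
  by move=> /(_ (ltW z1)); rewrite /= cmapK.
Qed.

End travel_time_differential.

(** * Symplectic invariance of the Hamiltonian field *)

Section symplectic.
Context {R : realType} {n : nat} {M : topologicalType} {A : smooth_manifold R n M}.
Local Notation V := 'rV[R]_n.
Local Notation E := (V * V)%type.
Implicit Types (c d : chart A) (p q : cotangent A) (g : R -> cotangent A).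

(** The left-hand side is symmetric in a and b but for the iterated derivative,
    which makes the latter symmetric too. *)
Lemma derive_second_difference (W X : normedModType R) (O : set W) (f : W -> X) (z a b : W) (e : R) :
  finite_frame W -> open O -> O z -> Ck 2 O f -> 0 < e ->
  exists2 r : R, 0 < r & forall s : R, 0 < s < r ->
    `|f (z + s *: a + s *: b) - f (z + s *: a) - (f (z + s *: b) - f z) -
      s ^+ 2 *: 'D_a (fun x => 'D_b f x) z| <= e * s ^+ 2.
Proof.
move=> fW oO Oz [df d2f] e0.
have /near_normP[r0 r00 hr0] : nbhs z O by exact: open_nbhs_nbhs.
have [d2 _] := d2f b.
pose N := 2 * (`|a| + `|b|) + 1; have N0 : 0 < N by rewrite ltr_wpDl// mulr_ge0// addr_ge0.
have /has_diff_withinP[linD /(_ (e / N))[|r1 r10 hr1]] := differentiable_hdw setT (d2 z Oz).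
  by rewrite divr_gt0.
have m0 : 0 < Num.min r0 r1 by rewrite lt_min r00.
exists (Num.min r0 r1 / N); first by rewrite divr_gt0.
move=> s /andP[s0]; rewrite ltr_pdivlMr// => sN.
have ab0 : 0 <= s * (`|a| + `|b|) by rewrite mulr_ge0 ?(ltW s0)// addr_ge0.
have small (k l : R) : 0 <= k <= 1 -> 0 <= l <= 1 ->
    `|(z + k *: (s *: a) + l *: (s *: b)) - z| <= s * (`|a| + `|b|).
  move=> /andP[k0 k1] /andP[l0 l1].
  rewrite (_ : _ - z = k *: (s *: a) + l *: (s *: b)); last by module_eq.
  rewrite (le_trans (ler_normD _ _))// !normrZ !(ger0_norm k0) !(ger0_norm l0) (gtr0_norm s0).
  by rewrite mulrDr lerD// ler_piMl// mulr_ge0// ltW.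
have sm : s * (`|a| + `|b|) < Num.min r0 r1 by move: sN; rewrite /N; lra.
have dO y : `|y - z| <= s * (`|a| + `|b|) -> has_diff_within setT f y (fun v => 'D_v f y).
  move=> hy; apply/differentiable_hdw/df/hr0.
  by rewrite (le_lt_trans hy)// (lt_le_trans sm)// ge_min lexx.
have D1 := @deriv_on_segment R W X f (fun y v => 'D_v f y) (z + s *: a) (s *: b) fW.
have D2 := @deriv_on_segment R W X f (fun y v => 'D_v f y) z (s *: b) fW.
have {}D1 : deriv_on 0 1 (fun t : R => f (z + s *: a + t *: (s *: b)))
    (fun t => 'D_(s *: b) f (z + s *: a + t *: (s *: b))).
  apply: D1 => t t01; apply: dO.
  by have := small 1 t; rewrite scale1r; apply; rewrite ?ler01 ?lexx.
have {}D2 : deriv_on 0 1 (fun t : R => f (z + t *: (s *: b)))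
    (fun t => 'D_(s *: b) f (z + t *: (s *: b))).
  apply: D2 => t t01; apply: dO.
  by have := small 0 t; rewrite scale0r addr0; apply; rewrite ?ler01 ?lexx.
have := mean_value01 (deriv_onB (deriv_onB D1 D2)
  (@deriv_on_linear_part R X 0 1 (s ^+ 2 *: 'D_a (fun x => 'D_b f x) z))).
move=> /(_ (e * s ^+ 2)); rewrite !scale1r !scale0r !addr0 subr0 => MV.
rewrite (_ : _ - _ = f (z + s *: a + s *: b) - f (z + s *: b) -
  s ^+ 2 *: 'D_a (fun x => 'D_b f x) z - (f (z + s *: a) - f z)); last by module_eq.
apply: MV => t t01.
have b1 := small 1 t ltac:(by rewrite ler01 lexx) t01; rewrite scale1r in b1.
have b2 := small 0 t ltac:(by rewrite ler01 lexx) t01; rewrite scale0r addr0 in b2.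
set y1 := z + s *: a + _ in b1 *; set y2 := z + t *: _ in b2 *.
have lin1 : islinear (fun v => 'D_v f y1) by case: (dO _ b1).
have lin2 : islinear (fun v => 'D_v f y2) by case: (dO _ b2).
rewrite (islinearZ lin1) (islinearZ lin2).
have h1 := hr1 y1 (lt_le_trans (le_lt_trans b1 sm) _) I.
have h2 := hr1 y2 (lt_le_trans (le_lt_trans b2 sm) _) I.
have {}h1 := h1 ltac:(by rewrite ge_min lexx orbT).
have {}h2 := h2 ltac:(by rewrite ge_min lexx orbT).
have E1 : 'D_(y1 - z) (fun x => 'D_b f x) z - 'D_(y2 - z) (fun x => 'D_b f x) z =
    s *: 'D_a (fun x => 'D_b f x) z.
  rewrite -(islinearB linD) -(islinearZ linD); congr ('D_(_) _ _).
  by rewrite /y1 /y2; module_eq.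
have -> : s *: 'D_b f y1 - s *: 'D_b f y2 - s ^+ 2 *: 'D_a (fun x => 'D_b f x) z =
   s *: (('D_b f y1 - 'D_b f z - 'D_(y1 - z) (fun x => 'D_b f x) z) -
         ('D_b f y2 - 'D_b f z - 'D_(y2 - z) (fun x => 'D_b f x) z)).
  by rewrite expr2 -scalerA -E1; module_eq.
rewrite normrZ (gtr0_norm s0) mulrC expr2 mulrA ler_wpM2r ?(ltW s0)//.
rewrite (le_trans (ler_normB _ _))// (le_trans (lerD h1 h2))// -mulrDr.
rewrite mulrAC ler_pdivrMr// -mulrA ler_wpM2l ?(ltW e0)//.
by rewrite /N; move: b1 b2 s0 ab0; clear; lra.
Qed.

Lemma derive_sym (W X : normedModType R) (O : set W) (f : W -> X) (z a b : W) :
  finite_frame W -> open O -> O z -> Ck 2 O f ->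
  'D_a (fun x => 'D_b f x) z = 'D_b (fun x => 'D_a f x) z.
Proof.
move=> fW oO Oz C2; apply/eqP; rewrite -subr_eq0; apply/eqP.
apply: (@small_norm_eq0 _ _ _ 2) => // e e0.
have [r1 r10 h1] := derive_second_difference a b fW oO Oz C2 e0.
have [r2 r20 h2] := derive_second_difference b a fW oO Oz C2 e0.
pose s := Num.min r1 r2 / 2.
have m0 : 0 < Num.min r1 r2 by rewrite lt_min r10.
have s0 : 0 < s by rewrite divr_gt0.
have sm : s < Num.min r1 r2 by rewrite /s ltr_pdivrMr// ltr_pMr// ltr1n.
move: (sm); rewrite lt_min => /andP[s1 s2].
have {}h1 := h1 s ltac:(by rewrite s0); have {}h2 := h2 s ltac:(by rewrite s0).
have s20 : 0 < s ^+ 2 by rewrite exprn_gt0.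
rewrite -(ler_pM2l s20) -[X in X * `|_| <= _](gtr0_norm s20) -normrZ.
rewrite [z + s *: b + s *: a]addrAC in h2.
set F := f _ in h1 h2; set Fa := f (z + s *: a) in h1 h2; set Fb := f (z + s *: b) in h1 h2.
have -> : s ^+ 2 *: ('D_a (fun x => 'D_b f x) z - 'D_b (fun x => 'D_a f x) z) =
  (F - Fb - (Fa - f z) - s ^+ 2 *: 'D_b (fun x => 'D_a f x) z) -
  (F - Fa - (Fb - f z) - s ^+ 2 *: 'D_a (fun x => 'D_b f x) z) by module_eq.
rewrite (le_trans (ler_normB _ _))// (le_trans (lerD h2 h1))//.
by rewrite -mulrDl mulrC ler_wpM2l ?(ltW s20)// mulr_natr mulr2n.
Qed.

Lemma hdw_row (W : normedModType R) (D : set W) (f : 'I_n -> W -> R^o) a (L : 'I_n -> W -> R^o) :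
  (forall i, has_diff_within D (f i) a (L i)) ->
  has_diff_within D (fun w => \row_i f i w : V) a (fun w => \row_i L i w : V).
Proof.
move=> h; have hL i : islinear (L i) by case: (h i).
apply/has_diff_withinP; split=> [k u v|e e0].
  by apply/rowP => i; rewrite !mxE hL.
have /choice[d hd] : forall i : 'I_n, exists d : R, 0 < d /\ forall z, `|z - a| < d -> D z ->
    `|f i z - f i a - L i (z - a)| <= e * `|z - a|.
  by move=> i; have /has_diff_withinP[_ /(_ e e0)[d d0 hd]] := h i; exists d.
have D0 : 0 < \sum_i (d i)^-1 + 1.
  by rewrite ltr_wpDl// sumr_ge0// => i _; rewrite invr_ge0; case: (hd i) => /ltW.
exists (\sum_i (d i)^-1 + 1)^-1; first by rewrite invr_gt0.
move=> z zd Dz; apply: row_norm_le => [|i]; first by rewrite mulr_ge0// ltW.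
rewrite !mxE; have [di0 hdi] := hd i; apply: hdi => //; apply: lt_le_trans zd _.
rewrite invf_ple ?posrE// (bigD1 i)//= -addrA lerDl addr_ge0// sumr_ge0// => j _.
by rewrite invr_ge0; case: (hd j) => /ltW.
Qed.

(** The lift to cotangent bundles of a map tau, written with (an extension of)
    the inverse sig of tau. *)
Definition lift_map (tau sig : V -> V) (w : E) : E :=
  (tau w.1, \row_i pairing w.2 ('D_(delta_mx 0 i) sig (tau w.1))).

Definition lift_diff (tau sig : V -> V) (w v : E) : E :=
  ('D_(v.1) tau w.1, \row_i (pairing v.2 ('D_(delta_mx 0 i) sig (tau w.1)) +
     pairing w.2 ('D_('D_(v.1) tau w.1) (fun x => 'D_(delta_mx 0 i) sig x) (tau w.1)))).

Lemma lift_map_diff tau sig (w : E) : differentiable tau w.1 ->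
  (forall v, differentiable (fun x => 'D_v sig x) (tau w.1)) ->
  has_diff_within setT (lift_map tau sig) w (lift_diff tau sig w).
Proof.
move=> dt ds; have fE : finite_frame (E : normedModType R) by exact: _.
have ex (D : set E) (D' : set V) (f : E -> V) (a : E) : (forall y, D' y) ->
    exists2 d : R, 0 < d & forall z, `|z - a| < d -> D z -> D' (f z).
  by move=> h; exists 1.
have D1 : has_diff_within setT (fun w : E => tau w.1) w (fun v => 'D_(v.1) tau w.1).
  by apply: (hdw_comp _ _ (hdw_linear setT w (@fst_linear R n)) (differentiable_hdw setT dt)); exists 1.
apply: hdw_pair => //; apply: hdw_row => i.
have D2 : has_diff_within setT (fun w : E => 'D_(delta_mx 0 i) sig (tau w.1)) w
    (fun v => 'D_('D_(v.1) tau w.1) (fun x => 'D_(delta_mx 0 i) sig x) (tau w.1)).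
  by apply: (hdw_comp _ _ D1 (differentiable_hdw setT (ds _))); exists 1.
have D3 := hdw_pair (hdw_linear setT w (@snd_linear R n)) D2.
by apply: (hdw_comp _ _ D3 (hdw_pairing _)); exists 1.
Qed.

Definition symplectic_form (u v : E) : R := pairing v.2 u.1 - pairing u.2 v.1.

Lemma symmetric_sum (D : 'I_n -> V -> V) (a b : V) : (forall i, islinear (D i)) ->
  (forall i j, D i (delta_mx 0 j) = D j (delta_mx 0 i)) ->
  \sum_i b 0 i *: D i a = \sum_i a 0 i *: D i b.
Proof.
move=> linD sym.
have DE (a' b' : V) : \sum_i b' 0 i *: D i a' = \sum_i \sum_j (b' 0 i * a' 0 j) *: D i (delta_mx 0 j).
  apply: eq_bigr => i _; rewrite {1}(row_sum_delta a') (islinear_sum (linD i)) scaler_sumr.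
  by apply: eq_bigr => j _; rewrite (islinearZ (linD i)) scalerA.
rewrite !DE exchange_big; apply: eq_bigr => i _; apply: eq_bigr => j _.
by rewrite mulrC sym.
Qed.

Lemma symplectic_shift (u v : E) (u' v' : E) (Q : V -> V -> V) (z a b : V) :
  pairing u'.2 v'.1 = pairing u.2 v.1 + pairing z (Q a b) ->
  pairing v'.2 u'.1 = pairing v.2 u.1 + pairing z (Q b a) -> Q a b = Q b a ->
  symplectic_form u' v' = symplectic_form u v.
Proof. by rewrite /symplectic_form => -> -> ->; rewrite opprD addrACA subrr addr0. Qed.

(** The lift preserves the canonical symplectic form; this is where the symmetry
    of second derivatives enters. *)
Lemma lift_symplectic (O : set V) tau sig (w u v : E) : open O -> O (tau w.1) -> Ck 2 O sig ->
  islinear (fun v => 'D_v tau w.1) ->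
  (forall a, 'D_('D_a tau w.1) sig (tau w.1) = a) ->
  symplectic_form (lift_diff tau sig w u) (lift_diff tau sig w v) = symplectic_form u v.
Proof.
move=> oO Ow C2 linT inv; set z := tau w.1.
have dsig : islinear (fun v => 'D_v sig z).
  by have [h _] := differentiable_hdw setT (C2.1 _ Ow).
pose D (i : 'I_n) (a : V) : V := 'D_a (fun x => 'D_(delta_mx 0 i) sig x) z.
have linD i : islinear (D i).
  by have [h _] := differentiable_hdw setT ((C2.2 (delta_mx 0 i)).1 _ Ow).
have sym i j : D i (delta_mx 0 j) = D j (delta_mx 0 i).
  exact: (derive_sym _ _ (finite_frame_row n) oO Ow C2).
pose Q (a b : V) : V := \sum_i b 0 i *: D i a.
have part (x y : E) : pairing (lift_diff tau sig w x).2 (lift_diff tau sig w y).1 =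
    pairing x.2 y.1 + pairing w.2 (Q ('D_(x.1) tau w.1) ('D_(y.1) tau w.1)).
  set b := 'D_(y.1) tau w.1; set a := 'D_(x.1) tau w.1.
  have -> : pairing x.2 y.1 = pairing x.2 (\sum_i b 0 i *: 'D_(delta_mx 0 i) sig z).
    congr pairing; rewrite -[LHS]inv -/b -/z [in LHS](row_sum_delta b) (islinear_sum dsig).
    by apply: eq_bigr => i _; rewrite (islinearZ dsig).
  rewrite /Q !(islinear_sum (pairing_linearr _)) -big_split; apply: eq_bigr => i _.
  rewrite mxE !pairingZr -/a -/b -/z -[LHS]/((_ + _) * b 0 i) mulrDl.
  by rewrite [_ * b 0 i]mulrC [X in _ + X = _]mulrC.
apply: (symplectic_shift (part u v) (part v u)).
exact: symmetric_sum.
Qed.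

Lemma transition_symplectic p0 c c' : cdom c (base p0) -> cdom c' (base p0) ->
  exists (S L : E -> E) (r : R), [/\ 0 < r,
    forall p, near_state c p0 r p -> cdom c' (base p) /\ state c' p = S (state c p),
    has_diff_within setT S (state c p0) L &
    forall u v, symplectic_form (L u) (L v) = symplectic_form u v].
Proof.
move=> h1 h2; have [P [tau [d [oP Px Ct d0 ht]]]] := transition_ext h1 h2.
have [Q [sig [e [oQ Qx Cs e0 hs]]]] := transition_ext h2 h1.
have [r r0 hr] := @cmap_near_inv _ _ _ _ c (base p0) _ h1 (cmap_near h2 e0).
have [|_ _ t0 tD] := ht (base p0) h1; first by rewrite subrr normr0.
have [|_ _ s0 sD] := hs (base p0) h2; first by rewrite subrr normr0.
exists (lift_map tau sig), (lift_diff tau sig (state c p0)), (Num.min d r).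
split; first by rewrite lt_min d0.
- move=> p [hp pK].
  have : `|cmap c (base p) - cmap c (base p0)| < Num.min d r.
    by apply: le_lt_trans pK; exact: (pair_fst_le (state c p - state c p0)).
  rewrite lt_min => /andP[zd zr].
  have [k2 _ te _] := ht _ hp zd; have [_ pe] := hr _ hp zr; have [_ _ _ dS] := hs _ k2 pe.
  split=> //; rewrite /state /lift_map /= te; congr pair; apply/rowP => i; rewrite mxE.
  have Ei := congr1 (fun f => f (delta_mx 0 i)) dS; rewrite /= in Ei.
  by rewrite -[in LHS]pairing_delta (cotangent_law _ k2 hp) Ei.
- apply: lift_map_diff => [|v]; first by have [h _] := Ct 1%N; exact: h.
  by rewrite /= t0; have [_ /(_ v)[h _]] := Cs 2%N; exact: h.
- move=> u v; apply: (@lift_symplectic Q); rewrite /= ?t0//; last first.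
  + move=> x; have := transition_diff_comp x h1 h2 h1.
    by rewrite transition_diff_id// tD sD.
  + by have [h _] := Ct 1%N; have [] := differentiable_hdw setT (h _ Px).
  + exact: (Cs 2%N).
Qed.

Lemma symplectic_nondegenerate (u v : E) :
  (forall w, symplectic_form u w = symplectic_form v w) -> u = v.
Proof.
have form0 (x : E) a b : symplectic_form x (a, b) = pairing b x.1 - pairing x.2 a by [].
move=> h; rewrite [u]surjective_pairing [v]surjective_pairing; congr pair; last first.
  apply: pairing_inj => a; have := h (a, 0); rewrite !form0.
  by rewrite !(islinear0 (pairing_linearl _) : pairing 0 _ = 0) !sub0r => /oppr_inj.
apply/rowP => i; have := h (0, delta_mx 0 i); rewrite !form0 !pairing0r !subr0.
have E1 (x : V) : pairing (delta_mx 0 i) x = pairing x (delta_mx 0 i).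
  by apply: eq_bigr => j _; exact: mulrC.
by rewrite !E1 !pairing_delta.
Qed.

(** The Hamiltonian field is determined by the energy and the symplectic form, and
    changes of coordinates preserve both. *)
Lemma bichar_chart_change (H : cotangent A -> R) (hH : hamiltonian_conditions H) c c'
    (a b t : R) g (r : R) : cdom c (base (g t)) -> cdom c' (base (g t)) -> nonzero (g t) -> 0 < r ->
  (forall s, a <= s <= b -> `|s - t| < r -> cdom c (base (g s))) ->
  @has_diff_within R R^o E `[a, b] (state c \o g) t
      (fun s => s *: (H_xi H c (g t), - H_x H c (g t))) ->
  @has_diff_within R R^o E `[a, b] (state c' \o g) t
      (fun s => s *: (H_xi H c' (g t), - H_x H c' (g t))).
Proof.
move=> h1 h2 n0 r0 gc Dg; set p := g t in h1 h2 n0 *.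
have fE : finite_frame (E : normedModType R) by exact: _.
have [S [L [r1 [r10 hS DS wL]]]] := transition_symplectic h1 h2.
have [S' [L' [r2 [r20 hS' DS' wL']]]] := transition_symplectic h2 h1.
have near0 : near_state c p r1 p by split=> //; rewrite subrr normr0.
have near0' : near_state c' p r2 p by split=> //; rewrite subrr normr0.
have [_ S0] := hS p near0; have [_ S'0] := hS' p near0'.
have linL : islinear L by case: DS.
set v : E := (H_xi H c p, - H_x H c p) in Dg.
set v' : E := (H_xi H c' p, - H_x H c' p).
have LL : L' \o L = id.
  apply: (hdw_unique (accessible_phase h1 n0) _ (hdw_linear (L := idfun) _ _ _)) => //.
  have DS1 := hdw_sub (@subsetT _ (phase_image c)) DS.
  rewrite S0 in DS'.
  have D := hdw_comp fE fE DS1 DS' (ex_intro2 _ _ 1 ltr01 (fun _ _ _ => I)).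
  have [C [e [C0 e0 hC]]] := hdw_bound fE DS.
  apply: (@hdw_local _ _ _ _ _ _ _ _ _ (Num.min r1 (Num.min e (r2 / C))) _ _ _ D).
  - by rewrite !lt_min r10 e0 divr_gt0.
  - move=> z; rewrite !lt_min => /and3P[z1 ze z2] iz; split=> //.
    have [q [qc _ zE]] := phase_imageP iz; rewrite zE in z1 ze z2 *.
    have [qc' qE] := hS q (conj qc z1); rewrite /= -qE.
    have [|_ <-//] := hS' q; split=> //; rewrite qE S0.
    by rewrite (le_lt_trans (hC _ ze I))// mulrC -ltr_pdivlMr.
  - by rewrite /= -S0 -S'0.
have dHE : dHchart H c' p = dHchart H c p \o L'.
  apply: (hdw_unique (accessible_phase h2 n0) (dHchartP hH h2 n0)).
  have := dHchartP hH h1 n0; rewrite S'0 => D1.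
  have [C [e [C0 e0 hC]]] := hdw_bound fE DS'.
  have key z : `|z - state c' p| < r2 -> phase_image c' z ->
      phase_image c (S' z) /\ Hchart H c (S' z) = Hchart H c' z.
    move=> z2 iz; have [q [qc qn zE]] := phase_imageP iz; rewrite zE in z2 *.
    have [qc' <-] := hS' q (conj qc z2); split; first exact: phase_image_state.
    by rewrite !Hchart_state.
  have DS1 := hdw_sub (@subsetT _ (phase_image c')) DS'.
  have D := hdw_comp fE fE DS1 D1 (ex_intro2 _ _ r2 r20 (fun z zr iz => (key z zr iz).1)).
  apply: (hdw_local r20 _ _ D) => [z zr iz|]; first by have [] := key z zr iz.
  by have [] := key (state c' p) ltac:(by rewrite subrr normr0) (phase_image_state h2 n0).
have formH c1 (w : E) : cdom c1 (base p) ->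
    symplectic_form (H_xi H c1 p, - H_x H c1 p) w = dHchart H c1 p w.
  move=> hc1; rewrite [w]surjective_pairing (dHchart_split hH _ _ hc1 n0) /symplectic_form /=.
  rewrite pairingNl opprK addrC; congr (_ + _).
  by apply: eq_bigr => j _; exact: mulrC.
have vE : L v = v'.
  apply: symplectic_nondegenerate => w.
  rewrite formH// dHE /= -formH// -/v -[in RHS](congr1 (fun f => f v) LL) /=.
  by rewrite wL'.
have [C [e [C0 e0 hC]]] := hdw_bound finite_frame_R Dg.
have D1 := hdw_comp finite_frame_R fE Dg DS (ex_intro2 _ _ 1 ltr01 (fun _ _ _ => I)).
have -> : (fun s : R^o => s *: v') = L \o (fun s : R^o => s *: v).
  by apply/funext => s; rewrite /= (islinearZ linL) vE.
apply: (@hdw_local _ _ _ _ _ _ _ _ _ (Num.min r (Num.min e (r1 / C))) _ _ _ D1).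
- by rewrite !lt_min r0 e0 divr_gt0.
- move=> s; rewrite !lt_min => /and3P[sr se s1] sab; split=> //=.
  have [|_ ->//] := hS (g s); split; first by apply: gc => //; move: sab; rewrite /= in_itv.
  by rewrite (le_lt_trans (hC _ se sab))// mulrC -ltr_pdivlMr.
- by rewrite /= -/p -S0.
Qed.

End symplectic.

(** * Short bicharacteristics near the boundary *)

Section existence.
Context {R : realType} {n : nat} {M : topologicalType} {A : smooth_manifold R n M}
  (H : cotangent A -> R).
Hypothesis hH : hamiltonian_conditions H.
Local Notation V := 'rV[R]_n.
Local Notation E := (V * V)%type.
Implicit Types (c d : chart A) (p q : cotangent A) (g : R -> cotangent A).

Lemma smooth_function_ext (f : M -> R) c x : smooth_function A f -> cdom c x ->
  exists (P : set V) (h : V -> R^o) (r : R), [/\ open P, P (cmap c x), (forall k, Ck k P h), 0 < r &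
    forall y, cdom c y -> `|cmap c y - cmap c x| < r ->
      @has_diff_within R V R^o (chart_image c) (f \o cinv c) (cmap c y) (fun v => 'D_v h (cmap c y))].
Proof.
move=> sm hc; have [P [h [oP Px Ch Eh]]] := sm c _ (chart_image_map hc).
have [C1 _] := Ch 1%N.
have /near_normP[r r0 hr] : nbhs (cmap c x) P by exact: open_nbhs_nbhs.
exists P, h, r; split=> // y yc yr; have Py := hr _ yr.
have /near_normP[e e0 he] : nbhs (cmap c y) P by exact: open_nbhs_nbhs.
apply: (hdw_local e0 _ _ (differentiable_hdw setT (C1 _ Py))).
  by move=> z ze iz; split=> //; rewrite -Eh// inE; split=> //; exact: he.
by rewrite -Eh// inE; split=> //; exact: chart_image_map.
Qed.

(** rho vanishes on the boundary, so its differential kills the tangent vectors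
    of the boundary. *)
Lemma drho_Hxi_neq0 rho c p : boundary_defining A rho -> boundary A (base p) ->
  cdom c (base p) -> drho_Hxi H rho c p != 0 -> coord0 (H_xi H c p) != 0.
Proof.
move=> [sm rho0 _ _] bp hc; apply: contra => /eqP v0; set z := cmap c (base p).
have z0 : coord0 z = 0 by exact: boundary_chart.
have [P [f [r [_ _ _ r0 D]]]] := smooth_function_ext sm hc.
have {}D := D (base p) hc ltac:(by rewrite subrr normr0).
rewrite /drho_Hxi (diff_withinE (accessible_image hc) D).
have [lin _] := D; set v := H_xi H c p in v0 *.
have [d d0 hd] := chart_image_near hc.
have zero (s : R) : `|s *: v| < d -> rho (cinv c (z + s *: v)) = 0.
  move=> sd; have c0 : coord0 (z + s *: v) = 0.
    by rewrite (islinearD coord0_linear) (islinearZ coord0_linear) v0 z0 add0r scaler0.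
  have iz : chart_image c (z + s *: v).
    by apply: hd; rewrite ?c0// addrAC subrr add0r.
  by have [cz zE] := cinvK iz; apply: rho0; exists c; rewrite ?zE.
apply/eqP/(@small_norm_eq0 _ R^o _ `|v|) => // e e0.
have /has_diff_withinP[_ /(_ e e0)[d' d'0 hd']] := D.
have v1 : 0 < `|v| + 1 by rewrite ltr_wpDl.
have m0 : 0 < Num.min d d' by rewrite lt_min d0.
have [s s0 sv] : exists2 s : R, 0 < s & `|s *: v| < Num.min d d'.
  exists (Num.min d d' / (`|v| + 1)); first by rewrite divr_gt0.
  by rewrite normrZ gtr0_norm ?divr_gt0// mulrAC ltr_pdivrMr// ltr_pM2l// ltrDl.
move: sv; rewrite lt_min => /andP[svd svd'].
have := hd' (z + s *: v); rewrite [z + _]addrC addrK => /(_ svd').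
rewrite [_ + z]addrC /=; have iz : chart_image c (z + s *: v).
  apply: hd; rewrite ?[z + _]addrC ?addrK// (islinearD coord0_linear) (islinearZ coord0_linear) v0 z0.
  by rewrite scaler0 add0r.
move=> /(_ iz); rewrite zero// cmapK// rho0// subrr sub0r (islinearZ lin) normrN !normrZ.
by rewrite (gtr0_norm s0) mulrCA ler_pM2l.
Qed.

(** Since coord0 is nonnegative on M, it can only increase from a boundary point
    where the bicharacteristic starts, and decrease to one where it ends. *)
Lemma bichar_boundary (a b t : R) g c (k : R) : bicharacteristic H a b g -> a < b -> a <= t <= b ->
  cdom c (base (g t)) -> coord0 (cmap c (base (g t))) = 0 ->
  (k = 1 /\ t = a) \/ (k = -1 /\ t = b) ->
  0 <= k * coord0 (H_xi H c (g t)).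
Proof.
move=> hg ab tab hc z0 kt; apply/ler_addgt0Pr => e e0.
have [_ Dg] := bichar_at hg tab hc.
have /has_diff_withinP[_ /(_ e e0)[d d0 hd]] := Dg.
have [d' d'0 hd'] := bichar_near hg tab (open_nbhs_nbhs (conj (@cdom_open _ _ _ A c) hc)).
pose h : R := Num.min (b - a) (Num.min d d' / 2).
have ba : 0 < b - a by rewrite subr_gt0.
have m0 : 0 < Num.min d d' by rewrite lt_min d0.
have h0 : 0 < h by rewrite lt_min ba divr_gt0.
have hb : h <= b - a by rewrite ge_min lexx.
have hm : h < Num.min d d'.
  by rewrite gt_min; apply/orP; right; rewrite ltr_pdivrMr// ltr_pMr// ltr1n.
move: hm; rewrite lt_min => /andP[hmd hmd'].
pose s := t + k * h.
have kk : k * k = 1 /\ `|k| = 1.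
  by case: kt => -[-> _]; rewrite ?mulrNN ?mulr1 ?normrN ?normr1.
have sab : a <= s <= b.
  by rewrite /s; case: kt => -[-> ->]; apply/andP; split; lra.
have st : `|s - t| = h by rewrite /s addrC addKr normrM kk.2 mul1r gtr0_norm.
have := hd s; rewrite st /= in_itv /= => /(_ hmd sab) h1.
have cs : cdom c (base (g s)) by apply: hd' => //; rewrite st.
have := le_trans (pair_fst_le _) h1; rewrite /=.
set v := H_xi H c (g t); move=> h2.
have := le_trans (coord0_bound _) h2.
rewrite !(islinearB coord0_linear) (islinearZ coord0_linear) z0 subr0.
rewrite (_ : s - t = k * h); last by rewrite /s addrC addKr.
move=> h3.
have s0 := chart_coord0_ge0 (chart_image_map cs).
have {h3} : coord0 (cmap c (base (g s))) - k * h * coord0 v <= e * h.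
  by apply: le_trans h3; exact: ler_norm.
move: kk => [kk _] => h4.
have : 0 <= h * (k * coord0 v + e) by lra.
by rewrite pmulr_rge0.
Qed.

(** The factor coord0 (X w0).1 gives the direction: when it does not vanish, the
    derivative of coord0 along integral curves near w0 has its sign. *)
Lemma coord0_monotone (X : E -> E) w0 : tame X w0 -> exists2 r : R, 0 < r &
  forall (u : R -> E) a b, deriv_on a b u (X \o u) ->
    (forall t, a <= t <= b -> `|u t - w0| < r) ->
    forall s t, a <= s -> s <= t -> t <= b ->
    0 <= coord0 (X w0).1 * (coord0 (u t).1 - coord0 (u s).1).
Proof.
move=> tX; set k := coord0 (X w0).1.
have [k0|k0] := eqVneq k 0; first by exists 1 => // *; rewrite k0 mul0r.
have kp : 0 < `|k| by rewrite normr_gt0.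
have [r r0 hr] := tame_near tX erefl kp.
exists r => // u a b Du near s t sa st tb.
have tab : a <= t <= b by rewrite (le_trans sa).
have sab : a <= s <= b by rewrite sa (le_trans st).
have := mean_value_affine (c := X w0) Du tab sab (K := `|k|).
move=> /(_ _) h1; have {h1} : `|u t - u s - (t - s) *: X w0| <= `|k| * `|t - s|.
  by apply: h1 => r' rab _; apply/ltW/(hr (u r') _ _ erefl)/near.
rewrite [`|t - s|]ger0_norm ?subr_ge0// => h2.
have := le_trans (coord0_bound _) (le_trans (pair_fst_le _) h2); rewrite /=.
rewrite !(islinearB coord0_linear) (islinearZ coord0_linear) -/k -[_ *: _]/(_ * _).
set D := _ - coord0 (u s).1; move=> /ler_normlP[h3 h4].
have ts : 0 <= t - s by rewrite subr_ge0.
by case: (ltrgt0P k) k0 h3 h4 => // kk _ h3 h4; [apply: mulr_ge0|apply: mulr_le0]; nra.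
Qed.

(** Integral curves of the field of one chart are bicharacteristics: the
    equation in the other charts follows by symplectic invariance. *)
Lemma bichar_of_curve c p0 : cdom c (base p0) -> nonzero p0 ->
  exists (X : E -> E) (r : R), [/\ 0 < r, tame X (state c p0),
    forall p, near_state c p0 r p -> (H_xi H c p, - H_x H c p) = X (state c p) &
    forall (u : R -> E) a b, deriv_on a b u (X \o u) ->
      (forall t, a <= t <= b -> `|u t - state c p0| < r /\ 0 <= coord0 (u t).1) ->
      exists2 g, bicharacteristic H a b g &
        forall t, a <= t <= b -> cdom c (base (g t)) /\ state c (g t) = u t].
Proof.
move=> hc n0; have [h [X [K [HK tX hK]]]] := hamiltonian_field hH hc n0.
have K0 : 0 < K := HK.1; have [d d0 hd] := chart_image_near hc.
exists X, (Num.min K^-1 d); rewrite lt_min invr_gt0 K0 d0; split=> //.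
  move=> p [pc]; rewrite lt_min => /andP[pK _].
  by have [|_ _ _ ->] := hK p; split.
move=> u a b Du near.
pose g t := cotangent_at c (u t).1 (u t).2.
have gE t : a <= t <= b -> [/\ cdom c (base (g t)), state c (g t) = u t & near_state c p0 K^-1 (g t)].
  move=> tab; have [] := near t tab; rewrite lt_min => /andP[uK ud] u0.
  have iz : chart_image c (u t).1.
    by apply: hd => //; apply: le_lt_trans ud; exact: (pair_fst_le (u t - state c p0)).
  have [cz zE] := cinvK iz.
  have [bE cE] := cotangent_at_map (u t).2 cz; rewrite zE in bE cE.
  have gc : cdom c (base (g t)) by rewrite /g bE.
  have sE : state c (g t) = u t by rewrite /state /g cE bE zE -surjective_pairing.
  by split=> //; split=> //; rewrite sE.
exists g; last by move=> t /gE[].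
apply: bichar_intro => [t tab U hU|t tab].
  have [gc sE _] := gE t tab.
  have [e e0 he] := cmap_near_inv gc hU.
  have [e' e'0 he'] := deriv_on_continuous Du tab e0.
  exists e' => // s sab st; have [gc' sE' _] := gE s sab; apply: he => //.
  apply: le_lt_trans (he' s sab st); rewrite -sE -sE'.
  exact: (pair_fst_le (state c (g s) - state c (g t))).
have [gc sE gK] := gE t tab; have [gn _ _ XE] := hK _ gK.
split=> // c' hc'.
apply: (@bichar_chart_change _ _ _ _ H hH c c' a b t g 1) => //.
  by move=> s sab _; have [] := gE s sab.
have /deriv_onP/(_ t tab) := Du; rewrite /= -sE -XE.
apply: (@hdw_local _ _ _ _ _ _ _ _ _ 1) => // s _ sab; split=> //=.
by have [_ -> _] := gE s sab.
Qed.

(** Interior or inward-pointing covectors, from which bicharacteristics can start. *)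
Definition startable c p : Prop :=
  0 < coord0 (cmap c (base p)) \/ 0 < coord0 (H_xi H c p).

(** Integral curves near an interior point keep a positive first coordinate, and it
    increases along those near an inward-pointing covector. *)
Lemma short_flow_exists c p1 : cdom c (base p1) -> nonzero p1 -> startable c p1 ->
  exists rho : R, 0 < rho /\ forall p (sig : R), near_state c p1 rho p -> 0 <= sig <= rho ->
    exists q, flow H sig p q.
Proof.
move=> hc n1 st; have [X [r [r0 tX XE hX]]] := bichar_of_curve hc n1.
have [r1 r10 hr1] := coord0_monotone tX.
have X1 : (X (state c p1)).1 = H_xi H c p1.
  by rewrite -XE//; split=> //; rewrite subrr normr0.
pose m : R := if 0 < coord0 (cmap c (base p1)) then coord0 (cmap c (base p1)) else 1.
have m0 : 0 < m by rewrite /m; case: ifP.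
have mn : 0 < Num.min r (Num.min r1 m) by rewrite !lt_min r0 r10.
have [rho [tau [rho0 tau0 ex]]] := integral_curve_exists _ tX mn.
exists (Num.min rho tau); split=> [|p sig [pc]]; first by rewrite lt_min rho0.
rewrite lt_min => /andP[prho _] /andP[s0]; rewrite le_min => /andP[_ stau].
have [|u [u0 Du near]] := ex 0 sig _ _ prho; first by rewrite s0 add0r.
have pos t : 0 <= t <= sig -> 0 <= coord0 (u t).1.
  move=> tb; have := near t tb; rewrite !lt_min => /and3P[_ _ um].
  have cp := chart_coord0_ge0 (chart_image_map pc).
  have [z0|z0] := boolP (0 < coord0 (cmap c (base p1))).
    rewrite /m z0 in um; have := le_lt_trans (le_trans (coord0_bound _) (pair_fst_le _)) um.
    by rewrite (islinearB coord0_linear) /= => /ltr_normlP[]; lra.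
  case: st => [|st]; first by rewrite (negPf z0).
  have /andP[t0 tsig] := tb.
  have := hr1 u 0 sig Du _ 0 t (lexx _) t0 tsig; rewrite X1 pmulr_rge0// u0 /= subr_ge0 => h1.
  apply: le_trans cp (h1 _) => t' /near; rewrite !lt_min => /and3P[_ ? _] //.
have [t tb|g hg gE] := hX u 0 sig Du.
  by split; [move: (near t tb); rewrite lt_min => /andP[]|exact: pos].
have b0 : 0 <= (0 : R) <= sig by rewrite lexx.
have [g0c g0] := gE 0 b0.
exists (g sig); apply/flowP => //; exists g; split=> //.
by apply: (state_inj g0c pc); rewrite g0 u0.
Qed.

End existence.

(** * Bicharacteristics between given points *)

Section exponential.
Context {R : realType} {n : nat} {M : topologicalType} {A : smooth_manifold R n M}
  (H : cotangent A -> R).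
Hypothesis hH : hamiltonian_conditions H.
Local Notation V := 'rV[R]_n.
Local Notation E := (V * V)%type.
Implicit Types (c d : chart A) (p q : cotangent A) (g : R -> cotangent A).

(** Real induction: short flows are appended to flows that are already known to be
    defined near g 0. *)
Lemma flow_exists_near c g (b : R) : bicharacteristic H 0 b g -> cdom c (base (g 0)) ->
  (forall t, 0 <= t <= b -> exists2 d, cdom d (base (g t)) & startable H d (g t)) ->
  forall t, 0 <= t <= b -> exists rho : R, 0 < rho /\
    forall p, near_state c (g 0) rho p -> exists q, flow H t p q.
Proof.
move=> hg gc st.
have nz t : 0 <= t <= b -> nonzero (g t).
  by move=> tb; have [d hd _] := st t tb; have [] := bichar_at hg tb hd.
have fl t : 0 <= t <= b -> flow H t (g 0) (g t).
  by move=> /andP[t0 tb]; have := bichar_flow hH hg (lexx 0) t0 tb; rewrite subr0.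
have step s t d (r1 : R) : 0 <= s <= b -> 0 <= t -> 0 < r1 ->
    (forall p (sig : R), near_state d (g s) r1 p -> 0 <= sig <= r1 -> exists q, flow H sig p q) ->
    (exists rho : R, 0 < rho /\ forall p, near_state c (g 0) rho p -> exists q, flow H s p q) ->
    cdom d (base (g s)) -> s <= t <= s + r1 ->
    exists rho : R, 0 < rho /\ forall p, near_state c (g 0) rho p -> exists q, flow H t p q.
  move=> sb t0 r10 hr1 [rho [rho0 hrho]] ds /andP[st1 tr1].
  have s0 : 0 <= s by case/andP: sb.
  have tF := flow_tame hH s0 (fl s sb) gc ds.
  have [rho' [rho'0 hrho']] := evolution_near tF gc (fl s sb) r10.
  exists (Num.min rho rho'); rewrite lt_min rho0; split=> // p [pc].
  rewrite lt_min => /andP[p1 p2].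
  have [q Fq] := hrho p (conj pc p1); have nq := hrho' p q (conj pc p2) Fq.
  have [|q' Fq'] := hr1 q (t - s) nq; first by rewrite subr_ge0 st1 lerBlDl.
  exists q'; rewrite -(subrK s t) addrC; apply: flow_cat Fq Fq' => //.
  by rewrite subr_ge0.
apply: real_induction => t tb IH.
  have [-> | t0] := eqVneq t 0.
    have b0 : 0 <= (0 : R) <= b by rewrite lexx /=; case/andP: tb => /le_trans h /h.
    have [d d0 hd] := nonzero_near gc (nz _ b0).
    exists d; split=> // p [pc pd]; exists p; apply: flow_refl.
    exact/(nonzero_comp pc)/(hd _ pd).
  have tp : 0 < t by rewrite lt_neqAle eq_sym t0; case/andP: tb.
  have [d td sd] := st t tb.
  have [r1 [r10 hr1]] := short_flow_exists hH td (nz t tb) sd.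
  have r20 : 0 < r1 / 2 by rewrite divr_gt0.
  have tpb : 0 < t <= b by rewrite tp; case/andP: tb.
  have [s [s0 ss sr1 [ds h1]]] := bichar_near_left hg tpb td r20.
  have sb : 0 <= s <= b by rewrite s0 (le_trans (ltW ss))//; case/andP: tb.
  have IHs := IH s ltac:(by rewrite s0).
  apply: (step s t d (r1 / 2) sb (ltW tp) r20 _ IHs ds _).
    move=> p sig [pc pr] /andP[g0 gr]; apply: hr1; last first.
      by rewrite g0 (le_trans gr)// ler_pdivrMr// ler_pMr// ler1n.
    split=> //; rewrite (_ : state d p - _ = (state d p - state d (g s)) + (state d (g s) - state d (g t)));
      last by module_eq.
    by rewrite (le_lt_trans (ler_normD _ _))// [ltRHS](splitr r1) ltrD.
  by rewrite (ltW ss) -lerBlDl ltW.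
have [d td sd] := st t ltac:(by case/andP: tb => -> /ltW).
have tb' : 0 <= t <= b by case/andP: tb => -> /ltW.
have [r1 [r10 hr1]] := short_flow_exists hH td (nz t tb') sd.
exists r1 => // s /andP[ts tr] sb.
have t0 : 0 <= t by case/andP: tb.
apply: (step t s d r1) => //; first exact: le_trans (ltW ts).
  by apply: IH; rewrite t0 lexx.
by rewrite (ltW ts) ltW.
Qed.

(** The time-one flow near g 0, prolonged past the boundary by integral curves of
    an extension of the field in the last chart, so that it is defined for all
    covectors near g 0.  When the point reached by the prolonged flow lies in M,
    transversality shows that the boundary was not crossed on the way. *)
Lemma extended_flow c d g : bicharacteristic H 0 1 g ->
  cdom c (base (g 0)) -> cdom d (base (g 1)) ->
  (forall t, 0 <= t < 1 -> exists2 d, cdom d (base (g t)) & startable H d (g t)) ->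
  0 < coord0 (cmap d (base (g 1))) \/ coord0 (H_xi H d (g 1)) < 0 ->
  exists (P : E -> V -> Prop) (r : R), [/\ 0 < r, tame_rel P (state c (g 0)),
    forall p, near_state c (g 0) r p -> exists y, P (state c p) y,
    forall p q, near_state c (g 0) r p -> flow H 1 p q -> P (state c p) (cmap d (base q)) &
    forall p y, near_state c (g 0) r p -> cdom d y -> P (state c p) (cmap d y) ->
      exists2 q, flow H 1 p q & base q = y].
Proof.
move=> hg gc gd st stop.
have i1 : 0 <= (1 : R) <= 1 by rewrite ler01 lexx.
have n1 : nonzero (g 1) by have [] := bichar_at hg i1 gd.
have [X [r0 [r00 tX XE hX]]] := bichar_of_curve hH gd n1.
have [r1 r10 hr1] := coord0_monotone tX.
have X1 : (X (state d (g 1))).1 = H_xi H d (g 1).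
  by rewrite -XE//; split=> //; rewrite subrr normr0.
pose m : R := if 0 < coord0 (cmap d (base (g 1))) then coord0 (cmap d (base (g 1))) else 1.
have m0 : 0 < m by rewrite /m; case: ifP.
have [r3 [tau3 [r30 tau30 [K [K0 hK]]]]] := integral_curves_tame tX.
pose r2 := Num.min (Num.min r0 r1) (Num.min m r3).
have r20 : 0 < r2 by rewrite !lt_min r00 r10 m0.
have [rho1 [tau1 [rho10 tau10 ex]]] := integral_curve_exists _ tX r20.
have [rho4 [rho40 stays]] := bichar_stays hH gd n1 r20.
pose k := Num.min (Num.min tau1 tau3) (Num.min rho1 rho4).
have k0 : 0 < k by rewrite !lt_min tau10 tau30 rho10.
have k20 : 0 < k / 2 by rewrite divr_gt0.
have i01 : 0 < (1 : R) <= 1 by rewrite ltr01 lexx.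
have [s [s0 s1 sk [ds gs]]] := bichar_near_left hg i01 gd k20.
have kk : k / 2 <= k by rewrite ler_pdivrMr// ler_pMr// ler1n.
have ek := le_trans (ltW sk) kk; pose eps := 1 - s; rewrite -/eps in sk ek.
have e0 : 0 <= eps by rewrite subr_ge0 ltW.
have sE : s + eps = 1 by rewrite addrC subrK.
have ebb : 0 <= (0 : R) <= eps by rewrite lexx.
move: ek; rewrite !le_min => /andP[/andP[et1 et3] /andP[_ e4]].
have sb : 0 <= s <= 1 by rewrite s0 ltW.
have Fs : flow H s (g 0) (g s) by have := bichar_flow hH hg (lexx 0) s0 (ltW s1); rewrite subr0.
have tF := flow_tame hH s0 Fs gc ds.
have [rho' [rho'0 near1]] := evolution_near tF gc Fs k20.
have hgs : bicharacteristic H 0 s g by exact: bichar_sub (lexx _) (ltW s1) hg.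
have [rho'' [rho''0 ext]] := flow_exists_near hgs gc
  (fun t tb => st t ltac:(by case/andP: tb => -> /le_lt_trans /(_ s1))) (t := s)
  ltac:(by rewrite s0 lexx).
have near2 p q : near_state c (g 0) rho' p -> flow H s p q -> near_state d (g 1) k q.
  move=> np /(near1 p q np)[qd qs]; split=> //.
  rewrite (_ : state d q - _ = (state d q - state d (g s)) + (state d (g s) - state d (g 1)));
    last by module_eq.
  by rewrite (le_lt_trans (ler_normD _ _))// [ltRHS](splitr k) ltrD.
(* the last part of the prolonged flow, over the time eps, in the chart d *)
pose Q (w : E) (y : V) := exists u : R -> E, [/\ u 0 = w, deriv_on 0 eps u (X \o u),
  forall t, 0 <= t <= eps -> `|u t - state d (g 1)| < r2 & y = (u eps).1].
have tQ : tame_rel Q (state d (g s)).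
  exists K; split=> // w1 w2 w3 w4 y1 y2 y3 y4 _ _ _ _.
  move=> [u1 [<- D1 b1 ->]] [u2 [<- D2 b2 ->]] [u3 [<- D3 b3 ->]] [u4 [<- D4 b4 ->]].
  apply: le_trans (hK 0 eps _ u1 u2 u3 u4 _ eps _); last by rewrite e0 lexx.
  - exact: (pair_fst_le (u1 eps - u2 eps - (u3 eps - u4 eps))).
  - by rewrite e0 add0r.
  - have r23 t (u : R -> E) : `|u t - state d (g 1)| < r2 -> `|u t - state d (g 1)| < r3.
      by rewrite !lt_min => /andP[_ /andP[]].
    have good u : deriv_on 0 eps u (X \o u) ->
        (forall t, 0 <= t <= eps -> `|u t - state d (g 1)| < r2) ->
        deriv_on 0 eps u (X \o u) /\ forall t, 0 <= t <= eps -> `|u t - state d (g 1)| < r3.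
      by move=> Du bu; split=> // t tb; exact: r23 (bu t tb).
    move=> u [->|[->|[->|->]]]; [exact: good D1 b1|exact: good D2 b2|exact: good D3 b3|].
    exact: good D4 b4.
have P0 : chart_rel c d (flow H s) (state c (g 0)) (state d (g s)) by exists (g 0), (g s).
exists (fun w z => exists2 y, chart_rel c d (flow H s) w y & Q y z), (Num.min rho' rho'').
have nr p : near_state c (g 0) (Num.min rho' rho'') p ->
    near_state c (g 0) rho' p /\ near_state c (g 0) rho'' p.
  by case=> pc; rewrite lt_min => /andP[? ?].
split; first by rewrite lt_min rho'0.
- by have [tF1 _] := tF; exact: tame_rel_comp tF1 tQ P0.
- move=> p /nr[np1 np2]; have [q Fq] := ext p np2.
  have [qd] := near2 p q np1 Fq; rewrite !lt_min => /andP[_ /andP[qr _]].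
  have [|u [u0 Du near]] := ex 0 eps _ _ qr; first by rewrite e0 add0r.
  exists (u eps).1; exists (state d q); last by exists u.
  by exists p, q; split=> //; case: np1.
- move=> p q /nr[np1 _]; rewrite -sE => /(flow_split hH s0 e0)[q1 Fq1 /(flowP _ _ _ e0)[g1 [hg1 g10 g1e]]].
  have [q1d] := near2 p q1 np1 Fq1; rewrite !lt_min => /andP[_ /andP[_ q14]].
  have nn t : 0 <= t <= eps -> near_state d (g 1) r2 (g1 t).
    by apply: (stays g1 eps) => //; rewrite ?e0// g10.
  exists (state d q1); first by exists p, q1; split=> //; case: np1.
  exists (state d \o g1); split=> //=; [by rewrite g10| |by move=> t /nn[]|by rewrite g1e].
  apply: deriv_on_ext (bichar_deriv (lexx _) (lexx _) hg1 (fun t tb => (nn t tb).1)).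
  move=> t /nn[td]; rewrite !lt_min => /andP[/andP[t0 _] _]; split=> //=.
  by rewrite XE.
- move=> p y /nr[np1 _] yd [w [p' [q [p'c Fq pE ->]]] [u [u0 Du near yE]]].
  have pc : cdom c (base p) by case: np1.
  have {pE} pE := state_inj p'c pc (esym pE); rewrite {p' p'c}pE in Fq.
  have [qd _] := near2 p q np1 Fq.
  have pos t : 0 <= t <= eps -> 0 <= coord0 (u t).1.
    move=> tb; have := near t tb; rewrite !lt_min => /andP[_ /andP[um _]].
    have [z0|z0] := boolP (0 < coord0 (cmap d (base (g 1)))).
      rewrite /m z0 in um; have := le_lt_trans (le_trans (coord0_bound _) (pair_fst_le _)) um.
      by rewrite (islinearB coord0_linear) /= => /ltr_normlP[]; lra.
    case: stop => [|stop]; first by rewrite (negPf z0).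
    have /andP[t0 te] := tb.
    have := hr1 u 0 eps Du _ t eps t0 te (lexx _); rewrite X1 nmulr_rge0// -yE subr_le0 => h1.
    apply: le_trans (chart_coord0_ge0 (chart_image_map yd)) (h1 _) => t' /near.
    by rewrite !lt_min => /andP[/andP[_ ?] _].
  have [t tb|g' hg' gE] := hX u 0 eps Du.
    by split; [move: (near t tb); rewrite !lt_min => /andP[/andP[]]|exact: pos].
  have [g0d g0] := gE 0 ebb; have [ged ge] := gE eps ltac:(by rewrite e0 lexx).
  have g0E : g' 0 = q by apply: (state_inj g0d qd); rewrite g0 u0.
  exists (g' eps).
    rewrite -sE; apply: flow_cat Fq _ => //; apply/flowP => //; exists g'; split=> //.
  by rewrite -(cmapK ged) -(cmapK yd) yE -ge.
Qed.

(** Successive approximations are retracted onto the ball; the value of f at their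
    limit lies in the ball already, so that the retraction fixes it. *)
Lemma contraction_fixpoint (W : normedModType R) (f : W -> W) w0 (r : R) : picard_space W -> 0 < r ->
  (forall x y, `|x - w0| <= r -> `|y - w0| <= r -> `|f x - f y| <= 1 / 2 * `|x - y|) ->
  `|f w0 - w0| <= r / 2 -> exists2 x, `|x - w0| <= r & f x = x.
Proof.
move=> [complete _ retract] r0 hf f0; have [k [kr k1 kid]] := retract w0 r r0.
pose u := fix u i := if i is j.+1 then k (f (u j)) else w0.
have r00 : 0 <= r by exact: ltW.
have ur i : `|u i - w0| <= r by case: i => [|i]; rewrite /= ?subrr ?normr0.
have step i : `|u i.+1 - u i| <= r / 2 ^+ i.
  elim: i => [|i IH]; first by rewrite expr0 divr1; exact: (ur 1%N).
  apply: le_trans (k1 (f (u i.+1)) (f (u i))) (le_trans (hf _ _ (ur _) (ur _)) _).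
  by rewrite exprS invfM [_^-1 * _]mulrC mulrA -[leRHS]mulrC div1r ler_pM2l.
have [l hl] := complete u r step.
have cv e : 0 < e -> exists i, `|u i - l| <= e.
  by move=> e0; have [i hi] := pow2_small (2 * r) e0; exists i; rewrite (le_trans (hl i)).
have lr : `|l - w0| <= r.
  apply/ler_addgt0Pr => e e0; have [i hi] := cv e e0.
  rewrite -(subrKA (u i)) (le_trans (ler_normD _ _))// addrC lerD//.
  by rewrite distrC.
have fl : `|f l - w0| <= r.
  rewrite -(subrKA (f w0)) (le_trans (ler_normD _ _))// [leRHS](splitr r) lerD//.
  rewrite (le_trans (hf _ _ lr _)) ?subrr ?normr0// mulrC mulrA mulr1.
  by rewrite ler_pM2r// invr_gt0.
exists l => //; rewrite -(kid _ fl); apply/eqP; rewrite -subr_eq0; apply/eqP.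
apply: (@small_norm_eq0 _ _ _ (2 : R)) => // e e0; have [i hi] := pow2_small (2 * r) e0.
rewrite -(subrKA (u i.+1)) (le_trans (ler_normD _ _))// mulr_natr mulr2n lerD//.
  rewrite distrC /= (le_trans (k1 _ _))// (le_trans (hf _ _ (ur _) lr))//.
  by rewrite (le_trans _ (le_trans (hl i) hi))// ler_piMl// ler_pdivrMr// mul1r ler1n.
rewrite (le_trans (hl i.+1))// (le_trans _ hi)// ler_pM2l ?mulr_gt0//.
by rewrite lef_pV2 ?posrE ?exprn_gt0// ler_eXn2l// ltr1n.
Qed.

End exponential.

Section travel_time_existence.
Context {R : realType} {n : nat} {M : topologicalType} {A : smooth_manifold R n M}
  (H : cotangent A -> R).
Hypothesis hH : hamiltonian_conditions H.
Local Notation V := 'rV[R]_n.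
Local Notation E := (V * V)%type.
Implicit Types (c d : chart A) (p q : cotangent A) (g : R -> cotangent A).

Lemma inverse_near (t T0 d : R) : 0 < T0 -> 0 < d -> `|t - T0| < T0 / 2 ->
  `|t - T0| < d * (T0 ^+ 2 / 2) -> `|t^-1 - T0^-1| < d.
Proof.
move=> T00 d0 tT td; have [th t0] := near_half T00 tT.
have -> : t^-1 - T0^-1 = (T0 - t) / (t * T0) by field; rewrite !gt_eqF.
rewrite normrM normfV [`|t * T0|]gtr0_norm ?mulr_gt0// ltr_pdivrMr ?mulr_gt0// distrC.
by rewrite (lt_le_trans td)// ler_wpM2l ?(ltW d0)// expr2 mulrAC ler_wpM2r ?(ltW T00).
Qed.

(** The local inverse G of the exponential map of base (g 0) has an invertible
    differential B, which serves as the approximate inverse in a Newton iteration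
    with frozen slope for the prolonged flow from nearby points. *)
Theorem exponential_onto g : bicharacteristic H 0 1 g ->
  not_conjugate H (g 0) (base (g 1)) ->
  (forall t, 0 <= t < 1 -> exists2 d, cdom d (base (g t)) & startable H d (g t)) ->
  (forall d, cdom d (base (g 1)) ->
    0 < coord0 (cmap d (base (g 1))) \/ coord0 (H_xi H d (g 1)) < 0) ->
  forall W, nbhs_cotangent (g 0) W ->
  \forall z \near nbhs (base (g 0), base (g 1)), exists p q,
    [/\ W p, flow H 1 p q, base p = z.1 & base q = z.2].
Proof.
move=> hg nc st stop W hW.
have [c [d [D [G [B [d0 [[gc gd d00 D0] G0 GP GD DG]]]]]]] := not_conjugate_charts nc.
have [P [r [r0 tP Pex Pfl flP]]] := extended_flow hH hg gc gd st (stop d gd).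
set z0 := cmap c (base (g 0)); set y0 := cmap d (base (g 1)) in D0 G0 GP GD DG.
set zeta0 := comp (g 0) c in G0.
have [C0 [d1 [C00 d10 hG]]] := hdw_bound (finite_frame_row n) DG.
have d20 : 0 < Num.min d0 (Num.min d1 (r / C0)) by rewrite !lt_min d00 d10 divr_gt0.
have pairE (z zeta : V) : (z, zeta) - (z0, zeta0) = (z - z0, zeta - zeta0) :> E by [].
have GP' y : D y -> `|y - y0| < Num.min d0 (Num.min d1 (r / C0)) -> P (z0, G y) y.
  move=> Dy; rewrite !lt_min => /and3P[y1 y2 y3].
  have [p [q [fl bp cp bq]]] := GP y Dy y1.
  have -> : (z0, G y) = state c p by rewrite /state bp cp.
  rewrite -[in X in P _ X]bq; apply: Pfl => //; split; first by rewrite bp.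
  rewrite -[state c p - _]/((cmap c (base p) - z0, comp p c - zeta0) : E) bp subrr cp -G0.
  apply: pair_norm_lt; rewrite /= ?normr0//.
  by rewrite (le_lt_trans (hG y y2 Dy))// mulrC -ltr_pdivlMr.
have GD' u : `|u| < Num.min d0 (Num.min d1 (r / C0)) -> D (y0 + u) \/ D (y0 - u).
  by rewrite lt_min => /andP[/GD].
have [B' [linB' BB' B'B inv]] := tame_inversion tP G0 d20 D0 GP' GD' DG.
have linB : islinear B by case: DG.
have [b b0 hb] := islinear_bounded (finite_frame_row n) linB.
have e0 : 0 < (2 * b)^-1 by rewrite invr_gt0 mulr_gt0.
have [r1 [C1 [r10 C10 est]]] := inv _ e0.
have [rW [rW0 hrW]] := nbhs_cotangent_state hW gc.
pose rad : R := Num.min r (Num.min r1 rW) / 2.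
have m0 : 0 < Num.min r (Num.min r1 rW) by rewrite !lt_min r0 r10.
have rad0 : 0 < rad by rewrite divr_gt0.
have radm : rad < Num.min r (Num.min r1 rW) by rewrite /rad ltr_pdivrMr// ltr_pMr// ltr1n.
have C2 : 0 < 2 * b * (C1 + 1) by rewrite !mulr_gt0// addr_gt0.
pose dl : R := Num.min rad (rad / (2 * b * (C1 + 1))).
have dl0 : 0 < dl by rewrite lt_min rad0 divr_gt0.
exists ([set x | cdom c x /\ `|cmap c x - z0| < dl], [set y | cdom d y /\ `|cmap d y - y0| < dl]).
  by split; apply: cmap_near.
move=> [x y] [/= [cx xd] [dy yd]]; set z := cmap c x in xd.
move: (xd) (yd); rewrite !lt_min => /andP[xr xC] /andP[yr yC].
have near zeta : `|zeta - zeta0| <= rad -> `|(z, zeta) - (z0, zeta0)| < Num.min r (Num.min r1 rW).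
  by move=> h; rewrite pairE pair_norm_lt//=; [exact: lt_trans xr radm|exact: le_lt_trans h radm].
pose pt zeta := cotangent_at c z zeta.
have ptE zeta : [/\ base (pt zeta) = x, cdom c (base (pt zeta)) & state c (pt zeta) = (z, zeta)].
  by have [h1 h2] := cotangent_at_map zeta cx; rewrite /state /pt h1 h2.
pose F zeta := xget 0 [set y | P (z, zeta) y].
have FP zeta : `|zeta - zeta0| <= rad -> P (z, zeta) (F zeta).
  move=> /near; rewrite !lt_min => /and3P[h _ _].
  have [_ pc pE] := ptE zeta; rewrite -pE in h.
  have [v hv] := Pex _ (conj pc h); apply: xgetPex; exists v.
  by rewrite /= -pE.
have estF za zb : `|za - zeta0| <= rad -> `|zb - zeta0| <= rad ->
    `|F za - F zb - B' (za - zb)| <= (2 * b)^-1 * `|za - zb|.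
  move=> ha hb'; have := est (z, za) (z, zb) (F za) (F zb); rewrite /= subrr normr0 mulr0 addr0.
  apply; [| |exact: FP|exact: FP].
    by move: (near _ ha); rewrite !lt_min => /and3P[].
  by move: (near _ hb'); rewrite !lt_min => /and3P[].
pose f zeta := zeta - B (F zeta - cmap d y).
have [za zb|| zeta zr fz] := @contraction_fixpoint R V f zeta0 rad _ rad0.
- move=> ha hb'; rewrite /f.
  have -> : za - B (F za - cmap d y) - (zb - B (F zb - cmap d y)) = - B (F za - F zb - B' (za - zb)).
    rewrite !(islinearB linB) BB'; module_eq.
  rewrite normrN (le_trans (hb _))//.
  rewrite (le_trans (ler_wpM2l (ltW b0) (estF _ _ ha hb')))// mulrA.
  by rewrite invfM mulrCA mulfV ?gt_eqF// mulr1 div1r.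
- rewrite /f addrAC subrr sub0r normrN (le_trans (hb _))//.
  have h0 : `|zeta0 - zeta0| <= rad by rewrite subrr normr0 ltW.
  have := est (z, zeta0) (z0, zeta0) (F zeta0) y0.
  rewrite /= subrr normr0 mulr0 add0r (islinear0 linB') subr0 => h1.
  have {h1} : `|F zeta0 - y0| <= C1 * `|z - z0|.
    apply: h1; [by move: (near _ h0); rewrite !lt_min => /and3P[]|by rewrite subrr normr0|exact: FP|].
    by rewrite -[X in P (_, X)]G0; apply: GP' => //; rewrite subrr normr0.
  move=> h1.
  have h2 : C1 * `|z - z0| <= C1 * (rad / (2 * b * (C1 + 1))) by rewrite ler_wpM2l// ltW.
  have h3 : `|F zeta0 - cmap d y| <= (C1 + 1) * (rad / (2 * b * (C1 + 1))).
    rewrite -(subrKA y0) (le_trans (ler_normD _ _))// mulrDl mul1r lerD//; first exact: le_trans h1 h2.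
    by rewrite distrC ltW.
  rewrite (le_trans (ler_wpM2l (ltW b0) h3))//.
  have c1 : C1 + 1 != 0 by rewrite gt_eqF// addr_gt0.
  have b1 : b != 0 by rewrite gt_eqF.
  rewrite le_eqVlt; apply/orP; left; apply/eqP; field.
  by rewrite c1 b1.
have BF : B (F zeta - cmap d y) = 0.
  by apply/eqP; rewrite -oppr_eq0 -(inj_eq (addrI zeta)) addr0; apply/eqP.
have Fy : F zeta = cmap d y.
  by apply/eqP; rewrite -subr_eq0 -[_ - _]B'B BF (islinear0 linB').
have [bp pc pE] := ptE zeta.
have := near _ zr; rewrite !lt_min -pE => /and3P[n1 _ n2].
have [|q fl bq] := flP (pt zeta) y (conj pc n1) dy.
  by rewrite pE -Fy; exact: FP.
by exists (pt zeta), q; split=> //; apply: hrW.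
Qed.

(** Uniqueness of nearby bicharacteristics with given endpoints comes from the
    same estimates as the differentiability of the travel time. *)
Theorem travel_time_exists p0 q0 (T0 : R) :
  unit_covector H p0 -> 0 < T0 -> flow H T0 p0 q0 ->
  not_conjugate H (covector_scale T0 p0) (base q0) ->
  (forall W, nbhs_cotangent (covector_scale T0 p0) W ->
    \forall z \near nbhs (base p0, base q0), exists p q,
      [/\ W p, flow H 1 p q, base p = z.1 & base q = z.2]) ->
  exists T, local_travel_time H p0 (base q0) T0 T.
Proof.
move=> up T00 fl nc onto.
set P0 := covector_scale T0 p0 in nc onto.
have fl1 := flow_unit_time hH T00 fl.
have [c [d [r [K [hc hd [r0 K0] est]]]]] := endpoint_estimates hH fl1 nc.
have hc0 : cdom c (base p0) by [].
have [delta [delta0 hdelta]] := scale_near (p0 := p0) hc0 T00 r0.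
pose W1 : set (cotangent A) := near_state c p0 delta.
pose e1 : R := Num.min delta (T0 / 2).
have e10 : 0 < e1 by rewrite lt_min delta0 divr_gt0.
have uniq x y p t p' t' : travels H W1 T0 e1 x y p t -> travels H W1 T0 e1 x y p' t' ->
    p' = p /\ t' = t.
  move=> [Wp pu bp te [q fq bq]] [Wp' pu' bp' te' [q' fq' bq']].
  move: te te'; rewrite !lt_min => /andP[td /(near_half T00)[_ t0]] /andP[td' /(near_half T00)[_ t0']].
  have := est _ _ _ _ (hdelta _ _ Wp td) (hdelta _ _ Wp' td')
    (flow_unit_time hH t0 fq) (flow_unit_time hH t0' fq').
  rewrite /= bp bp' bq bq' !subrr !normr0 addr0 mulr0 => -[_ h _].
  have {h} E0 : covector_scale t' p' = covector_scale t p.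
    apply: (@cotangent_eq _ _ _ _ _ _ c); rewrite /= ?bp ?bp'//; first by rewrite -bp; case: Wp.
    by apply/eqP; rewrite -subr_eq0 -normr_le0.
  have tt : t' = t.
    have := congr1 H E0; rewrite !(energy_scale hH)//.
    move=> /(mulIf (_ : 2^-1 != 0)) => /(_ ltac:(by rewrite invr_eq0 pnatr_eq0)) /eqP.
    by rewrite eqf_sqr => /orP[/eqP//|/eqP tE]; move: t0'; rewrite tE oppr_gt0 ltNge (ltW t0).
  split=> //; have := congr1 (covector_scale t^-1) E0; rewrite tt !covector_scale_scale.
  by rewrite mulVf ?gt_eqF// !covector_scale1.
pose T x y := xget 0 [set t | exists p, travels H W1 T0 e1 x y p t].
have mono W e x y p t : W `<=` W1 -> e <= e1 -> travels H W T0 e x y p t ->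
    travels H W1 T0 e1 x y p t.
  by move=> WW ee [Wp pu bp te fq]; split=> //; [exact: WW|exact: lt_le_trans ee].
exists T, W1; split; first by exact: (@state_nbhs_cotangent _ _ _ _ p0 _ c delta hc0).
exists e1 => // W e hW WW /andP[e0 ee].
have T0i : 0 < T0^-1 by rewrite invr_gt0.
have P0c : cdom c (base P0) by [].
have [rW [rW0 hrW]] := nbhs_cotangent_state hW hc0.
have [d1 [d10 hd1]] := scale_near (p0 := P0) P0c T0i rW0.
have P0n : nonzero P0 by apply: nonzero_scale; [rewrite gt_eqF|case: up].
have [h [X [L [HL _ hL]]]] := hamiltonian_field hH P0c P0n.
have L0 : 0 < L := HL.1.
pose m : R := Num.min (Num.min e (T0 / 2)) (d1 * (T0 ^+ 2 / 2)).
have m0 : 0 < m by rewrite !lt_min e0 divr_gt0// mulr_gt0// divr_gt0// exprn_gt0.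
have mT : 0 < m * T0 / 2 by rewrite divr_gt0// mulr_gt0.
have [d2 d20 hd2] := tame_near (C11_tame _ HL) erefl mT.
pose rad := Num.min d1 (Num.min L^-1 d2).
have rad0 : 0 < rad by rewrite !lt_min d10 invr_gt0 L0.
have nb : nbhs_cotangent P0 (near_state c P0 rad).
  exact: (@state_nbhs_cotangent _ _ _ _ P0 _ c rad).
apply: filterS (onto _ nb) => -[x y] [P [Q [[Pc]]]] /=.
rewrite !lt_min => /and3P[P1 PL P2] flP bP bQ.
have [Pn hP _ _] := hL P (conj Pc PL).
have P0near : near_state c P0 L^-1 P0 by split=> //; rewrite subrr normr0 invr_gt0.
have [_ hP0 _ _] := hL P0 P0near.
have HP0 : 0 < H P by exact: (H_positive hH).
pose t := Num.sqrt (2 * H P).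
have t2 : t ^+ 2 = 2 * H P by rewrite sqr_sqrtr// mulr_ge0// ltW.
have t0 : 0 < t by rewrite sqrtr_gt0 mulr_gt0.
have tm : `|t - T0| < m.
  have := hd2 _ _ P2 erefl; rewrite hP hP0 (energy_scale hH)// => h1.
  have E1 : (t - T0) * (t + T0) = 2 * (H P - T0 ^+ 2 / 2).
    by rewrite -[LHS]/((t - T0) * (t + T0)) -subr_sqr t2; field.
  have h2 : `|t - T0| * T0 <= `|t - T0| * (t + T0) by rewrite ler_wpM2l// lerDr ltW.
  have h3 : `|t - T0| * (t + T0) = 2 * `|H P - T0 ^+ 2 / 2|.
    have := congr1 (fun x : R => `|x|) E1; rewrite !normrM.
    by rewrite [`|t + T0|]gtr0_norm ?addr_gt0// [`|2|]gtr0_norm.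
  rewrite -(ltr_pM2r T00) (le_lt_trans h2)// h3; move: h1; clear; lra.
move: tm; rewrite !lt_min => /andP[/andP[te thalf] td].
have ti : `|t^-1 - T0^-1| < d1 by exact: inverse_near.
pose p := covector_scale t^-1 P.
have ti0 : 0 < t^-1 by rewrite invr_gt0.
have pn : nonzero p by apply: nonzero_scale; rewrite ?gt_eqF.
have pu : unit_covector H p.
  split=> //; rewrite (H_homogeneous hH)// exprVn t2.
  by field; rewrite gt_eqF.
have trav : travels H W T0 e x y p t.
  split=> //.
    apply: hrW; have := hd1 P t^-1 (conj Pc P1) ti.
    by rewrite /P0 covector_scale_scale mulVf ?gt_eqF// covector_scale1.
  exists (covector_scale t^-1 Q) => //.
  by have := flow_scale hH ti0 ler01 flP; rewrite invrK mul1r.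
have TE : T x y = t.
  have [p1 tr1] : exists p, travels H W1 T0 e1 x y p (T x y).
    by apply: (@xgetPex _ 0 [set t | exists p, travels H W1 T0 e1 x y p t]); exists t, p; exact: mono trav.
  by have [_] := uniq _ _ _ _ _ _ (mono _ _ _ _ _ _ WW ee trav) tr1.
rewrite TE; exists p => // p' t' /(mono _ _ _ _ _ _ WW ee).
exact: uniq (mono _ _ _ _ _ _ WW ee trav).
Qed.

End travel_time_existence.

(** * Covectors of the boundary and their lifts *)

Section boundary.
Context {R : realType} {n : nat} {M : topologicalType} {A : smooth_manifold R n M}
  (H : cotangent A -> R).
Hypothesis hH : hamiltonian_conditions H.
Local Notation V := 'rV[R]_n.
Local Notation E := (V * V)%type.
Implicit Types (c d : chart A) (p q : cotangent A) (g : R -> cotangent A).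

Lemma transversal_start (a b : R) g c rho : boundary_defining A rho ->
  bicharacteristic H a b g -> a < b -> boundary A (base (g a)) -> cdom c (base (g a)) ->
  drho_Hxi H rho c (g a) != 0 -> 0 < coord0 (H_xi H c (g a)).
Proof.
move=> hrho hg ab ba hc dr; rewrite lt_neqAle eq_sym (drho_Hxi_neq0 hrho ba hc dr) /=.
have aab : a <= a <= b by rewrite lexx ltW.
have := bichar_boundary hg ab aab hc (boundary_chart ba hc) (or_introl (conj erefl erefl)).
by rewrite mul1r.
Qed.

Lemma transversal_end (a b : R) g c rho : boundary_defining A rho ->
  bicharacteristic H a b g -> a < b -> boundary A (base (g b)) -> cdom c (base (g b)) ->
  drho_Hxi H rho c (g b) != 0 -> coord0 (H_xi H c (g b)) < 0.
Proof.
move=> hrho hg ab bb hc dr; rewrite lt_neqAle (drho_Hxi_neq0 hrho bb hc dr) /=.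
have bab : a <= b <= b by rewrite lexx ltW.
have := bichar_boundary hg ab bab hc (boundary_chart bb hc) (or_intror (conj erefl erefl)).
by rewrite mulN1r oppr_ge0.
Qed.

(** If its end points lie on the boundary, transversality makes the bicharacteristic
    point inwards at the start and outwards at the end. *)
Lemma regular_travel_time p0 q0 (T0 : R) rho :
  unit_covector H p0 -> 0 < T0 -> flow H T0 p0 q0 ->
  not_conjugate H (covector_scale T0 p0) (base q0) ->
  boundary_defining A rho -> meets_boundary_regularly H rho p0 q0 T0 ->
  exists T, local_travel_time H p0 (base q0) T0 T.
Proof.
move=> up T00 fl nc hrho [inside tr0 trT]; apply: (travel_time_exists hH up T00 fl nc).
have /(flowP H _ _ (ltW T00))[g1 [hg1 g10 g1T]] := fl.
pose g t := covector_scale T0 (g1 (T0 * t + 0)).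
have g0 : g 0 = covector_scale T0 p0 by rewrite /g mulr0 addr0 g10.
have gT : g 1 = covector_scale T0 q0 by rewrite /g mulr1 addr0 g1T.
have hg : bicharacteristic H 0 1 g.
  by apply: (bichar_reparam hH T00); rewrite mulr0 mulr1 !addr0.
have b0 : base (g 0) = base p0 by rewrite g0.
have bT : base (g 1) = base q0 by rewrite gT.
have T0T : 0 <= (0 : R) <= T0 by rewrite lexx ltW.
have TTT : 0 <= T0 <= T0 by rewrite lexx ltW.
have Hxi t d : 0 <= t <= T0 -> cdom d (base (g1 t)) ->
    H_xi H d (covector_scale T0 (g1 t)) = T0 *: H_xi H d (g1 t).
  by move=> tT hd; have [nt _] := bichar_at hg1 tT hd; have [] := dHchart_scale hH hd nt T00.
rewrite -g0 -b0 -bT; apply: (exponential_onto hH hg); first by rewrite g0 bT.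
- move=> t /andP[t0 t1]; have [d hd] := cdom_cover A (base (g t)).
  exists d => //; have [bd|/interior_chart/(_ hd)] := pselect (boundary A (base (g t))); last by left.
  have [t00|t00] := eqVneq t 0; last first.
    have tp : 0 < t by rewrite lt_neqAle eq_sym t00.
    case: (@inside (T0 * t) (g1 (T0 * t + 0))) => //.
      by rewrite mulr_gt0//= gtr_pMr.
    rewrite addr0 -g10 -[T0 * t]subr0 subr0; have := bichar_flow hH hg1 (lexx 0) (t := T0 * t).
    by rewrite subr0; apply; rewrite ?mulr_ge0 ?(ltW T00)// ger_pMr// ltW.
  rewrite t00 in hd bd *; right.
  have hd0 : cdom d (base (g1 0)) by rewrite g10 -b0.
  have bd0 : boundary A (base (g1 0)) by rewrite g10 -b0.
  rewrite /g mulr0 addr0 Hxi//.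
  rewrite (islinearZ coord0_linear) -[_ *: _]/(_ * _) mulr_gt0//.
  apply: (transversal_start hrho hg1 T00 bd0 hd0).
  by rewrite g10 in hd0 bd0 *; exact: tr0.
- move=> d hd; have [bd|/interior_chart/(_ hd)] := pselect (boundary A (base (g 1))); last by left.
  right; have hd0 : cdom d (base (g1 T0)) by rewrite g1T -bT.
  have bd0 : boundary A (base (g1 T0)) by rewrite g1T -bT.
  rewrite /g mulr1 addr0 Hxi//.
  rewrite (islinearZ coord0_linear) -[_ *: _]/(_ * _) pmulr_rlt0//.
  apply: (transversal_end hrho hg1 T00 bd0 hd0).
  by rewrite g1T in hd0 bd0 *; exact: trT.
Qed.

(** Changes of charts preserve the tangent vectors of the boundary. *)
Lemma restricts_chart p (b : bcotangent A) c : cdom c (base p) -> base p = bbase b ->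
  (forall v, coord0 v = 0 -> pairing (bcomp b c) v = pairing (comp p c) v) -> restricts p b.
Proof.
move=> hc bE h; split=> // c' hc' v v0.
have hcb : cdom c (bbase b) by rewrite -bE. have hcb' : cdom c' (bbase b) by rewrite -bE.
have z0 : coord0 (cmap c (base p)) = 0 by rewrite bE; exact: boundary_chart (bbase_boundary b) hcb.
rewrite (bcomp_law hcb' hcb v0) (cotangent_law v hc' hc) -bE.
by apply: h; apply: (transition_diff_coord0 hc' hc z0); right.
Qed.

(** The covectors that vanish on the tangent space of the boundary are the multiples
    of this one. *)
Definition conormal : V := \row_i (i == 0%N :> nat)%:R.

Lemma pairing_conormal v : pairing conormal v = coord0 v.
Proof.
rewrite /coord0 big_mkcond; apply: eq_bigr => i _; rewrite mxE.
by case: eqP => _; rewrite ?mul1r ?mul0r.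
Qed.

Lemma conormal_bound : `|conormal| <= 1.
Proof.
by apply: row_norm_le => // i; rewrite mxE; case: eqP; rewrite ?normr1 ?normr0.
Qed.

Lemma coord0_entry (v : V) (i : 'I_n) : i = 0%N :> nat -> coord0 v = v 0 i.
Proof.
move=> i0; rewrite /coord0 (big_pred1 i) // => j /=.
by apply/eqP/eqP => [j0|->//]; apply: val_inj; rewrite /= j0.
Qed.

Lemma coord0_delta (i : 'I_n) : i != 0%N :> nat -> coord0 (delta_mx 0 i : V) = 0.
Proof.
move=> i0; apply: big1 => j /eqP j0; rewrite mxE.
by case: (j =P i) => [ji|]; rewrite ?andbF//; rewrite -ji j0 in i0.
Qed.

Lemma conormal_decomposition p (b : bcotangent A) c : restricts p b -> cdom c (base p) ->
  comp p c = bcomp b c + coord0 (comp p c) *: conormal.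
Proof.
move=> [_ h] hc; apply/rowP => i; rewrite !mxE.
have [i0|i0] := eqVneq (i : nat) 0%N.
  rewrite mulr1 (coord0_entry _ i0) -(coord0_entry (bcomp b c) i0) (bcomp_coord0 b c).
  by rewrite add0r.
rewrite mulr0 addr0 -!pairing_delta; apply/esym/h => //; exact: coord0_delta.
Qed.

(** In a boundary chart the lift of (x, xi') is the solution of a scalar equation
    whose derivative is the first component of H_xi. *)
Lemma boundary_lift p0 (b0 : bcotangent A) c : unit_covector H p0 -> restricts p0 b0 ->
  cdom c (base p0) -> coord0 (H_xi H c p0) != 0 ->
  exists r1 : R, 0 < r1 /\
  (forall p p' b, near_state c p0 r1 p -> near_state c p0 r1 p' -> unit_covector H p ->
    unit_covector H p' -> restricts p b -> restricts p' b -> p' = p) /\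
  forall r : R, 0 < r -> exists e : R, 0 < e /\ forall b, cdom c (bbase b) ->
    `|cmap c (bbase b) - cmap c (bbase b0)| < e -> `|bcomp b c - bcomp b0 c| < e ->
    exists p, [/\ near_state c p0 r p, unit_covector H p & restricts p b].
Proof.
move=> [n0 up] res0 hc k0; set k := coord0 _ in k0.
have [h [X [K [HK _ hK]]]] := hamiltonian_field hH hc n0.
have K0 : 0 < K := HK.1.
have kp : 0 < `|k| by rewrite normr_gt0.
have fE : finite_frame (E : normedModType R) by exact: _.
have near0 : near_state c p0 K^-1 p0 by split=> //; rewrite subrr normr0 invr_gt0.
have [_ hp0 dp0 _] := hK p0 near0.
have [D0 _ _] := HK.2 (state c p0) (near0.2).
have lin0 : islinear (fun v => 'D_v h (state c p0)) by case: D0.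
pose e0 : E := (0, conormal).
have e01 : `|e0| <= 1 by apply: pair_norm_le; rewrite /= ?normr0 ?conormal_bound.
have De0 : 'D_e0 h (state c p0) = k.
  rewrite -[LHS]/((fun v => 'D_v h (state c p0)) e0) -dp0 (dHchart_split hH _ _ hc n0).
  rewrite pairing0r add0r /k -pairing_conormal; apply: eq_bigr => i _; exact: mulrC.
pose r1 := Num.min K^-1 (`|k| / (6 * K)).
have K6 : 0 < 6 * K by rewrite mulr_gt0.
have r10 : 0 < r1 by rewrite lt_min invr_gt0 K0 divr_gt0.
have r1K : r1 <= K^-1 by rewrite ge_min lexx.
have r1k : K * r1 <= `|k| / 6.
  have : r1 * (6 * K) <= `|k| by rewrite -ler_pdivlMr// ge_min lexx orbT.
  by lra.
(* H is strictly monotone in the conormal direction, with slope close to k *)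
have slope w (s : R) : `|w - state c p0| < r1 -> `|w + s *: e0 - state c p0| < r1 ->
    `|h (w + s *: e0) - h w - s * k| <= 1 / 2 * (`|k| * `|s|).
  move=> w1 w2; have wK := lt_le_trans w1 r1K; have wK' := lt_le_trans w2 r1K.
  have T := C11_taylor fE HK wK wK'.
  have [Dw _ lip] := HK.2 w wK; have linw : islinear (fun v => 'D_v h w) by case: Dw.
  have := lip (state c p0) near0.2 (s *: e0); move: T.
  rewrite [w + _ - w]addrC addKr (islinearZ linw) (islinearZ lin0) De0.
  rewrite -[s *: k]/(s * k); set dw := s *: 'D_e0 h w => h1 h2.
  have se : `|s *: e0| <= `|s| by rewrite normrZ ler_piMr.
  have s2 : `|s *: e0| <= 2 * r1.
    rewrite (_ : s *: e0 = (w + s *: e0 - state c p0) - (w - state c p0)); last by module_eq.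
    by rewrite (le_trans (ler_normB _ _))// mulrDl mul1r lerD// ltW.
  have h3 : K * `|s *: e0| ^+ 2 <= K * (2 * r1 * `|s|) by rewrite ler_pM2l// expr2 ler_pM.
  have h4 : K * `|w - state c p0| * `|s *: e0| <= K * r1 * `|s|.
    by rewrite ler_pM ?mulr_ge0 ?(ltW K0)// ler_pM2l// ltW.
  have h5 : 3 * (K * r1) * `|s| <= 1 / 2 * `|k| * `|s| by rewrite ler_wpM2r//; lra.
  rewrite -(subrKA dw) (le_trans (ler_normD _ _))// mulrA.
  by rewrite (le_trans (lerD (le_trans h1 h3) (le_trans h2 h4)))// (le_trans _ h5)//; lra.
exists r1; split=> //; split.
- move=> p p' b [pc pr] [pc' pr'] [pn pu] [_ pu'] res res'.
  have bE : base p' = base p by rewrite res.1 res'.1.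
  pose s := coord0 (comp p' c) - coord0 (comp p c).
  have wE : state c p' = state c p + s *: e0.
    rewrite /state bE (conormal_decomposition res pc) (conormal_decomposition res' pc').
    rewrite -[RHS]/(cmap c (base p) + s *: 0, _ + s *: conormal) scaler0 addr0; congr pair.
    by rewrite -[RHS]/(bcomp b c + coord0 (comp p c) *: conormal + s *: conormal) /s; module_eq.
  have := slope (state c p) s pr ltac:(by rewrite -wE).
  rewrite -wE; have [_ -> _ _] := hK p (conj pc (lt_le_trans pr r1K)).
  have [_ -> _ _] := hK p' (conj pc' (lt_le_trans pr' r1K)).
  rewrite pu pu' subrr sub0r normrN normrM [`|k| * _]mulrC => sk.
  have s0 : s = 0.
    apply/eqP; rewrite -normr_eq0 eq_le normr_ge0 andbT -(ler_pM2r kp) mul0r.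
    by move: sk; set x := `|s| * `|k|; lra.
  apply: (cotangent_eq pc' bE); move: wE; rewrite s0 scale0r addr0 => wE.
  exact: (congr1 snd wE).
- move=> r r0; pose m : R := Num.min r r1; pose rad : R := m / 3.
  have m0 : 0 < m by rewrite lt_min r0.
  have rad0 : 0 < rad by rewrite divr_gt0.
  have rk0 : 0 < rad * `|k| / 2 by rewrite divr_gt0// mulr_gt0.
  have [d d0 hd] := tame_near (C11_tame fE HK) erefl rk0.
  exists (Num.min rad d); split=> [|b bc]; first by rewrite lt_min rad0.
  have bE0 : bbase b0 = base p0 by rewrite res0.1.
  set z := cmap c (bbase b); set be := bcomp b c; set be0 := bcomp b0 c.
  rewrite bE0 => z1 z2.
  have cE := conormal_decomposition res0 hc; rewrite -/be0 in cE.
  set s0 := coord0 _ in cE.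
  pose w (s : R) : E := (z, be + s *: conormal).
  have z1' : `|z - cmap c (base p0)| < rad by move: z1; rewrite lt_min => /andP[].
  have z2' : `|be - be0| < rad by move: z2; rewrite lt_min => /andP[].
  have wD s : w s - state c p0 = (z - cmap c (base p0), (be - be0) + (s - s0) *: conormal).
    rewrite /w /state cE -[LHS]/((z - cmap c (base p0), be + s *: conormal - (be0 + s0 *: conormal)) : E).
    by congr pair; module_eq.
  have near s : `|s - s0| <= rad -> `|w s - state c p0| < m.
    move=> hs; have mE : m = 3 * rad by rewrite /rad mulrC divfK.
    rewrite wD mE; apply: pair_norm_lt; rewrite /=; first by lra.
    rewrite (le_lt_trans (ler_normD _ _))// normrZ.
    have : `|s - s0| * `|conormal| <= `|s - s0| by rewrite ler_piMr// conormal_bound.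
    by lra.
  have nearr1 s : `|s - s0| <= rad -> `|w s - state c p0| < r1.
    by move=> /near; rewrite lt_min => /andP[].
  have wS s s' : w s = w s' + (s - s') *: e0.
    rewrite -[RHS]/(z + (s - s') *: 0, be + s' *: conormal + (s - s') *: conormal).
    by rewrite scaler0 addr0; congr pair; module_eq.
  pose f (s : R^o) : R^o := s - (h (w s) - 1 / 2) / k.
  have ki : `|k^-1| * `|k| = 1 by rewrite -normrM mulVf// normr1.
  have [s s' hs hs'|| s sr fs] := @contraction_fixpoint R R^o f s0 rad _ rad0.
  + have := slope (w s') (s - s') (nearr1 _ hs'); rewrite -wS => /(_ (nearr1 _ hs)).
    have -> : f s - f s' = - (k^-1 * (h (w s) - h (w s') - (s - s') * k)).
      by rewrite /f; field.
    rewrite normrN normrM => sl.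
    rewrite (le_trans (ler_wpM2l (normr_ge0 _) sl))// mulrCA [`|k^-1| * _]mulrA ki.
    by rewrite !mul1r.
  + have ws : `|w s0 - state c p0| < d.
      rewrite wD subrr scale0r addr0; apply: pair_norm_lt; rewrite /=.
        by move: z1; rewrite lt_min => /andP[].
      by move: z2; rewrite lt_min => /andP[].
    have := hd _ _ ws erefl; rewrite hp0 up => h1.
    rewrite /f addrAC subrr sub0r normrN normrM -(ler_pM2r kp) -[leLHS]mulrA ki mulr1.
    by rewrite mulrAC ltW.
  have hw : h (w s) = 1 / 2.
    apply/eqP; rewrite -subr_eq0; have : (h (w s) - 1 / 2) / k = 0.
      by apply/eqP; rewrite -oppr_eq0 -(inj_eq (addrI s)) addr0; apply/eqP.
    by move/eqP; rewrite mulf_eq0 invr_eq0 (negPf k0) orbF.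
  have [b1 b2] := cotangent_at_map (be + s *: conormal) bc.
  set p := cotangent_at c (cmap c (bbase b)) _ in b1 b2.
  have pc : cdom c (base p) by rewrite b1.
  have pE : state c p = w s by rewrite /state b1 b2.
  exists p; have := near s sr; rewrite lt_min -pE => /andP[n1 n2].
  have [pn hp _ _] := hK p (conj pc (lt_le_trans n2 r1K)).
  split=> //; first by split=> //; rewrite -hp pE.
  apply: (restricts_chart pc) => // v v0.
  rewrite b2 (islinearD (pairing_linearl v)).
  by rewrite pairingZl pairing_conormal v0 mulr0 addr0.
Qed.

End boundary.

(** * Hitting times *)

Section hits.
Context {R : realType} {n : nat} {M : topologicalType} {A : smooth_manifold R n M}
  (H : cotangent A -> R).
Hypothesis hH : hamiltonian_conditions H.
Local Notation V := 'rV[R]_n.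
Local Notation E := (V * V)%type.
Implicit Types (c d : chart A) (p q : cotangent A) (g : R -> cotangent A).

Lemma accessible_end (t : R) : 0 < t -> @accessible R R^o `[0, t] t.
Proof.
move=> t0 v d d0; have v1 : 0 < `|v| + 1 by rewrite ltr_wpDl.
pose m : R := Num.min (d / 2) (t / (`|v| + 1)).
have m0 : 0 < m by rewrite lt_min !divr_gt0.
have md : m < d by rewrite gt_min ltr_pdivrMr// ltr_pMr// ltr1n.
have mt : m * `|v| <= t.
  have : m * (`|v| + 1) <= t by rewrite -ler_pdivlMr// ge_min lexx orbT.
  by apply: le_trans; rewrite ler_pM2l// lerDl.
have [v0|v0] := leP 0 v.
  exists (- m); rewrite oppr_eq0 gt_eqF// normrN gtr0_norm//; split=> //.
  rewrite ger0_norm// in mt; rewrite /= in_itv /= -[_ *: v]/(- m * v) mulNr subr_ge0 mt /=.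
  by rewrite gerBl mulr_ge0// ltW.
exists m; rewrite gt_eqF// gtr0_norm//; split=> //.
rewrite ltr0_norm// mulrN in mt; rewrite /= in_itv /= -[_ *: v]/(m * v).
apply/andP; split; first by lra.
by rewrite gerDl pmulr_rle0// ltW.
Qed.

(** The number <d rho, H_xi> is the derivative of rho along the bicharacteristic,
    hence does not depend on the chart. *)
Lemma drho_Hxi_chart rho d d' (t : R) p q : smooth_function A rho -> 0 < t -> flow H t p q ->
  cdom d (base q) -> cdom d' (base q) -> drho_Hxi H rho d q = drho_Hxi H rho d' q.
Proof.
move=> sm t0 /(flowP _ _ _ (ltW t0))[g [hg _ gt]].
have tt : 0 <= t <= t by rewrite lexx ltW.
suff key c : cdom c (base q) -> @has_diff_within R R^o R^o `[0, t] (rho \o (@base _ _ _ _ \o g)) t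
    (fun s => s * drho_Hxi H rho c q).
  move=> hd hd'; have := hdw_unique (accessible_end t0) (key d hd) (key d' hd').
  by move=> /(congr1 (fun f => f 1)); rewrite !mul1r.
move=> hc; have [P [f [r [_ _ _ r0 D]]]] := smooth_function_ext sm hc.
have {}D := D (base q) hc ltac:(by rewrite subrr normr0).
rewrite /drho_Hxi (diff_withinE (accessible_image hc) D).
have lin : islinear (fun v => 'D_v f (cmap c (base q))) by case: D.
rewrite -gt in hc D lin *.
have [_ /hdw_fst Dg] := bichar_at hg tt hc.
have [e e0 he] := bichar_near hg tt (open_nbhs_nbhs (conj (@cdom_open _ _ _ A c) hc)).
have inC s : `|s - t| < e -> `[0, t]%classic s -> chart_image c (cmap c (base (g s))).
  by move=> st; rewrite /= in_itv /= => sb; exact/chart_image_map/he.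
have DD := hdw_comp finite_frame_R (finite_frame_row n) Dg D (ex_intro2 _ _ e e0 inC).
rewrite (_ : (fun s => _) = (fun v => 'D_v f (cmap c (base (g t)))) \o
  (fun s : R^o => (s *: (H_xi H c (g t), - H_x H c (g t))).1)); last first.
  by apply/funext => s; exact: esym (islinearZ lin s (H_xi H c (g t))).
apply: (hdw_local e0 _ _ DD) => [s se sb|]; last by rewrite /= cmapK.
by split=> //=; rewrite cmapK//; apply: he => //; move: sb; rewrite /= in_itv.
Qed.

Lemma drho_Hxi_near rho d p0 : smooth_function A rho -> cdom d (base p0) -> nonzero p0 ->
  drho_Hxi H rho d p0 != 0 -> exists r : R, 0 < r /\
    forall p, near_state d p0 r p -> drho_Hxi H rho d p != 0.
Proof.
move=> sm hd n0; have [P [f [r [oP Px Cf r0 D]]]] := smooth_function_ext sm hd.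
have [h [X [K [HK tX hK]]]] := hamiltonian_field hH hd n0.
have K0 : 0 < K := HK.1.
pose Y (w : E) : R^o := pairing (\row_i 'D_(delta_mx 0 i) f w.1) (X w).1.
have YE p : near_state d p0 (Num.min r K^-1) p -> drho_Hxi H rho d p = Y (state d p).
  move=> [pd]; rewrite lt_min => /andP[pr pK].
  have {}D := D (base p) pd (le_lt_trans (pair_fst_le (state d p - state d p0)) pr).
  rewrite /drho_Hxi (diff_withinE (accessible_image pd) D) /Y.
  have [|_ _ _ <-] := hK p; first by split.
  have lin : islinear (fun v => 'D_v f (cmap d (base p))) by case: D.
  by rewrite (pairing_sum _ lin).
have tY : tame Y (state d p0).
  apply: tame_pairing; last first.
    by apply: (tame_comp tX); apply: tame_linear; exact: fst_linear.
  apply: tame_row => i.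
  have [_ /(_ (delta_mx 0 i)) C2] := Cf 3%N.
  have [Ks [Hs _]] := Ck2_C11 (finite_frame_row n) oP Px C2.
  apply: (@tame_comp _ _ _ _ fst (fun z => 'D_(delta_mx 0 i) f z)).
    by apply: tame_linear; exact: fst_linear.
  exact: C11_tame Hs.
have m0 : 0 < Num.min r K^-1 by rewrite lt_min r0 invr_gt0.
have near0 : near_state d p0 (Num.min r K^-1) p0 by split=> //; rewrite subrr normr0.
rewrite YE// => Y0; have Yp : 0 < `|Y (state d p0)| by rewrite normr_gt0.
have [e e0 he] := tame_near tY erefl Yp.
exists (Num.min (Num.min r K^-1) e); rewrite lt_min m0; split=> // p [pd].
rewrite lt_min => /andP[p1 p2]; rewrite YE//; apply: contraTneq (he _ _ p2 erefl) => ->.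
by rewrite sub0r normrN ltxx.
Qed.

Lemma flow_near c d p0 q0 (T0 r : R) : 0 < T0 -> flow H T0 p0 q0 -> cdom c (base p0) ->
  cdom d (base q0) -> 0 < r -> exists delta : R, 0 < delta /\
  forall p q t, near_state c p0 delta p -> `|t - T0| < delta -> flow H t p q -> near_state d q0 r q.
Proof.
move=> T00 fl hc hd r0; have fl1 := flow_unit_time hH T00 fl.
have hcs : cdom c (base (covector_scale T0 p0)) by [].
have hds : cdom d (base (covector_scale T0 q0)) by [].
have T0i : 0 < T0^-1 by rewrite invr_gt0.
have [d1 [d10 h1]] := scale_near hds T0i r0.
have [d2 [d20 h2]] := evolution_near (flow_tame hH ler01 fl1 hcs hds) hcs fl1 d10.
have [d3 [d30 h3]] := scale_near hc T00 d20.
exists (Num.min d3 (Num.min (T0 / 2) (d1 * (T0 ^+ 2 / 2)))); split.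
  by rewrite !lt_min d30 divr_gt0// mulr_gt0// divr_gt0// exprn_gt0.
move=> p q t [pc]; rewrite !lt_min => /andP[pd _] /and3P[t3 tT td] flq.
have [th t0] := near_half T00 tT.
have ti : `|t^-1 - T0^-1| < d1 by exact: inverse_near.
have := h1 _ _ (h2 _ _ (h3 _ _ (conj pc pd) t3) (flow_unit_time hH t0 flq)) ti.
by rewrite !covector_scale_scale !mulVf ?gt_eqF// !covector_scale1.
Qed.

Lemma avoid_local d p1 (y0 : M) : cdom d (base p1) -> nonzero p1 -> base p1 <> y0 ->
  exists (r : R) (Y : set M), [/\ 0 < r, nbhs y0 Y & forall p q (sig : R),
    near_state d p1 r p -> 0 <= sig <= r -> flow H sig p q -> ~ Y (base q)].
Proof.
move=> hd n1 ne; have := manifold_hausdorff A; rewrite open_hausdorff.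
move=> /(_ _ _ (introN eqP ne))[[N Y] /= [Np Yy] [oN oY /eqP NY]].
rewrite !inE in Np Yy.
have [e e0 he] := cmap_near_inv hd (open_nbhs_nbhs (conj oN Np)).
have [r [r0 stays]] := bichar_stays hH hd n1 e0.
exists r, Y; split=> //; first exact: open_nbhs_nbhs.
move=> p q sig np sr fl Yq; have /andP[s0 _] := sr.
have /(flowP _ _ _ s0)[g [hg g0 gs]] := fl.
have sb : 0 <= sig <= sig by rewrite lexx andbT.
have := stays g sig sr hg; rewrite g0 => /(_ np sig sb); rewrite gs => -[qd qe].
have Nq : N (base q) by apply: he => //; exact: le_lt_trans (pair_fst_le (state d q - state d p1)) qe.
by have : (N `&` Y) (base q) by []; rewrite NY.
Qed.

(** Real induction over the time interval, since each point of the bicharacteristic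
    has a neighbourhood that is disjoint from one of y0. *)
Lemma flow_avoids c g (b : R) (y0 : M) : bicharacteristic H 0 b g -> 0 <= b -> cdom c (base (g 0)) ->
  (forall t, 0 <= t <= b -> base (g t) <> y0) ->
  exists (r : R) (Y : set M), [/\ 0 < r, nbhs y0 Y & forall t p q,
    0 <= t <= b -> near_state c (g 0) r p -> flow H t p q -> ~ Y (base q)].
Proof.
move=> hg b0 gc ne.
pose P s := exists (r : R) (Y : set M), [/\ 0 < r, nbhs y0 Y & forall t p q,
    0 <= t <= s -> near_state c (g 0) r p -> flow H t p q -> ~ Y (base q)].
have loc s : 0 <= s <= b -> exists d (r : R) (Y : set M), [/\ cdom d (base (g s)), 0 < r, nbhs y0 Y &
    forall p q (sig : R), near_state d (g s) r p -> 0 <= sig <= r -> flow H sig p q -> ~ Y (base q)].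
  move=> sb; have [d hd] := cdom_cover A (base (g s)).
  have [ns _] := bichar_at hg sb hd.
  by have [r [Y [r0 hY h]]] := avoid_local hd ns (ne s sb); exists d, r, Y.
have step s s' d p1 (r : R) (Y : set M) : 0 <= s <= b -> s' <= s + r -> 0 < r -> nbhs y0 Y ->
    (forall p q (sig : R), near_state d p1 r p -> 0 <= sig <= r -> flow H sig p q -> ~ Y (base q)) ->
    cdom d (base (g s)) -> (exists2 r' : R, 0 < r' & forall p, near_state d (g s) r' p -> near_state d p1 r p) ->
    (0 < s -> P s) -> P s'.
  move=> sb sr r0 hY h ds [r' r'0 hr'] Ps.
  have s0 : 0 <= s by case/andP: sb.
  have fl : flow H s (g 0) (g s).
    by have := bichar_flow hH hg (lexx 0) s0 (andP sb).2; rewrite subr0.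
  have [e [e0 he]] := evolution_near (flow_tame hH s0 fl gc ds) gc fl r'0.
  have [rs [Ys [rs0 hYs hs]]] : exists (r : R) (Y : set M), [/\ 0 < r, nbhs y0 Y & forall t p q,
      0 <= t < s -> near_state c (g 0) r p -> flow H t p q -> ~ Y (base q)].
    have [->|sn] := eqVneq s 0.
      by exists 1, setT; split=> // [|t p q /andP[/le_lt_trans h' /h']]; [exact: filterT|rewrite ltxx].
    have [|rs [Ys [rs0 hYs hs]]] := Ps; first by rewrite lt_neqAle eq_sym sn.
    by exists rs, Ys; split=> // t p q /andP[t0 /ltW ts]; apply: hs; rewrite t0.
  exists (Num.min e rs), (Y `&` Ys); split; [by rewrite lt_min e0|exact: filterI|].
  move=> t p q /andP[t0 ts] [pc]; rewrite lt_min => /andP[p1e p1s] flq [Yq Ysq].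
  have [tls|stl] := ltP t s; first by apply: (hs t p q) => //; rewrite t0.
  move: flq; rewrite -(subrK s t) addrC => flq.
  have [|q1 fl1 fl2] := flow_split hH s0 _ flq; first by rewrite subr_ge0.
  apply: (h q1 q (t - s)) => //; first exact/hr'/(he p q1).
  by rewrite subr_ge0 stl lerBlDl (le_trans ts).
suff : P b by [].
apply: (@real_induction _ 0 b P _ _ b); last by rewrite b0 lexx.
  move=> t tb IH; have [d [r [Y [td r0 hY h]]]] := loc t tb.
  have [t0|t0] := eqVneq t 0.
    apply: (step t t d (g t) r Y) => //; [by rewrite lerDl ltW|by exists r|].
    by rewrite t0 ltxx.
  have tpb : 0 < t <= b by rewrite lt_neqAle eq_sym t0; case/andP: tb => -> ->.
  have r2 : 0 < r / 2 by rewrite divr_gt0.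
  have [s [s0 st tr [ds gs]]] := bichar_near_left hg tpb td r2.
  have sb : 0 <= s <= b by rewrite s0 (le_trans (ltW st))//; case/andP: tb.
  have rr : r / 2 <= r by rewrite ler_pdivrMr// ler_pMr// ler1n.
  apply: (step s t d (g t) r Y) => //; first by rewrite -lerBlDl (le_trans (ltW tr)).
    exists (r / 2) => // p [pd pr]; split=> //.
    rewrite (_ : state d p - _ = (state d p - state d (g s)) + (state d (g s) - state d (g t)));
      last by module_eq.
    by rewrite (le_lt_trans (ler_normD _ _))// [ltRHS](splitr r) ltrD.
  by move=> sp; apply: IH; rewrite s0.
move=> t tb IH; have tb' : 0 <= t <= b by case/andP: tb => -> /ltW.
have [d [r [Y [td r0 hY h]]]] := loc t tb'.
exists r => // s /andP[ts sr] sb.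
apply: (step t s d (g t) r Y) => //; [exact: ltW|by exists r|].
by move=> t0; apply: IH; rewrite lexx andbT ltW.
Qed.

(** Near the end point the first coordinate decreases at a definite rate, so that a
    neighbour continued for the time e would have a negative first coordinate. *)
Lemma flow_exits c d g (b e : R) : bicharacteristic H 0 b g -> 0 <= b -> cdom c (base (g 0)) ->
  cdom d (base (g b)) -> coord0 (cmap d (base (g b))) = 0 -> coord0 (H_xi H d (g b)) < 0 -> 0 < e ->
  exists r : R, 0 < r /\ forall t p q, near_state c (g 0) r p -> b + e <= t -> ~ flow H t p q.
Proof.
move=> hg b0 gc gd z0; set k := coord0 _ => k0 e0.
have bb : 0 <= b <= b by rewrite b0 lexx.
have fl : flow H b (g 0) (g b) by have := bichar_flow hH hg (lexx 0) b0 (lexx b); rewrite subr0.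
have [nb _] := bichar_at hg bb gd.
have [h [X [K [HK tX hK]]]] := hamiltonian_field hH gd nb.
have K0 : 0 < K := HK.1.
have near0 : near_state d (g b) K^-1 (g b) by split=> //; rewrite subrr normr0 invr_gt0.
have kp : 0 < - k / 2 by rewrite divr_gt0// oppr_gt0.
have [r1 r10 hr1] := tame_near tX erefl kp.
have m0 : 0 < Num.min r1 K^-1 by rewrite lt_min r10 invr_gt0.
have [r2 [r20 stays]] := bichar_stays hH gd nb m0.
pose sig := Num.min e r2; have s0 : 0 < sig by rewrite lt_min e0.
have s00 := ltW s0; have se : sig <= e by rewrite ge_min lexx.
have sr2 : sig <= r2 by rewrite ge_min lexx orbT.
have r30 : 0 < Num.min r2 (sig * (- k / 2) / 2) by rewrite lt_min r20 divr_gt0// mulr_gt0.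
have [r [r0 hr]] := evolution_near (flow_tame hH b0 fl gc gd) gc fl r30.
exists r; split=> // t p q np bt; rewrite -(subrK b t) addrC.
have tb : sig <= t - b by rewrite (le_trans se)// lerBrDl.
move=> /(flow_split hH b0)[|q1 fl1]; first exact: le_trans tb.
rewrite -(subrK sig (t - b)) addrC => /(flow_split hH s00)[|q2 fl2 _]; first by rewrite subr_ge0.
have [q1d] := hr p q1 np fl1; rewrite lt_min => /andP[q1r q1k].
have /(flowP _ _ _ s00)[g1 [hg1 g10 g1s]] := fl2.
have nn t' : 0 <= t' <= sig -> near_state d (g b) (Num.min r1 K^-1) (g1 t').
  by apply: (stays g1 sig) => //; rewrite ?s00// g10.
have D : deriv_on 0 sig (state d \o g1) (X \o (state d \o g1)).
  apply: deriv_on_ext (bichar_deriv (lexx _) (lexx _) hg1 (fun t tb => (nn t tb).1)).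
  move=> t' /nn[t'd]; rewrite lt_min => /andP[_ tK]; split=> //=.
  by have [|_ _ _ ->] := hK (g1 t'); split.
have a1 : 0 <= sig <= sig by rewrite s00 lexx. have a2 : 0 <= (0 : R) <= sig by rewrite lexx.
have := mean_value_affine (c := X (state d (g b))) (K := - k / 2) D a1 a2.
move=> /(_ _); rewrite /= g10 g1s subr0 (gtr0_norm s0) => h1.
have {h1} : `|state d q2 - state d q1 - sig *: X (state d (g b))| <= - k / 2 * sig.
  apply: h1 => t' tb' _; apply/ltW/(hr1 (state d (g1 t')) _ _ erefl).
  by have [_] := nn t' tb'; rewrite lt_min => /andP[].
have [_ _ _ <-] := hK _ near0.
move=> h1; have := le_trans (coord0_bound _) (le_trans (pair_fst_le _) h1); rewrite /=.
rewrite !(islinearB coord0_linear) (islinearZ coord0_linear) -/k -[_ *: _]/(_ * _).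
have := le_lt_trans (le_trans (coord0_bound _) (pair_fst_le _)) q1k.
rewrite /= (islinearB coord0_linear) z0 subr0 => /ltr_normlP[_ h3] /ler_normlP[_ h4].
have q2d : cdom d (base q2) by rewrite -g1s; have [] := nn sig a1.
have h5 := chart_coord0_ge0 (chart_image_map q2d).
have h6 : sig * k < 0 by rewrite pmulr_rlt0.
by move: h3 h4 h5 h6; rewrite mulrAC mulNr mulrN -/k; set x := coord0 _; set y := coord0 _; nra.
Qed.

End hits.

(** * The scattering relation *)

Section scattering_relation.
Context {R : realType} {n : nat} {M : topologicalType} {A : smooth_manifold R n M}
  (H : cotangent A -> R).
Hypothesis hH : hamiltonian_conditions H.
Local Notation V := 'rV[R]_n.
Local Notation E := (V * V)%type.
Implicit Types (c d : chart A) (p q : cotangent A) (g : R -> cotangent A).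

(** Earlier than T0 - e the neighbours of g are still away from its end point, and
    later than T0 + e they have left M. *)
Lemma hitting_time c g (T0 e : R) rho : boundary_defining A rho -> 0 < T0 -> 0 < e ->
  bicharacteristic H 0 T0 g -> cdom c (base (g 0)) -> boundary A (base (g T0)) ->
  hits_transversally H rho (g T0) ->
  (forall t, 0 <= t < T0 -> base (g t) <> base (g T0)) ->
  exists (r : R) (Y : set M), [/\ 0 < r, nbhs (base (g T0)) Y & forall t p q,
    0 < t -> near_state c (g 0) r p -> flow H t p q -> Y (base q) -> `|t - T0| < e].
Proof.
move=> hrho T00 e0 hg gc bT tr ne; have [d gd] := cdom_cover A (base (g T0)).
have k0 := transversal_end hrho hg T00 bT gd (tr d gd).
have [r1 [r10 exits]] := flow_exits hH hg (ltW T00) gc gd (boundary_chart bT gd) k0 e0.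
pose b : R := T0 - Num.min e T0.
have m0 : 0 < Num.min e T0 by rewrite lt_min e0.
have b0 : 0 <= b by rewrite subr_ge0 ge_min lexx orbT.
have bT0 : b < T0 by rewrite gtrBl.
have be : T0 - e <= b by rewrite lerD2l lerN2 ge_min lexx.
have [|r2 [Y [r20 hY avoids]]] := flow_avoids hH (bichar_sub (lexx 0) (ltW bT0) hg) b0 gc (y0 := base (g T0)).
  by move=> t /andP[t0 tb]; apply: ne; rewrite t0 (le_lt_trans tb).
exists (Num.min r1 r2), Y; split=> //; first by rewrite lt_min r10.
move=> t p q t0 [pc]; rewrite lt_min => /andP[p1 p2] fl Yq.
rewrite ltNge; apply/negP; rewrite ler_normr => /orP[h|h].
  by apply: (exits t p q) fl => //; rewrite -lerBrDl.
apply: (avoids t p q _ _ fl Yq) => //; rewrite (ltW t0) (le_trans _ be)//.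
by rewrite lerBrDl -lerBrDr -opprB.
Qed.

Theorem scattering_graph p0 q0 (T0 : R) (T : M -> M -> R) (U V' : set M) (rho : M -> R)
    (b0 e0 : bcotangent A) :
  unit_covector H p0 -> 0 < T0 -> flow H T0 p0 q0 ->
  not_conjugate H (covector_scale T0 p0) (base q0) ->
  local_travel_time H p0 (base q0) T0 T ->
  open_in_boundary A U -> open_in_boundary A V' -> U `&` V' = set0 ->
  boundary_defining A rho -> U (base p0) -> V' (base q0) ->
  incoming H rho p0 -> hits_transversally H rho q0 ->
  (forall t q, 0 < t < T0 -> flow H t p0 q -> ~ V' (base q)) ->
  restricts p0 b0 -> restricts q0 e0 ->
  exists2 W1 : set (cotangent A), nbhs_cotangent p0 W1 &
  forall W, nbhs_cotangent p0 W -> W `<=` W1 ->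
  exists N1 N2 : set (bcotangent A),
    [/\ nbhs_bcotangent b0 N1, nbhs_bcotangent e0 N2,
        forall b, N1 b -> exists2 p,
          [/\ W p, unit_covector H p & restricts p b] &
          forall p', W p' -> unit_covector H p' -> restricts p' b -> p' = p &
        forall b1 b2, N1 b1 -> N2 b2 ->
          (canonical_graph T U V' b1 b2 <-> scattering H rho U V' W b1 b2)].
Proof.
move=> up T00 fl nc [WT [hWT [e1 e10 hT]]] [OU _ UE] [OV _ VE] UV hrho Up Vq inc tr first res0 rese.
have [sm _ _ _] := hrho.
have bp : boundary A (base p0) by move: Up; rewrite UE => -[].
have bq : boundary A (base q0) by move: Vq; rewrite VE => -[].
have [c hc] := cdom_cover A (base p0); have [d hd] := cdom_cover A (base q0).
have [n0 nq] := flow_nonzero (ltW T00) fl.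
have k0 : coord0 (H_xi H c p0) != 0.
  by apply: (drho_Hxi_neq0 hrho bp hc); rewrite gt_eqF// inc.
have [r1 [r10 [uniq lift]]] := boundary_lift hH up res0 hc k0.
have /(flowP _ _ _ (ltW T00))[g [hg g0 gT]] := fl.
have [r2 [r20 hits]] := drho_Hxi_near hH sm hd nq (tr d hd).
have [dl [dl0 hdl]] := flow_near hH T00 fl hc hd r20.
have [r3 [Y [r30 hY time]]] : exists (r : R) (Y : set M), [/\ 0 < r, nbhs (base q0) Y & forall t p q,
    0 < t -> near_state c p0 r p -> flow H t p q -> Y (base q) -> `|t - T0| < e1].
  rewrite -g0 -gT; apply: (hitting_time hrho T00 e10 hg); rewrite ?g0 ?gT//.
  move=> t /andP[t0 tT] bE; have [tz|tz] := eqVneq t 0.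
    have : (U `&` V') (base q0) by split=> //; rewrite -bE tz g0.
    by rewrite UV.
  have tp : 0 < t by rewrite lt_neqAle eq_sym tz.
  apply: (first t (g t)); rewrite ?tp ?bE//.
  by have := bichar_flow hH hg (lexx 0) t0 (ltW tT); rewrite subr0 g0.
exists (WT `&` near_state c p0 r1).
  by apply: nbhs_cotangentI => //; exact: (@state_nbhs_cotangent _ _ _ _ p0 _ c r1).
move=> W hW WW.
(* (a) for covectors so close to p0 that they hit the boundary transversally *)
have hW' : nbhs_cotangent p0 (W `&` near_state c p0 dl).
  by apply: nbhs_cotangentI => //; exact: (@state_nbhs_cotangent _ _ _ _ p0 _ c dl).
have [U1 [V1 [hU1 hV1 TD]]] :=
  nbhs_prodP (travel_differential hH up T00 fl nc hWT e10 hT hW' dl0).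
have ee : 0 < e1 <= e1 by rewrite e10 lexx.
have [U2 [V2 [hU2 hV2 TU]]] := nbhs_prodP (hT WT e1 hWT (@subset_refl _ WT) ee).
have [rW [rW0 hrW]] := nbhs_cotangent_state hW hc.
have m0 : 0 < Num.min rW r3 by rewrite lt_min rW0.
have [e [ep hlift]] := lift _ m0.
have [d1 d10 hd1] := cmap_near_inv hc (filterI hU1 hU2).
have [d2 d20 hd2] := cmap_near_inv hd (filterI (filterI hV1 hV2) hY).
have [b0E _] := res0; have [e0E _] := rese.
pose N1 (b : bcotangent A) := [/\ cdom c (bbase b),
  `|cmap c (bbase b) - cmap c (bbase b0)| < Num.min e d1 & `|bcomp b c - bcomp b0 c| < Num.min e d1].
pose N2 (b : bcotangent A) := cdom d (bbase b) /\ `|cmap d (bbase b) - cmap d (bbase e0)| < d2.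
have liftN b : N1 b -> exists p, [/\ near_state c p0 (Num.min rW r3) p, unit_covector H p & restricts p b].
  move=> [bc]; rewrite !lt_min => /andP[b1 _] /andP[b2 _]; exact: hlift.
have UN b : N1 b -> U1 (bbase b) /\ U2 (bbase b).
  by move=> [bc]; rewrite -b0E lt_min => /andP[_ b1] _; apply: hd1.
have VN b : N2 b -> [/\ V1 (bbase b), V2 (bbase b) & Y (bbase b)].
  by move=> [bd]; rewrite -e0E => b1; have [[]] := hd2 _ bd b1.
have WN p : near_state c p0 (Num.min rW r3) p -> W p.
  by move=> [pc]; rewrite lt_min => /andP[pW _]; apply: hrW.
have Wuniq p p' b : W p -> W p' -> unit_covector H p -> unit_covector H p' -> restricts p b ->
    restricts p' b -> p' = p.
  by move=> /WW[_ n1] /WW[_ n2]; exact: uniq.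
exists N1, N2; split.
- exists c; first by rewrite -b0E.
  exists (Num.min e d1); first by rewrite lt_min ep.
  by move=> b bc b1 b2; split.
- exists d; first by rewrite -e0E.
  by exists d2 => // b bd b1 _; split.
- move=> b /liftN[p [np pu res]]; exists p; first by split=> //; exact: WN.
  move=> p' Wp' pu' res'; exact: (Wuniq p p' b (WN _ np)).
move=> b1 b2 Nb1 Nb2; have [U1b U2b] := UN _ Nb1; have [V1b V2b Yb] := VN _ Nb2.
have [P [Q [[[WP nP] WTP uP] [bP bQ] [tdl te1 t0] flPQ [dP dQ]]]] := TD _ _ U1b V1b.
rewrite /= in bP bQ tdl te1 t0 flPQ dP dQ; set t := T _ _ in tdl te1 t0 flPQ.
(* P and Q are the covectors of the bicharacteristic that defines T *)
split=> [[Ub Vb [p [q [[pE qE] dp dq resp resq]]]]|].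
- rewrite pE qE in dp dq.
  have EP : p = covector_scale (-1) P by apply: is_differential_unique dp dP _; rewrite /= bP.
  have EQ : q = Q by apply: is_differential_unique dq dQ _; rewrite bQ.
  rewrite EP covector_scale_scale mulrNN mulr1 covector_scale1 in resp; rewrite EQ in resq.
  split=> //; exists P, Q, t; split=> //; split=> //; first by rewrite bQ.
  have nQ := hdl P Q t nP tdl flPQ.
  move=> d' hd'; have [Qd _] := nQ.
  by rewrite -(drho_Hxi_chart sm t0 flPQ Qd hd'); exact: hits.
move=> [Ub [p [q [s [[Wp pu resp] s0 flpq [Vb _ resq]]]]]].
have [pl [npl ul resl]] := liftN b1 Nb1.
have pE : pl = p by apply: (Wuniq p pl b1) => //; exact: WN.
have [bpE _] := resp; have [bqE _] := resq.
have sT : `|s - T0| < e1.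
  apply: (time s p q) => //; last by rewrite bqE.
  by case: npl => plc; rewrite lt_min pE => /andP[_ ?]; split=> //; rewrite -pE.
have [p1 _ un] := TU _ _ U2b V2b.
have [|pE1 sE] := un p s.
  by split=> //; [have [] := WW p Wp|exists q].
have [|PE tE] := un P t; first by split=> //; exists Q.
have {PE} PE : P = p by rewrite PE pE1.
have {}sE : s = t by [].
rewrite sE in flpq; rewrite PE in flPQ dP.
have qE : Q = q by apply: (flow_unique hH (ltW t0) flPQ flpq).
split=> //; first by rewrite -bqE.
exists (covector_scale (-1) p), q; rewrite covector_scale_scale mulrNN mulr1 covector_scale1.
split=> //=; first by rewrite bqE.
by rewrite bpE -qE.
Qed.

End scattering_relation.

Theorem corollary3p2 (R : realType) (n : nat) (M : topologicalType)
    (A : smooth_manifold R n M) (H : cotangent A -> R)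
    (p0 q0 : cotangent A) (T0 : R) :
  (2 <= n)%N ->
  hamiltonian_conditions H ->
  unit_covector H p0 -> 0 < T0 -> flow H T0 p0 q0 ->
  not_conjugate H (covector_scale T0 p0) (base q0) ->
  (* the travel time is well defined near (x0, y0) *)
  (forall rho : M -> R, boundary_defining A rho ->
    meets_boundary_regularly H rho p0 q0 T0 ->
    exists T, local_travel_time H p0 (base q0) T0 T) /\
  forall T : M -> M -> R, local_travel_time H p0 (base q0) T0 T ->
  (* (a) *)
  (\forall z \near nbhs (base p0, base q0),
    exists p q : cotangent A,
      [/\ base p = z.1 /\ base q = z.2,
          is_differential (fun x => T x z.2) p,
          is_differential (fun y => T z.1 y) q &
          flow H (T z.1 z.2) (covector_scale (-1) p) q]) /\
  (* (b) *)
  (forall (U V : set M) (rho : M -> R) (b0 e0 : bcotangent A),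
    open_in_boundary A U -> open_in_boundary A V -> U `&` V = set0 ->
    boundary_defining A rho ->
    U (base p0) -> V (base q0) ->
    incoming H rho p0 -> hits_transversally H rho q0 ->
    (forall t q, 0 < t < T0 -> flow H t p0 q -> ~ V (base q)) ->
    restricts p0 b0 -> restricts q0 e0 ->
    exists2 W1 : set (cotangent A), nbhs_cotangent p0 W1 &
    forall W, nbhs_cotangent p0 W -> W `<=` W1 ->
    exists N1 N2 : set (bcotangent A),
      [/\ nbhs_bcotangent b0 N1, nbhs_bcotangent e0 N2,
          (* the lift of (x, xi') to S^*M near (x0, xi^0) is unique *)
          forall b, N1 b -> exists2 p,
            [/\ W p, unit_covector H p & restricts p b] &
            forall p', W p' -> unit_covector H p' -> restricts p' b -> p' = p &
          forall b1 b2, N1 b1 -> N2 b2 ->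
            (canonical_graph T U V b1 b2 <-> scattering H rho U V W b1 b2)]).
Proof.
move=> _ hH up T00 fl nc; split.
  by move=> rho hrho reg; exact: (regular_travel_time hH up T00 fl nc hrho reg).
move=> T hT; split; last first.
  move=> U V' rho b0 e0 oU oV UV hrho Up Vq inc tr first res0 rese.
  exact: (scattering_graph hH up T00 fl nc hT oU oV UV hrho Up Vq inc tr first res0 rese).
have [W1 [hW1 [e1 e10 {}hT]]] := hT.
apply: filterS (travel_differential hH up T00 fl nc hW1 e10 hT hW1 ltr01) => z.
move=> [p [q [_ [pE qE] _ flpq [dp dq]]]]; exists (covector_scale (-1) p), q; split=> //.
by rewrite covector_scale_scale mulrNN mulr1 covector_scale1.
Qed.
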